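(* Let $\varphi:\mathbb{R}\to\mathbb{R}$ be continuous and nondecreasing, let $\mu\ge0$ be an even Radon measure on $\mathbb{R}^N\setminus\{0\}$ with $\int_{|z|\le1}|z|^2\mu(\mathrm{d}z)+\int_{|z|>1}\mu(\mathrm{d}z)<\infty$, let $u_0\in L^1(\mathbb{R}^N)\cap L^\infty(\mathbb{R}^N)$, and let $u\in L^1(Q_T)\cap L^\infty(Q_T)\cap C([0,T];L^1_{\mathrm{loc}}(\mathbb{R}^N))$. Then $u$ is an energy solution of $\partial_tu-\mathcal{L}^\mu[\varphi(u)]=0$ in $Q_T$, $u(\cdot,0)=u_0$ on $\mathbb{R}^N$, if and only if it is a distributional solution of this problem.
   Context: $T>0$, $Q_T:=\mathbb{R}^N\times(0,T)$; $\mu$ even means $\mu(B)=\mu(-B)$ for all Borel $B$. The operator is $\mathcal{L}^\mu[\phi](x)=\int_{\mathbb{R}^N\setminus\{0\}}\big(\phi(x+z)-\phi(x)-z\cdot D\phi(x)\mathbf{1}_{|z|\le1}\big)\mu(\mathrm{d}z)$. Set $\mathcal{E}_\mu[f,g]:=\frac12\int_{\mathbb{R}^N}\int_{|z|>0}(f(x+z)-f(x))(g(x+z)-g(x))\,\mu(\mathrm{d}z)\mathrm{d}x$, $|f|_{E_\mu}^2:=\mathcal{E}_\mu[f,f]$, and $L^2(0,T;E_\mu(\mathbb{R}^N)):=\{f:Q_T\to\mathbb{R}\text{ measurable}:\int_0^T|f(\cdot,t)|_{E_\mu}^2\mathrm{d}t<\infty\}$. Energy solution: $u\in L^1_{\mathrm{loc}}(Q_T)$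 with $\varphi(u)\in L^2(0,T;E_\mu(\mathbb{R}^N))$ and, for all $\psi\in C_c^\infty(\mathbb{R}^N\times[0,T))$, $\int_0^T\big(\int_{\mathbb{R}^N}u\,\partial_t\psi\,\mathrm{d}x-\mathcal{E}_\mu[\varphi(u),\psi]\big)\mathrm{d}t+\int_{\mathbb{R}^N}u_0(x)\psi(x,0)\,\mathrm{d}x=0$. Distributional solution: $u\in L^1_{\mathrm{loc}}(Q_T)$ such that, for all $\psi\in C_c^\infty(\mathbb{R}^N\times[0,T))$, $\iint_{Q_T}\big(u\,\partial_t\psi+\varphi(u)\mathcal{L}^\mu[\psi]\big)\mathrm{d}x\mathrm{d}t+\int_{\mathbb{R}^N}u_0(x)\psi(x,0)\,\mathrm{d}x=0$. *)

(* Defs.v *)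
From HB Require Import structures.
From mathcomp Require Import all_boot all_order all_algebra.
From mathcomp Require Import all_classical all_reals all_analysis.
From mathcomp Require Import measurable_realfun.

Set Implicit Arguments.
Unset Strict Implicit.
Unset Printing Implicit Defensive.

Import Order.TTheory GRing.Theory Num.Theory.
Import numFieldNormedType.Exports.

Local Open Scope classical_set_scope.
Local Open Scope ring_scope.

Definition measure_rV_display : measure_display.
Proof. exact: default_measure_display. Qed.

(* R^N is 'rV[R]_N with the sigma-algebra generated by the coordinates, as for
   n.-tuple; measurable_rV_open shows that it is the Borel sigma-algebra. *)
Section measurable_rV.
Context {R : realType} (n : nat).

Let coors : 'I_n -> 'rV[R]_n -> R := fun i v => v ord0 i.

Let rV_set0 : g_sigma_preimage coors set0.
Proof. exact: sigma_algebra0. Qed.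

Let rV_setC A : g_sigma_preimage coors A -> g_sigma_preimage coors (~` A).
Proof. exact: sigma_algebraC. Qed.

Let rV_bigcup (F : _^nat) : (forall i, g_sigma_preimage coors (F i)) ->
  g_sigma_preimage coors (\bigcup_i (F i)).
Proof. exact: sigma_algebra_bigcup. Qed.

HB.instance Definition _ := @isMeasurable.Build measure_rV_display
  ('rV[R]_n) (g_sigma_preimage coors) rV_set0 rV_setC rV_bigcup.

Lemma measurable_coord (i : 'I_n) :
  measurable_fun [set: 'rV[R]_n] (fun v : 'rV[R]_n => v ord0 i).
Proof.
move=> _ Y mY; rewrite setTI; apply: sub_sigma_algebra.
by rewrite -bigcup_seq; exists i => /=; [rewrite mem_index_enum|exists Y; rewrite ?setTI].
Qed.

Lemma measurable_rVP d (T : measurableType d) (f : T -> 'rV[R]_n) :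
  (forall i, measurable_fun setT (fun x => f x ord0 i)) ->
  measurable_fun setT f.
Proof.
move=> mf; apply: (@measurability _ _ _ _ _ _
  (\big[setU/set0]_(i < n) preimage_set_system setT (coors i) measurable)) => //.
move=> _ [C + <-]; rewrite -bigcup_seq => -[i _ [A mA <-]].
by rewrite setTI setTI; have := mf i measurableT _ mA; rewrite setTI.
Qed.

End measurable_rV.

Lemma measurable_rV_open {R : realType} (n : nat) :
  @measurable _ 'rV[R]_n = <<s @open 'rV[R]_n >>.
Proof.
apply/seteqP; split.
  apply: smallest_sub; first exact: smallest_sigma_algebra.
  move=> B; rewrite -bigcup_seq => -[i _ [A mA <-]].
  have mf : measurable_fun [set: g_sigma_algebraType (@open 'rV[R]_n)]
      (fun v : 'rV[R]_n => v ord0 i : R).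
    apply: (@measurability _ _ _ _ _ _ (@RGenOpens.G R)).
      exact: RGenOpens.measurableE.
    move=> _ [_ [x [y ->]] <-]; rewrite setTI; apply: sub_sigma_algebra.
    by apply: open_comp => // v _; exact: coord_continuous.
  exact: mf.
apply: smallest_sub; first exact: sigma_algebra_measurable.
move=> U oU.
pose box (p : 'rV[rat]_n * nat) : set 'rV[R]_n :=
  \bigcap_(i in [set: 'I_n])
    [set v | ball (ratr (p.1 ord0 i) : R) p.2.+1%:R^-1 (v ord0 i)].
have mbox p : measurable (box p).
  apply: fin_bigcap_measurable; first exact: finite_finset.
  move=> i _; rewrite -[X in measurable X]setTI.
  apply: (@measurable_coord R n i); first exact: measurableT.
  exact: measurable_ball.
rewrite (_ : U = \bigcup_p (if `[< box p `<=` U >] then box p else set0)).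
  apply: countable_bigcupT_measurable => // p.
  by case: ifP.
apply/seteqP; split => [v Uv|v [p _]]; last by case: ifPn => // /asboolP; apply.
have /nbhs_ballP[e /= e0 veU] := open_nbhs_nbhs (conj oU Uv).
have e20 : 0 < e / 2 by rewrite divr_gt0.
have [k] := ltr_add_invr e20; rewrite add0r => ke.
have Hq i : exists q : rat, ball (v ord0 i) k.+1%:R^-1 (ratr q : R).
  have : v ord0 i - k.+1%:R^-1 < v ord0 i + k.+1%:R^-1 :> R.
    by rewrite ltrD2l gtrN// invr_gt0.
  move=> /rat_in_itvoo[q]; rewrite in_itv/= => /andP[q1 q2]; exists q.
  by rewrite -ball_normE/= distrC ltr_distl q1 q2.
pose q : 'rV[rat]_n := \row_i projT1 (cid (Hq i)).
exists (q, k) => //; rewrite asboolT.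
  by move=> i _ /=; rewrite mxE; case: cid => x /= /ball_sym.
move=> w qw; apply: veU; split => // a i; rewrite ord1.
rewrite (splitr e); apply: (@pseudometric_structure.ball_triangle R R (ratr (q ord0 i) : R)).
  rewrite mxE; case: cid => x /= vx.
  by apply: le_ball vx; exact: ltW.
by apply: le_ball (qw i I); exact: ltW.
Qed.

Lemma sigma_finite_product d1 d2 (T1 : measurableType d1)
    (T2 : measurableType d2) (R : realType)
    (m1 : {sigma_finite_measure set T1 -> \bar R})
    (m2 : {sigma_finite_measure set T2 -> \bar R}) :
  sigma_finite setT (m1 \x m2)%E.
Proof.
have /sigma_finiteP[F [TF ndF Foo]] := sigma_finiteT m1.
have /sigma_finiteP[G [TG ndG Goo]] := sigma_finiteT m2.
exists (fun n => F n `*` G n).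
  rewrite -setXTT TF TG predeqE => -[x y]; split.
    move=> [/= [n _ Fnx] [k _ Gky]]; exists (maxn n k) => //; split.
    - by move: x Fnx; exact/subsetPset/ndF/leq_maxl.
    - by move: y Gky; exact/subsetPset/ndG/leq_maxr.
  by move=> [n _ []/= ? ?]; split; exists n.
move=> k; have [? ?] := Foo k; have [? ?] := Goo k.
split; first exact: measurableX.
by rewrite product_measure1E// lte_mul_pinfty// ge0_fin_numE.
Qed.

(* Lebesgue measure on R^n: (x, v) |-> row_mx x v identifies R * R^n with
   R^n.+1. *)
Section lebesgue_measure_rV.
Context {R : realType}.

Definition cons_rV (n : nat) (p : R * 'rV[R]_n) : 'rV[R]_n.+1 :=
  row_mx (p.1%:M : 'rV_1) p.2.

Lemma cons_rV0 n (p : R * 'rV[R]_n) : cons_rV p ord0 ord0 = p.1.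
Proof.
rewrite /cons_rV (_ : @ord0 n = lshift n (@ord0 0)); last exact: val_inj.
by rewrite [LHS]row_mxEl !mxE.
Qed.

Lemma cons_rVS n (p : R * 'rV[R]_n) i :
  cons_rV p ord0 (lift ord0 i) = p.2 ord0 i.
Proof.
rewrite /cons_rV (_ : lift (@ord0 n) i = rshift 1 i); last exact: val_inj.
by rewrite [LHS]row_mxEr.
Qed.

Lemma measurable_cons_rV n : measurable_fun setT (@cons_rV n).
Proof.
apply: measurable_rVP => i; case: (unliftP ord0 i) => [j ->|->].
  under eq_fun do rewrite cons_rVS.
  exact: measurableT_comp (@measurable_coord R n j) _.
by under eq_fun do rewrite cons_rV0; exact: measurable_fst.
Qed.

Section step.
Variables (n : nat) (m : {sigma_finite_measure set 'rV[R]_n -> \bar R}).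

Definition lebesgue_rVS : set 'rV[R]_n.+1 -> \bar R :=
  pushforward (lebesgue_measure \x m)%E (@cons_rV n).

Let lebesgue_rVS0 : lebesgue_rVS set0 = 0%E.
Proof. by rewrite /lebesgue_rVS /pushforward preimage_set0 measure0. Qed.

Let lebesgue_rVS_ge0 A : (0 <= lebesgue_rVS A)%E.
Proof. by rewrite /lebesgue_rVS /pushforward measure_ge0. Qed.

Let lebesgue_rVS_sigma_additive : semi_sigma_additive lebesgue_rVS.
Proof.
have mcons A : measurable A -> measurable (@cons_rV n @^-1` A).
  by move=> mA; rewrite -[X in measurable X]setTI; exact: measurable_cons_rV.
move=> F mF tF mUF; rewrite /lebesgue_rVS /pushforward preimage_bigcup.
apply: measure_semi_sigma_additive.
- by move=> k; exact: mcons.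
- apply/trivIsetP => /= i j _ _ ij; rewrite -preimage_setI.
  by move/trivIsetP : tF => /(_ _ _ _ _ ij) ->//; rewrite preimage_set0.
- by rewrite -preimage_bigcup; exact: mcons.
Qed.

HB.instance Definition _ := isMeasure.Build _ _ _ lebesgue_rVS
  lebesgue_rVS0 lebesgue_rVS_ge0 lebesgue_rVS_sigma_additive.

Let lebesgue_rVS_sigma_finite : sigma_finite setT lebesgue_rVS.
Proof.
have [F TF Foo] := sigma_finite_product (@lebesgue_measure R) m.
pose g (v : 'rV[R]_n.+1) : R * 'rV[R]_n :=
  (v ord0 ord0, \row_i v ord0 (lift ord0 i)).
have mg : measurable_fun setT g.
  apply: measurable_fun_pair; first exact: measurable_coord.
  apply: measurable_rVP => i; under eq_fun do rewrite mxE.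
  exact: measurable_coord.
exists (fun k => g @^-1` F k).
  by rewrite -preimage_bigcup -TF preimage_setT.
move=> k; have [mF Fk] := Foo k; split.
  by rewrite -[X in measurable X]setTI; exact: mg.
rewrite /lebesgue_rVS /pushforward -comp_preimage.
rewrite (_ : g \o _ = id) ?preimage_id//.
apply/funext => -[x v] /=; rewrite /g cons_rV0; congr pair.
by apply/rowP => i; rewrite mxE cons_rVS.
Qed.

HB.instance Definition _ := Measure_isSigmaFinite.Build _ _ _ lebesgue_rVS
  lebesgue_rVS_sigma_finite.

End step.

Fixpoint lebesgue_rV n : {sigma_finite_measure set 'rV[R]_n -> \bar R} :=
  if n is n'.+1 then lebesgue_rVS (lebesgue_rV n') else \d_(0 : 'rV[R]_0).

Lemma lebesgue_rV_box n (A : 'I_n -> set R) : (forall i, measurable (A i)) ->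
  lebesgue_rV n [set v : 'rV[R]_n | forall i, A i (v ord0 i)] =
  (\prod_(i < n) lebesgue_measure (A i))%E.
Proof.
elim: n A => [|n IH] A mA.
  by rewrite big_ord0 /= diracE mem_set// => -[].
rewrite big_ord_recl -(IH (fun i => A (lift ord0 i)))//.
rewrite /= /lebesgue_rVS /pushforward -product_measure1E//; last first.
  rewrite (_ : [set _ | _] = \bigcap_(i in [set: 'I_n])
      [set v : 'rV[R]_n | A (lift ord0 i) (v ord0 i)]); last first.
    by apply/seteqP; split => v /= h i; [move=> _|]; exact: h.
  apply: fin_bigcap_measurable => // i _.
  rewrite -[X in measurable X]setTI.
  by apply: (@measurable_coord R n i) => //.
  exact: mA.
congr (_ _); apply/seteqP; split => [[x v] /= h|[x v] /= [hx hv] i].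
  split; first by have := h ord0; rewrite cons_rV0.
  by move=> i; have := h (lift ord0 i); rewrite cons_rVS.
by case: (unliftP ord0 i) => [j ->|->]; rewrite (cons_rVS, cons_rV0).
Qed.

End lebesgue_measure_rV.

Section lebesgue_Q.
Context {R : realType} {N : nat}.

Definition lebesgue_Q : set ('rV[R]_N * measurableTypeR R) -> \bar R :=
  (lebesgue_rV N \x @lebesgue_measure R)%E.

HB.instance Definition _ := Measure.on lebesgue_Q.

HB.instance Definition _ := Measure_isSigmaFinite.Build _ _ _ lebesgue_Q
  (sigma_finite_product (lebesgue_rV N) (@lebesgue_measure R)).

End lebesgue_Q.

Section nonlocal_operator.
Context {R : realType} {N : nat}.
Implicit Types (T t : R) (x z : 'rV[R]_N).

(* The library norm `|z| on 'rV is the sup norm. *)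
Definition euclidean_norm z : R := Num.sqrt (\sum_(i < N) z ord0 i ^+ 2).

Definition Q_ T : set ('rV[R]_N * R) := [set p | 0 < p.2 < T].

Definition gradient (f : 'rV[R]_N -> R) x : 'rV[R]_N :=
  \row_i 'D_(delta_mx ord0 i : 'rV[R]_N) f x.

Definition dot x z : R := \sum_(i < N) x ord0 i * z ord0 i.

Definition levy_operator (mu : {measure set 'rV[R]_N -> \bar R}) (f : 'rV[R]_N -> R) x
    : R :=
  (\int[mu]_(z in [set z | z != 0])
     (f (x + z) - f x
      - dot z (gradient f x) * (euclidean_norm z <= 1)%R%:R))%R.

Definition energy (mu : {measure set 'rV[R]_N -> \bar R}) (f g : 'rV[R]_N -> R)
    : \bar R :=
  (2^-1%:E * \int[lebesgue_rV N]_x \int[mu]_(z in [set z | z != 0%R])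
     ((f (x + z) - f x) * (g (x + z) - g x))%:E)%E.

(* A Radon measure on R^N \ {0} is represented by its extension to R^N that
   gives no mass to the origin. *)
Definition radon_punctured (mu : {measure set 'rV[R]_N -> \bar R}) : Prop :=
  [/\ mu [set 0] = 0%E,
      forall K : set 'rV[R]_N, compact K -> ~ K 0 -> (mu K < +oo)%E
    & forall B : set 'rV[R]_N, measurable B -> ~ B 0 ->
        mu B = ereal_sup [set mu K | K in [set K | compact K /\ K `<=` B]] ].

Definition even_measure (mu : {measure set 'rV[R]_N -> \bar R}) : Prop :=
  forall B : set 'rV[R]_N, measurable B -> mu B = mu [set - z | z in B].

Definition levy_integrable (mu : {measure set 'rV[R]_N -> \bar R}) : Prop :=
  (\int[mu]_(z in [set z | z != 0%R /\ (euclidean_norm z <= 1)%R])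
     (euclidean_norm z ^+ 2)%:E
   + \int[mu]_(z in [set z | (1 < euclidean_norm z)%R]) 1 < +oo)%E.

(* Elements of the Lebesgue spaces are given by Borel representatives; the
   values of a function on Q_T outside Q_ T are irrelevant. *)
Definition L1loc_rV (f : 'rV[R]_N -> R) : Prop :=
  measurable_fun setT f /\
  forall K, compact K -> (lebesgue_rV N).-integrable K (EFin \o f).

Definition L1loc_Q T (f : 'rV[R]_N * R -> R) : Prop :=
  measurable_fun (Q_ T) f /\
  forall K, compact K -> K `<=` Q_ T -> lebesgue_Q.-integrable K (EFin \o f).

Definition L1_rV (f : 'rV[R]_N -> R) : Prop :=
  (lebesgue_rV N).-integrable setT (EFin \o f).

Definition L1_Q T (f : 'rV[R]_N * R -> R) : Prop :=
  lebesgue_Q.-integrable (Q_ T) (EFin \o f).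

Definition Linfty_rV (f : 'rV[R]_N -> R) : Prop :=
  measurable_fun setT f /\
  exists M : R, {ae lebesgue_rV N, forall x, `|f x| <= M}.

Definition Linfty_Q T (f : 'rV[R]_N * R -> R) : Prop :=
  measurable_fun (Q_ T) f /\
  exists M : R, {ae lebesgue_Q, forall p, Q_ T p -> `|f p| <= M}.

(* v t is a representative of the class u(., t) for almost every t. *)
Definition C_L1loc T (u : 'rV[R]_N * R -> R) : Prop :=
  exists v : R -> 'rV[R]_N -> R,
  [/\ forall t, 0 <= t <= T -> L1loc_rV (v t),
      forall (K : set 'rV[R]_N) t, compact K -> 0 <= t <= T ->
        (\int[lebesgue_rV N]_(x in K) `|(v s x - v t x)%:E|)%E
          @[s --> within `[0, T] (nbhs t)] --> 0%E
    & {ae @lebesgue_measure R, forall t, 0 < t < T ->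
        {ae lebesgue_rV N, forall x, u (x, t) = v t x}} ].

Definition L2_energy T (mu : {measure set 'rV[R]_N -> \bar R})
    (f : 'rV[R]_N * R -> R) : Prop :=
  measurable_fun (Q_ T) f /\
  (\int[@lebesgue_measure R]_(t in `]0%R, T[)
     energy mu (fun x => f (x, t)) (fun x => f (x, t)) < +oo)%E.

(* C^k for finite-dimensional V: continuity of all the directional derivatives
   is equivalent to continuity of the differential. *)
Fixpoint Ck (V : normedModType R) (k : nat) (f : V -> R) : Prop :=
  if k is k'.+1 then
    (forall p, differentiable f p) /\ forall v, Ck k' (fun p => 'D_v f p)
  else continuous f.

(* C_c^oo(R^N * [0, T[): smoothness up to t = 0 is given by a smooth extension
   psi to R^N * R, and only the restriction of psi to R^N * [0, T[ matters. *)
Definition test_function T (psi : 'rV[R]_N * R -> R) : Prop :=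
  (forall k, Ck k psi) /\
  exists K : set ('rV[R]_N * R), [/\ compact K,
    K `<=` [set p | 0 <= p.2 < T] &
    forall p, 0 <= p.2 < T -> ~ K p -> psi p = 0].

Definition dt (psi : 'rV[R]_N * R -> R) (p : 'rV[R]_N * R) : R :=
  derive1 (fun s : R => psi (p.1, s)) p.2.

Definition energy_solution T (mu : {measure set 'rV[R]_N -> \bar R}) (phi : R -> R)
    (u0 : 'rV[R]_N -> R) (u : 'rV[R]_N * R -> R) : Prop :=
  [/\ L1loc_Q T u, L2_energy T mu (phi \o u)
    & forall psi, test_function T psi ->
      (\int[@lebesgue_measure R]_(t in `]0%R, T[)
         (\int[lebesgue_rV N]_x (u (x, t) * dt psi (x, t))%:E
          - energy mu (fun x => phi (u (x, t))) (fun x => psi (x, t)))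
       + \int[lebesgue_rV N]_x (u0 x * psi (x, 0%R))%:E = 0)%E ].

Definition distributional_solution T (mu : {measure set 'rV[R]_N -> \bar R})
    (phi : R -> R) (u0 : 'rV[R]_N -> R) (u : 'rV[R]_N * R -> R) : Prop :=
  L1loc_Q T u /\
  forall psi, test_function T psi ->
    (\int[lebesgue_Q]_(p in Q_ T)
       (u p * dt psi p
        + phi (u p) * levy_operator mu (fun x => psi (x, p.2)) p.1)%:E
     + \int[lebesgue_rV N]_x (u0 x * psi (x, 0%R))%:E = 0)%E.

End nonlocal_operator.

(* Main.v *)
From HB Require Import structures.
From mathcomp Require Import all_boot all_order all_algebra.
From mathcomp Require Import all_classical all_reals all_analysis.
From mathcomp Require Import measurable_realfun.
From mathcomp Require Import ring lra.
Require Import Defs.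

(* If phi(u) has finite energy, the two notions of solution agree: for a test
   function psi, integration by parts in the nonlocal form gives
   E[phi(u), psi] = - <phi(u), L psi>.

   It remains to see that a distributional solution has finite energy. Extend u
   by u0 to negative times, let A f(t) be the average of f(t + s) for the
   density l e^(l s) on s <= 0, and mollify in x. The weak formulation becomes
   the pointwise resolvent equation
     l (u - A u) = L a,  a = A phi(u).
   As a(t) - c a(t - tau), with c = e^(- l tau), is 1 - c times the average of
   phi(u) over [t - tau, t], testing with it bounds E[a, a] by
   - l <phi(u), u - A u> up to an error that vanishes with tau and the
   mollifier. If Phi is the convex primitive of phi, then
   phi(u) (A u - u) <= A Phi(u) - Phi(u), whose integral is controlled by
   that of Phi(u0), uniformly in l. The bound passes to the limit l -> oo by weak
   convergence of the differences of a. *)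

Set Implicit Arguments.
Unset Strict Implicit.
Unset Printing Implicit Defensive.

Import Order.TTheory GRing.Theory Num.Theory.
Import numFieldNormedType.Exports.

Local Open Scope classical_set_scope.
Local Open Scope ring_scope.

(** * Integrals of real functions *)

(** A distributional solution has no regularity in time, so phi(u) cannot serve as a test function.
    The exponential law is chosen because it turns d/dt into the algebraic expression l (u - A u),
    with the initial datum entering as the past of u. Testing with a itself would pair an average
    over the whole past with u - A u, while convexity of Phi needs phi(u) at the same instant. Hence
    the difference of a and its delayed copy: the memoryless property leaves an average over a short
    past, and the delayed term is absorbed, since a vanishes before time 0 and delaying it and
    cutting at T only loses energy. A second obstacle is that phi(u) need not be integrable, phi
    being merely continuous. After subtracting phi(0) it is bounded, and larger than e only on a set
    of finite measure; integration by parts is therefore done on truncations that vanish below e.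
    For given l one small number serves both as width of the mollifier and as tau; the resulting
    bound, twice the integral of Phi(u0) plus 1, depends on neither. *)

Section real_integral.
Context d (T : measurableType d) (R : realType).
Variable m : {measure set T -> \bar R}.
Implicit Types f g : T -> R.

Lemma integrable_measurable f :
  m.-integrable setT (EFin \o f) -> measurable_fun setT f.
Proof. by move=> fi; apply/measurable_EFinP; exact: measurable_int fi. Qed.

Lemma EFin_Rintegral f : m.-integrable setT (EFin \o f) ->
  (\int[m]_x f x)%:E = (\int[m]_x (f x)%:E)%E.
Proof. by move=> fi; rewrite /Rintegral fineK//; exact: integrable_fin_num. Qed.

Lemma le_Rintegrable f g : measurable_fun setT f ->
  (forall x, `|f x| <= g x) -> m.-integrable setT (EFin \o g) ->
  m.-integrable setT (EFin \o f).
Proof.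
move=> mf fg; apply: le_integrable => //; first exact/measurable_EFinP.
by move=> x _ /=; rewrite lee_fin; apply: le_trans (fg x) (ler_norm _).
Qed.

Lemma RintegrableD f g : m.-integrable setT (EFin \o f) ->
  m.-integrable setT (EFin \o g) ->
  m.-integrable setT (EFin \o (fun x => f x + g x)).
Proof. by move=> fi gi; exact: (integrableD _ fi gi). Qed.

Lemma RintegrableB f g : m.-integrable setT (EFin \o f) ->
  m.-integrable setT (EFin \o g) ->
  m.-integrable setT (EFin \o (fun x => f x - g x)).
Proof. by move=> fi gi; exact: (integrableB _ fi gi). Qed.

Lemma RintegrableZl (k : R) f : m.-integrable setT (EFin \o f) ->
  m.-integrable setT (EFin \o (fun x => k * f x)).
Proof. by move=> fi; exact: (integrableZl _ k fi). Qed.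

Lemma Rintegrable_bounded_mull (M : R) f g : measurable_fun setT f ->
  (forall x, `|f x| <= M) -> m.-integrable setT (EFin \o g) ->
  m.-integrable setT (EFin \o (fun x => f x * g x)).
Proof.
move=> mf fM gi; have mg := integrable_measurable gi.
have M0 (x : T) : 0 <= M by rewrite (le_trans _ (fM x)).
have := RintegrableZl M (integrable_norm gi); apply: le_Rintegrable.
  exact: measurable_funM.
by move=> x; rewrite normrM ler_wpM2r.
Qed.

Lemma RintegrableE f : measurable_fun setT f ->
  (\int[m]_x `|f x|%:E < +oo)%E -> m.-integrable setT (EFin \o f).
Proof. by move=> mf foo; apply/integrableP; split => //; exact/measurable_EFinP. Qed.

Lemma ge0_RintegrableE f : measurable_fun setT f -> (forall x, 0 <= f x) ->
  (\int[m]_x (f x)%:E < +oo)%E -> m.-integrable setT (EFin \o f).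
Proof.
move=> mf f0 foo; apply: RintegrableE => //.
by under eq_integral do rewrite ger0_norm//.
Qed.

Lemma ae_eq_Rintegrable f g : measurable_fun setT g ->
  {ae m, forall x, f x = g x} -> m.-integrable setT (EFin \o f) ->
  m.-integrable setT (EFin \o g).
Proof.
move=> mg fg fi; have mf := integrable_measurable fi.
apply: RintegrableE => //; move/integrableP : fi => [_]; congr (_ < _)%E.
apply: ae_eq_integral => //; [exact/measurable_EFinP/measurableT_comp..|].
by apply: filterS fg => x /= -> _.
Qed.

Lemma ae_eq_Rintegral f g : measurable_fun setT f -> measurable_fun setT g ->
  {ae m, forall x, f x = g x} -> \int[m]_x f x = \int[m]_x g x.
Proof.
move=> mf mg fg; rewrite /Rintegral; congr fine; apply: ae_eq_integral => //.
- exact/measurable_EFinP.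
- exact/measurable_EFinP.
- by apply: filterS fg => x /= -> _.
Qed.

End real_integral.

Section real_fubini.
Context d1 d2 (T1 : measurableType d1) (T2 : measurableType d2) (R : realType).
Variable m1 : {sigma_finite_measure set T1 -> \bar R}.
Variable m2 : {sigma_finite_measure set T2 -> \bar R}.

(** [fine] gives 0 on the null set of slices without a finite integral, so the real inner integral
    agrees almost everywhere with the extended one, to which Fubini's theorem applies. *)
Lemma Rfubini1 (f : T1 * T2 -> R) :
  (m1 \x m2)%E.-integrable setT (EFin \o f) ->
  m1.-integrable setT (EFin \o (fun x => \int[m2]_y f (x, y))) /\
  \int[m1]_x (\int[m2]_y f (x, y)) = \int[(m1 \x m2)%E]_p f p.
Proof.
move=> fi; have mF := measurable_fubini_F fi; have iF := integrable_fubini_F fi.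
have aeF : {ae m1, forall x, setT x ->
    fubini_F m2 (EFin \o f) x = (EFin \o (fun x => \int[m2]_y f (x, y))) x}.
  apply: filterS (ae_integrable1 fi) => x fx _ /=.
  by rewrite /Rintegral fineK//; exact: integrable_fin_num.
have mf : measurable_fun setT (EFin \o (fun x => \int[m2]_y f (x, y))).
  apply/measurable_EFinP; rewrite /Rintegral.
  exact: measurableT_comp mF.
split.
  apply/integrableP; split => //; move/integrableP : iF => [_].
  congr (_ < _)%E; apply: ae_eq_integral => //.
  - exact: measurableT_comp.
  - exact: measurableT_comp.
  - by apply: filterS aeF => x /(_ I) /= -> .
rewrite [LHS]/Rintegral [RHS]/Rintegral -integral12_prod_meas1//; congr fine.
by apply/esym/ae_eq_integral.
Qed.

Lemma Rfubini2 (f : T1 * T2 -> R) :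
  (m1 \x m2)%E.-integrable setT (EFin \o f) ->
  m2.-integrable setT (EFin \o (fun y => \int[m1]_x f (x, y))) /\
  \int[m2]_y (\int[m1]_x f (x, y)) = \int[(m1 \x m2)%E]_p f p.
Proof.
move=> fi; have mF := measurable_fubini_G fi.
have mfe : measurable_fun setT (EFin \o f) by exact: measurable_int fi.
have aeF : {ae m2, forall x, setT x ->
    fubini_G m1 (EFin \o f) x = (EFin \o (fun y => \int[m1]_x f (x, y))) x}.
  apply: filterS (ae_integrable2 fi) => x fx _ /=.
  by rewrite /Rintegral fineK//; exact: integrable_fin_num.
have mf : measurable_fun setT (EFin \o (fun y => \int[m1]_x f (x, y))).
  apply/measurable_EFinP; rewrite /Rintegral.
  exact: measurableT_comp mF.
split.
  apply/integrableP; split => //.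
  rewrite (_ : integral _ _ _ = \int[m2]_y `|fubini_G m1 (EFin \o f) y|)%E; last first.
    apply: ae_eq_integral => //; [exact: measurableT_comp..|].
    by apply: filterS aeF => x /(_ I) /= -> .
  apply: le_lt_trans ((integrable21ltyP m1 m2 mfe).1 fi).
  apply: ge0_le_integral => //.
  - exact: measurableT_comp.
  - apply: (measurable_fun_fubini_tonelli_G (fun p => `|(EFin \o f) p|)%E) => //.
    exact: measurableT_comp.
  - move=> y _; apply: le_abse_integral => //.
    exact: measurableT_comp mfe _.
rewrite [LHS]/Rintegral [RHS]/Rintegral -integral21_prod_meas1//; congr fine.
by apply/esym/ae_eq_integral.
Qed.

(** Tonelli for the positive and the negative part; [fine] keeps measurability where their
    difference is infinite. *)
Lemma measurable_Rintegral2 (f : T1 * T2 -> R) : measurable_fun setT f ->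
  measurable_fun setT (fun x => \int[m2]_y f (x, y)).
Proof.
move=> mf; have mf' : measurable_fun setT (EFin \o f) by exact/measurable_EFinP.
rewrite /Rintegral; apply: (measurableT_comp (f := @fine R)) => //.
rewrite (_ : (fun x => _) = (fun x => \int[m2]_y ((EFin \o f)^\+ (x, y)) -
   \int[m2]_y ((EFin \o f)^\- (x, y)))%E); last first.
  apply/funext => x; rewrite [LHS]integralE.
  by congr (_ - _)%E; apply: eq_integral => y _; rewrite ?funeposE ?funenegE.
apply: emeasurable_funB.
  by apply: (measurable_fun_fubini_tonelli_F ((EFin \o f)^\+)%E) => //;
    exact: measurable_funepos.
by apply: (measurable_fun_fubini_tonelli_F ((EFin \o f)^\-)%E) => //;
    exact: measurable_funeneg.
Qed.

Lemma measurable_Rintegral1 (f : T1 * T2 -> R) : measurable_fun setT f ->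
  measurable_fun setT (fun y => \int[m1]_x f (x, y)).
Proof.
move=> mf; have mf' : measurable_fun setT (EFin \o f) by exact/measurable_EFinP.
rewrite /Rintegral; apply: (measurableT_comp (f := @fine R)) => //.
rewrite (_ : (fun x => _) = (fun y => \int[m1]_x ((EFin \o f)^\+ (x, y)) -
   \int[m1]_x ((EFin \o f)^\- (x, y)))%E); last first.
  apply/funext => y; rewrite [LHS]integralE.
  by congr (_ - _)%E; apply: eq_integral => x _; rewrite ?funeposE ?funenegE.
apply: emeasurable_funB.
  by apply: (measurable_fun_fubini_tonelli_G ((EFin \o f)^\+)%E) => //;
    exact: measurable_funepos.
by apply: (measurable_fun_fubini_tonelli_G ((EFin \o f)^\-)%E) => //;
    exact: measurable_funeneg.
Qed.

Lemma RintegrableX2 (f : T1 * T2 -> R) (k : T1 -> R) : measurable_fun setT f ->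
  (forall x, m2.-integrable setT (EFin \o (fun y => f (x, y)))) ->
  (forall x, \int[m2]_y `|f (x, y)| <= k x) ->
  m1.-integrable setT (EFin \o k) ->
  (m1 \x m2)%E.-integrable setT (EFin \o f).
Proof.
move=> mf fi fk ki; apply/integrable12ltyP; first exact/measurable_EFinP.
move/integrableP : (ki) => [mk]; apply: le_lt_trans; apply: ge0_le_integral => //.
- by move=> x _; exact: integral_ge0.
- apply: (measurable_fun_fubini_tonelli_F (fun p => `|(EFin \o f) p|)%E) => //.
  apply: measurableT_comp => //; exact/measurable_EFinP.
- exact: measurableT_comp.
- move=> x _; rewrite -EFin_Rintegral ?lee_fin; last exact: integrable_norm.
  by rewrite (le_trans (fk x))// ler_norm.
Qed.

Lemma RintegrableX1 (f : T1 * T2 -> R) (k : T2 -> R) : measurable_fun setT f ->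
  (forall y, m1.-integrable setT (EFin \o (fun x => f (x, y)))) ->
  (forall y, \int[m1]_x `|f (x, y)| <= k y) ->
  m2.-integrable setT (EFin \o k) ->
  (m1 \x m2)%E.-integrable setT (EFin \o f).
Proof.
move=> mf fi fk ki; apply/integrable21ltyP; first exact/measurable_EFinP.
move/integrableP : (ki) => [mk]; apply: le_lt_trans; apply: ge0_le_integral => //.
- by move=> x _; exact: integral_ge0.
- apply: (measurable_fun_fubini_tonelli_G (fun p => `|(EFin \o f) p|)%E) => //.
  apply: measurableT_comp => //; exact/measurable_EFinP.
- exact: measurableT_comp.
- move=> x _; rewrite -EFin_Rintegral ?lee_fin; last exact: integrable_norm.
  by rewrite (le_trans (fk x))// ler_norm.
Qed.

Lemma Rintegrable_prodM (k : T1 -> R) (l : T2 -> R) :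
  m1.-integrable setT (EFin \o k) -> m2.-integrable setT (EFin \o l) ->
  (m1 \x m2)%E.-integrable setT (EFin \o (fun p => k p.1 * l p.2)).
Proof.
move=> ik il.
have mk := integrable_measurable ik; have ml := integrable_measurable il.
apply: (RintegrableX2 (k := fun x => (\int[m2]_y `|l y|) * `|k x|)).
- by apply: measurable_funM; exact: measurableT_comp.
- by move=> x /=; exact: RintegrableZl.
- move=> x /=; under eq_Rintegral do rewrite normrM.
  by rewrite RintegralZl 1?mulrC//; exact: integrable_norm.
- by apply: RintegrableZl; exact: integrable_norm.
Qed.

Lemma Rfubini (f : T1 * T2 -> R) :
  (m1 \x m2)%E.-integrable setT (EFin \o f) ->
  \int[m1]_x (\int[m2]_y f (x, y)) = \int[m2]_y (\int[m1]_x f (x, y)).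
Proof. by move=> fi; rewrite (Rfubini1 fi).2 (Rfubini2 fi).2. Qed.

End real_fubini.

(** * Translations *)

Section measure_preserving.
Context d (T : measurableType d) (R : realType).
Variable m : {measure set T -> \bar R}.

(** Measure preservation is stated through integrals of nonnegative functions because this form
    passes through Tonelli's theorem, one factor at a time. *)
Definition mpres (t : T -> T) := measurable_fun setT t /\
  forall f : T -> \bar R, measurable_fun setT f -> (forall x, 0 <= f x)%E ->
    (\int[m]_x f (t x) = \int[m]_x f x)%E.

Variables (t : T -> T) (ht : mpres t).

Lemma mpres_integrable (f : T -> R) : m.-integrable setT (EFin \o f) ->
  m.-integrable setT (EFin \o (f \o t)).
Proof.
move=> /integrableP[mf foo]; have [mt it] := ht.
apply/integrableP; split; first exact: (measurableT_comp mf mt).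
rewrite (_ : integral _ _ _ = \int[m]_x `|(EFin \o f) (t x)|)%E; last by [].
by rewrite (it (fun x => `|(EFin \o f) x|)%E)//; exact: measurableT_comp.
Qed.

Lemma mpres_integral (f : T -> R) : measurable_fun setT f ->
  (\int[m]_x (f (t x))%:E = \int[m]_x (f x)%:E)%E.
Proof.
move=> /measurable_EFinP mf; have [mt it] := ht; rewrite [LHS]integralE [RHS]integralE.
rewrite -(it ((EFin \o f)^\+)%E)//; last exact: measurable_funepos.
rewrite -(it ((EFin \o f)^\-)%E)//; last exact: measurable_funeneg.
by congr (_ - _)%E; apply: eq_integral => x _; rewrite ?funeposE ?funenegE.
Qed.

Lemma mpres_Rintegral (f : T -> R) : measurable_fun setT f ->
  \int[m]_x f (t x) = \int[m]_x f x.
Proof. by move=> mf; rewrite /Rintegral mpres_integral. Qed.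

End measure_preserving.

Section translation_invariance.
Context {R : realType}.

Lemma mpres_lebesgue_shift (s : R) :
  mpres (@lebesgue_measure R) (fun x : measurableTypeR R => x + s : measurableTypeR R).
Proof.
have ms : measurable_fun setT (fun x : measurableTypeR R => x + s : measurableTypeR R).
  exact: measurable_funD.
split => // f mf f0.
rewrite -(ge0_integral_pushforward ms _ measurableT)//.
apply: eq_measure_integral => A mA _; apply/esym/lebesgue_measure_unique => //= _ [[a b]] _ <-.
rewrite /pushforward/= (_ : _ @^-1` _ = `]a - s, b - s]%classic); last first.
  by apply/seteqP; split => x /=; rewrite !in_itv/= ltrBlDr lerBrDr.
rewrite !lebesgue_measure_itv/= !lte_fin ltrD2r.
by case: ifP => // _; rewrite -!EFinB; congr EFin; lra.
Qed.

Lemma measurable_rVD n d (T : measurableType d) (f g : T -> 'rV[R]_n) :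
  measurable_fun setT f -> measurable_fun setT g ->
  measurable_fun setT (fun x => f x + g x).
Proof.
move=> mf mg; apply: measurable_rVP => i; under eq_fun do rewrite mxE.
by apply: measurable_funD; apply: (measurableT_comp (@measurable_coord R n i)).
Qed.

Lemma measurable_rVN n d (T : measurableType d) (f : T -> 'rV[R]_n) :
  measurable_fun setT f -> measurable_fun setT (fun x => - f x).
Proof.
move=> mf; apply: measurable_rVP => i; under eq_fun do rewrite mxE.
by apply: measurableT_comp => //; apply: (measurableT_comp (@measurable_coord R n i)).
Qed.

(** Induction on the dimension: [cons_rV] splits off the first coordinate, and Tonelli reduces a
    translation to one in R and one in dimension n. In dimension 0 a translation is the identity. *)
Lemma mpres_rV_shift n (z : 'rV[R]_n) : mpres (lebesgue_rV n) (fun x => x + z).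
Proof.
elim: n z => [|n IH] z.
  rewrite (_ : (fun x => _) = id); first by split.
  by apply/funext => x; apply/rowP => -[].
have mz : measurable_fun setT (fun x : 'rV[R]_n.+1 => x + z).
  exact: measurable_rVD.
split => // f mf f0.
pose z' := \row_i z ord0 (lift ord0 i) : 'rV[R]_n.
have consD (p : measurableTypeR R * 'rV[R]_n) :
    cons_rV p + z = cons_rV (p.1 + z ord0 ord0, p.2 + z').
  apply/rowP => i; rewrite mxE; case: (unliftP ord0 i) => [j ->|->].
    by rewrite !cons_rVS !mxE.
  by rewrite !cons_rV0.
have mc : measurable_fun [set: measurableTypeR R * 'rV[R]_n]
    (@cons_rV R n : measurableTypeR R * 'rV[R]_n -> 'rV[R]_n.+1).
  exact: measurable_cons_rV.
have mfc : measurable_fun setT (fun p : measurableTypeR R * 'rV[R]_n => f (cons_rV p)).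
  exact: (measurableT_comp mf mc).
have push (g : 'rV[R]_n.+1 -> \bar R) : measurable_fun setT g -> (forall x, 0 <= g x)%E ->
    (\int[lebesgue_rV n.+1]_x g x =
     \int[@lebesgue_measure R]_x \int[lebesgue_rV n]_y g (cons_rV (x, y)))%E.
  move=> mg g0.
  have h := @ge0_integral_pushforward _ _ _ _ R _ mc (lebesgue_measure \x lebesgue_rV n)%E setT g measurableT mg (fun x _ => g0 x).
  transitivity (\int[(lebesgue_measure \x lebesgue_rV n)%E]_x (g \o cons_rV (n:=n)) x)%E.
    by rewrite preimage_setT in h; rewrite -[RHS]h.
  rewrite fubini_tonelli1 => [//||p]; first exact: (measurableT_comp mg mc).
  exact: g0.
rewrite push//; last exact: measurableT_comp mf mz.
rewrite push//.
transitivity (\int[@lebesgue_measure R]_x \int[lebesgue_rV n]_y f (cons_rV ((x + z ord0 ord0)%R, y)))%E.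
  apply: eq_integral => x _; under eq_integral do rewrite consD.
  have [_ h] := IH z'; rewrite (h (fun y => f (cons_rV (x + z ord0 ord0, y))))//=.
  by apply: (measurableT_comp mfc) => //=; exact: measurable_fun_pair.
have [_ h] := mpres_lebesgue_shift (z ord0 ord0).
apply: (h (fun x => \int[lebesgue_rV n]_y f (cons_rV (x, y)))%E).
  exact: (measurable_fun_fubini_tonelli_F (fun p => f (cons_rV p))).
by move=> x; apply: integral_ge0 => y _; exact: f0.
Qed.

Variable N : nat.
Notation Om := ('rV[R]_N * measurableTypeR R)%type.

Definition sh (p : Om) (w : Om) : Om := (w.1 + p.1, w.2 + p.2).

Lemma measurable_sh2 : measurable_fun setT (fun q : Om * Om => sh q.1 q.2).
Proof.
apply: measurable_fun_pair => /=.
  by apply: measurable_rVD; apply: measurableT_comp.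
by apply: measurable_funD; apply: measurableT_comp.
Qed.

Lemma measurable_sh p : measurable_fun setT (sh p).
Proof.
apply: (measurableT_comp measurable_sh2 (_ : measurable_fun setT (fun w => (p, w)))).
exact: measurable_fun_pair.
Qed.

Lemma mpres_sh p : mpres lebesgue_Q (sh p).
Proof.
have msh := measurable_sh p.
split => // f mf f0.
have ton (g : Om -> \bar R) : measurable_fun setT g -> (forall x, 0 <= g x)%E ->
    (\int[lebesgue_Q]_x g x =
     \int[lebesgue_rV N]_x \int[@lebesgue_measure R]_y g (x, y))%E.
  by move=> mg g0; rewrite /lebesgue_Q fubini_tonelli1.
rewrite ton//; last exact: measurableT_comp mf msh.
rewrite ton//.
transitivity (\int[lebesgue_rV N]_x \int[@lebesgue_measure R]_y f ((x + p.1)%R, y))%E.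
  apply: eq_integral => x _; have [_ h] := mpres_lebesgue_shift p.2.
  rewrite -[RHS](h (fun y => f (x + p.1, y)))//=.
  by apply: (measurableT_comp mf); exact: measurable_fun_pair.
have [_ h] := mpres_rV_shift p.1.
apply: (h (fun x => \int[@lebesgue_measure R]_y f (x, y))%E).
  exact: (measurable_fun_fubini_tonelli_F f).
by move=> x; apply: integral_ge0 => y _; exact: f0.
Qed.

Lemma sh0 : sh (0, 0) = id.
Proof. by apply/funext => -[x t]; rewrite /sh/= !addr0. Qed.

Lemma shA p q w : sh p (sh q w) = sh (q.1 + p.1, q.2 + p.2) w.
Proof. by rewrite /sh/= !addrA. Qed.

End translation_invariance.

(** * Borel sets of the product of space and time *)

Section product_borel.
Context {R : realType} {N : nat}.
Notation Om := ('rV[R]_N * measurableTypeR R)%type.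

Lemma measurable_snoc_rV :
  measurable_fun setT (fun p : Om => cons_rV (p.2, p.1)).
Proof.
apply: measurable_rVP => i; case: (unliftP ord0 i) => [j ->|->].
  under eq_fun do rewrite cons_rVS.
  by apply: (measurableT_comp (@measurable_coord R N j)); exact: measurable_fst.
by under eq_fun do rewrite cons_rV0; exact: measurable_snd.
Qed.

(** The open set is pulled back to R^(N+1), where open sets are measurable by [measurable_rV_open],
    and recovered through the measurable map [cons_rV]. *)
Lemma open_measurable_prod (O : set ('rV[R]_N * R)) : open O ->
  measurable (O : set Om).
Proof.
move=> oO.
pose g (v : 'rV[R]_N.+1) : 'rV[R]_N * R := (\row_i v ord0 (lift ord0 i), v ord0 ord0).
have cg : continuous g.
  move=> v A /nbhs_ballP[e e0 eA]; apply/nbhs_ballP; exists e => // w [_ vw].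
  by apply: eA; split => [|/=]; [split => // i j; rewrite !mxE ord1|]; exact: vw.
have oG : open (g @^-1` O) by apply: open_comp => // v _; exact: cg.
have mG : measurable (g @^-1` O).
  by rewrite measurable_rV_open; exact: sub_sigma_algebra.
have := measurable_snoc_rV measurableT mG; rewrite setTI.
rewrite (_ : _ @^-1` _ = O)//; apply/funext => -[x t] /=.
rewrite /g cons_rV0/=; congr O; congr pair.
by apply/rowP => i; rewrite mxE cons_rVS.
Qed.

Lemma continuous_measurable_prod (f : 'rV[R]_N * R -> R) : continuous f ->
  measurable_fun setT (f : Om -> R).
Proof.
move=> cf; apply: (@measurability _ _ _ _ _ _ (@RGenOpens.G R)).
  exact: RGenOpens.measurableE.
move=> _ [_ [x [y ->]] <-]; rewrite setTI; apply: open_measurable_prod.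
by apply: open_comp => // v _; exact: cf.
Qed.

Lemma measurable_prod_open : @measurable _ Om = <<s @open ('rV[R]_N * R)%type >>.
Proof.
apply/seteqP; split; last first.
  apply: smallest_sub; first exact: sigma_algebra_measurable.
  exact: open_measurable_prod.
apply: smallest_sub; first exact: smallest_sigma_algebra.
move=> A [[B mB <-]|[B mB <-]]; rewrite setTI.
  have mf : measurable_fun [set: g_sigma_algebraType (@open ('rV[R]_N * R)%type)]
      (fun p => p.1 : 'rV[R]_N).
    apply: (@measurability _ _ _ _ _ _ (@open 'rV[R]_N)).
      exact: measurable_rV_open.
    move=> _ [U oU <-]; rewrite setTI; apply: sub_sigma_algebra.
    by apply: open_comp => // v _; exact: cvg_fst.
  by have := mf measurableT _ mB; rewrite setTI.
have mf : measurable_fun [set: g_sigma_algebraType (@open ('rV[R]_N * R)%type)]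
    (fun p => p.2 : measurableTypeR R).
  apply: (@measurability _ _ _ _ _ _ (@RGenOpens.G R)).
    exact: RGenOpens.measurableE.
  move=> _ [_ [x [y ->]] <-]; rewrite setTI; apply: sub_sigma_algebra.
  by apply: open_comp => // v _; exact: cvg_snd.
by have := mf measurableT _ mB; rewrite setTI.
Qed.

End product_borel.

(** * Continuity of translations in L^1 *)

Section L1_translation.
Context {R : realType} {N : nat}.
Notation Om := ('rV[R]_N * measurableTypeR R)%type.
Notation m := (@lebesgue_Q R N).
Implicit Types f g h : Om -> R.

(** Extended-valued, so that the triangle inequality and translation invariance hold for every
    measurable function. *)
Definition nrm1 f : \bar R := (\int[m]_w `|f w|%:E)%E.

Lemma measurable_absE f : measurable_fun setT f ->
  measurable_fun setT (fun w => `|f w|%:E).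
Proof. by move=> mf; apply/measurable_EFinP; exact: measurableT_comp. Qed.

Lemma nrm1_le f g h : measurable_fun setT f -> measurable_fun setT g ->
  measurable_fun setT h -> (forall w, `|f w| <= `|g w| + `|h w|) ->
  (nrm1 f <= nrm1 g + nrm1 h)%E.
Proof.
move=> mf mg mh fgh; rewrite /nrm1 -ge0_integralD//; [|exact: measurable_absE..].
apply: ge0_le_integral => //.
- exact: measurable_absE.
- by apply: emeasurable_funD; exact: measurable_absE.
- by move=> w _; rewrite -EFinD lee_fin.
Qed.

Lemma nrm1_sh f p : measurable_fun setT f -> nrm1 (f \o sh p) = nrm1 f.
Proof.
move=> mf; have [_ h] := @mpres_sh R N p.
by rewrite /nrm1 (h (fun w => `|f w|%:E))//; exact: measurable_absE.
Qed.

Definition trans_cont f := forall e : R, 0 < e -> exists2 d : R, 0 < d &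
  forall p : Om, `|p.1| < d -> `|p.2 : R| < d ->
    (nrm1 (fun w => f (sh p w) - f w)%R <= e%:E)%E.

Lemma measurable_sh_comp f p : measurable_fun setT f -> measurable_fun setT (fun w => f (sh p w)).
Proof. by move=> mf; exact: measurableT_comp mf (measurable_sh p). Qed.

Lemma trans_contD f g : measurable_fun setT f -> measurable_fun setT g ->
  trans_cont f -> trans_cont g -> trans_cont (fun w => f w + g w).
Proof.
move=> mf mg tf tg e e0; have e20 : 0 < e / 2 by rewrite divr_gt0.
have [d1 d10 h1] := tf _ e20; have [d2 d20 h2] := tg _ e20.
exists (Num.min d1 d2); first by rewrite lt_min d10.
move=> p; rewrite !lt_min => /andP[p11 p12] /andP[p21 p22].
have := leeD (h1 p p11 p21) (h2 p p12 p22); rewrite -EFinD -splitr; apply: le_trans.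
have mfp := measurable_sh_comp p mf; have mgp := measurable_sh_comp p mg.
apply: nrm1_le => [|||w]; [|exact: measurable_funB..|].
  by apply: measurable_funB; apply: measurable_funD.
by apply: le_trans (ler_normD _ _); rewrite le_eqVlt; apply/orP; left; apply/eqP; congr `|_|; ring.
Qed.

Lemma trans_contZ (k : R) f : measurable_fun setT f ->
  trans_cont f -> trans_cont (fun w => k * f w).
Proof.
move=> mf tf e e0; have k0 : 0 < `|k| + 1 by rewrite ltr_wpDl.
have ek0 : 0 < e / (`|k| + 1) by rewrite divr_gt0.
have [d d0 h] := tf _ ek0; exists d => // p p1 p2.
have mfp := measurable_sh_comp p mf.
rewrite (_ : nrm1 _ = `|k|%:E * nrm1 (fun w => f (sh p w) - f w)%R)%E; last first.
  rewrite /nrm1 -ge0_integralZl//; last by apply: measurable_absE; exact: measurable_funB.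
  by apply: eq_integral => w _; rewrite -mulrBr normrM.
apply: le_trans (lee_wpmul2l _ (h p p1 p2)) _; first by rewrite lee_fin.
rewrite -EFinM lee_fin mulrCA ler_piMr ?ltW//.
by rewrite ltr_pdivrMr// mul1r ltrDl.
Qed.

(** Three terms of size e / 3; by [nrm1_sh] the translated error has the same norm as the error
    itself. *)
Lemma trans_cont_lim f : measurable_fun setT f ->
  (forall e, 0 < e -> exists g, [/\ measurable_fun setT g, trans_cont g &
     (nrm1 (fun w => f w - g w)%R <= e%:E)%E]) -> trans_cont f.
Proof.
move=> mf fg e e0; have e30 : 0 < e / 3 by rewrite divr_gt0.
have [g [mg tg fge]] := fg _ e30; have [d d0 h] := tg _ e30.
exists d => // p p1 p2.
have mfp := measurable_sh_comp p mf; have mgp := measurable_sh_comp p mg.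
apply: (@le_trans _ _ (nrm1 (fun w => (f w - g w))%R + (nrm1 (fun w => f (sh p w) - g (sh p w))%R + nrm1 (fun w => g (sh p w) - g w)%R))%E).
  apply: le_trans; last first.
    apply: leeD2l; apply: (@nrm1_le (fun w => f (sh p w) - g w)).
    - exact: measurable_funB.
    - exact: measurable_funB.
    - exact: measurable_funB.
    - move=> w; apply: le_trans (ler_normD _ _); rewrite le_eqVlt; apply/orP; left; apply/eqP; congr `|_|; ring.
  apply: nrm1_le; [exact: measurable_funB..|].
  move=> w; rewrite -(normrN (f w - g w)).
  by apply: le_trans (ler_normD _ _); rewrite le_eqVlt; apply/orP; left; apply/eqP; congr `|_|; ring.
have := nrm1_sh p (measurable_funB mf mg); rewrite /comp/= => ->.
have -> : e = e / 3 + (e / 3 + e / 3) by field.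
by rewrite EFinD EFinD leeD// leeD// h.
Qed.

Lemma Rintegrable_indic (E : set Om) : measurable E -> (m E < +oo)%E ->
  m.-integrable setT (EFin \o (\1_E : Om -> R)).
Proof.
move=> mE Eoo; apply: ge0_RintegrableE => //.
by rewrite integral_indic// setIT.
Qed.

(** [G] is exhausted by the sets of points at distance at least 1/(k+1) from its complement. For a
    smaller displacement such a set lies in [G] and in its translate, and each of the two exceeds it
    by measure at most e / 2. *)
Lemma trans_cont_open (G : set ('rV[R]_N * R)) : open G -> (m G < +oo)%E ->
  trans_cont (\1_G : Om -> R).
Proof.
move=> oG Goo e e0; have mG := open_measurable_prod oG.
pose F k : set ('rV[R]_N * R) := ~` \bigcup_(y in ~` G) ball y k.+1%:R^-1.
have mF k : measurable (F k : set Om).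
  apply: measurableC; apply: open_measurable_prod.
  by apply: bigcup_open => y _; exact: ball_open.
have FG k : F k `<=` G.
  move=> w Fw; apply: contrapT => Gw; apply: Fw; exists w => //.
  by apply: ballxx; rewrite invr_gt0.
have FGU : \bigcup_k F k = G.
  apply/seteqP; split => [w [k _]|w Gw]; first exact: FG.
  have /nbhs_ballP[r /= r0 rG] := open_nbhs_nbhs (conj oG Gw).
  have [k] := ltr_add_invr r0; rewrite add0r => kr; exists k => // -[y Gy yw].
  by apply: Gy; apply: rG; apply: ball_sym; apply: le_ball yw; exact: ltW.
have ndF : nondecreasing_seq F.
  move=> i j ij; apply/subsetPset; apply: subsetC.
  apply: subset_bigcup => y _ w; apply: le_ball.
  by rewrite lef_pV2 ?posrE// ler_nat.
have cF : (m \o F) @ \oo --> m G.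
  by rewrite -[X in _ --> m X]FGU; apply: nondecreasing_cvg_mu => //; rewrite FGU.
have Foo k : (m (F k) < +oo)%E by apply: le_lt_trans Goo; rewrite le_measure ?inE.
have [k ke] : exists k, (m G - m (F k) <= (e / 2)%:E)%E.
  have : (m \o F) @ \oo --> (fine (m G))%:E by rewrite fineK// ge0_fin_numE.
  move=> /fine_cvgP[_ /cvgrPdist_le /(_ (e / 2))]; rewrite divr_gt0// => /(_ isT)[k _ kP].
  exists k; have := kP _ (leqnn k).
  rewrite -(@fineK _ (m G)) ?ge0_fin_numE// -(@fineK _ (m (F k))) ?ge0_fin_numE//.
  by rewrite -EFinB lee_fin; apply: le_trans; exact: ler_norm.
exists k.+1%:R^-1; first by rewrite invr_gt0.
move=> p p1 p2.
have FGp w : F k w -> G (sh p w).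
  move=> Fw; apply: contrapT => Gw; apply: Fw; exists (sh p w) => //.
  by split; rewrite /= -ball_normE/= addrAC subrr add0r.
have mI (E : set Om) : measurable E -> measurable_fun setT (\1_E : Om -> R).
  by move=> mE; exact: measurable_indic.
apply: (@le_trans _ _ (nrm1 (fun w => \1_G (sh p w) - \1_(F k) w)%R + nrm1 (fun w => \1_G w - \1_(F k) w)%R)%E).
  apply: nrm1_le; first (by apply: measurable_funB; [apply: measurable_sh_comp|]; exact: mI);
   first (by apply: measurable_funB; [apply: measurable_sh_comp|]; exact: mI);
   first by apply: measurable_funB; exact: mI.
  move=> w; rewrite !indicE.
  have [Fw|Fw] := pselect (F k w).
    by rewrite (mem_set Fw) (mem_set (FG _ _ Fw)) (mem_set (FGp _ Fw)) !subrr normr0 addr0.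
  rewrite (memNset Fw) !subr0; case: (_ \in _); case: (_ \in _); rewrite /= ?subr0 ?sub0r ?subrr ?normrN ?normr0 ?normr1 ?addr0 ?add0r//.
have int_eq (H : Om -> R) : m.-integrable setT (EFin \o H) -> (forall w, \1_(F k) w <= H w) ->
    (nrm1 (fun w => H w - \1_(F k) w)%R = \int[m]_w (H w)%:E - m (F k))%E.
  move=> iH FH; rewrite /nrm1; under eq_integral do rewrite ger0_norm ?subr_ge0//.
  rewrite -[X in (_ - m X)%E]setIT -integral_indic// -integralB//.
  exact: Rintegrable_indic.
have iG := Rintegrable_indic mG Goo.
have leFG w : \1_(F k) w <= \1_G w :> R.
  rewrite !indicE ler_nat; case: (boolP (w \in F k)) => //.
  by rewrite !inE => /FG Gw; rewrite mem_set.
rewrite !int_eq//.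
- rewrite (mpres_integral (mpres_sh p) (mI _ mG)) integral_indic// setIT.
  by apply: le_trans (leeD ke ke) _; rewrite -EFinD -splitr.
- exact: (mpres_integrable (mpres_sh p) iG).
- move=> w; rewrite !indicE ler_nat; case: (boolP (w \in F k)) => //.
  by rewrite !inE => /FGp Gw; rewrite mem_set.
Qed.

Lemma trans_cont0 : trans_cont (cst 0).
Proof.
move=> e e0; exists 1 => // p _ _; rewrite /nrm1.
by under eq_integral do rewrite subrr normr0; rewrite integral0 lee_fin ltW.
Qed.

Lemma measurable_ind (E : set Om) : measurable E -> measurable_fun setT (\1_E : Om -> R).
Proof. by move=> mE; exact: measurable_indic. Qed.

Lemma nrm1_indicB (A C : set Om) : measurable A -> measurable C -> A `<=` C ->
  (m C < +oo)%E -> (nrm1 (fun w => \1_C w - \1_A w)%R = m C - m A)%E.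
Proof.
move=> mA mC AC Coo; have Aoo : (m A < +oo)%E.
  by apply: le_lt_trans Coo; rewrite le_measure ?inE.
have leAC w : \1_A w <= \1_C w :> R.
  rewrite !indicE ler_nat; case: (boolP (w \in A)) => //.
  by rewrite !inE => /AC Gw; rewrite mem_set.
rewrite /nrm1; under eq_integral do rewrite ger0_norm ?subr_ge0//.
rewrite -[in X in (_ - X)%E](setIT A) -[in X in (X - _)%E](setIT C).
rewrite -!integral_indic// -integralB//; exact: Rintegrable_indic.
Qed.

Lemma trans_cont_incr (F : (set Om)^nat) : (forall k, measurable (F k)) ->
  nondecreasing_seq F -> (m (\bigcup_k F k) < +oo)%E ->
  (forall k, trans_cont (\1_(F k))) -> trans_cont (\1_(\bigcup_k F k)).
Proof.
move=> mF ndF Uoo tF.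
have mU : measurable (\bigcup_k F k) by exact: bigcupT_measurable.
apply: trans_cont_lim; first exact: measurable_ind.
move=> e e0.
have Foo k : (m (F k) < +oo)%E.
  by apply: le_lt_trans Uoo; rewrite le_measure ?inE//; exact: bigcup_sup.
have cF : (m \o F) @ \oo --> m (\bigcup_k F k) by exact: nondecreasing_cvg_mu.
have [k ke] : exists k, (m (\bigcup_k F k) - m (F k) <= e%:E)%E.
  have : (m \o F) @ \oo --> (fine (m (\bigcup_k F k)))%:E by rewrite fineK// ge0_fin_numE.
  move=> /fine_cvgP[_ /cvgrPdist_le /(_ e)]; rewrite e0 => /(_ isT)[k _ kP].
  exists k; have := kP _ (leqnn k).
  rewrite -(@fineK _ (m (\bigcup_k F k))) ?ge0_fin_numE// -(@fineK _ (m (F k))) ?ge0_fin_numE//.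
  by rewrite -EFinB lee_fin; apply: le_trans; exact: ler_norm.
exists (\1_(F k) : Om -> R); split => //.
rewrite nrm1_indicB//; exact: bigcup_sup.
Qed.

(** Dynkin's pi-lambda argument starting from the open sets. The intersection with [B] keeps all
    measures finite, so that complements stay in the class. *)
Lemma trans_cont_setI (B : set ('rV[R]_N * R)) (E : set Om) :
  open B -> (m B < +oo)%E -> measurable E -> trans_cont (\1_(E `&` B) : Om -> R).
Proof.
move=> oB Boo mE; have mB := open_measurable_prod oB.
pose D : set (set Om) := [set E | @measurable _ Om E /\ trans_cont (\1_(E `&` B) : Om -> R)].
suff : (@measurable _ Om : set (set Om)) `<=` D by move=> /(_ _ mE)[].
rewrite measurable_prod_open -setI_closed_g_dynkin_g_sigma_algebra; last first.
  by move=> U V; exact: openI.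
have IB (F : set Om) : measurable F -> measurable (F `&` B) by move=> ?; exact: measurableI.
apply: smallest_sub; last first.
  move=> U oU; split; first exact: open_measurable_prod.
  apply: trans_cont_open; first exact: openI.
  by apply: le_lt_trans Boo; rewrite le_measure ?inE//; apply: IB; exact: open_measurable_prod.
split.
- split; first exact: measurableT.
  by rewrite setTI; exact: trans_cont_open.
- move=> F [mF tF]; split; first exact: measurableC.
  rewrite (_ : \1__ = (fun w => \1_B w + (-1) * \1_(F `&` B) w)); last first.
    apply/funext => w; rewrite !indicE !in_setI in_setC mulN1r.
    by case: (w \in F); rewrite /= ?subr0 ?subrr.
  apply: trans_contD; first exact: measurable_ind.
  + by apply: measurable_funM => //; apply: measurable_ind; exact: IB.
  + exact: trans_cont_open.
  + by apply: trans_contZ => //; apply: measurable_ind; exact: IB.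
- move=> F tF DF; have mF k := (DF k).1; split; first exact: bigcupT_measurable.
  pose U n := \big[setU/set0]_(k < n) F k `&` B.
  have mU n : @measurable _ Om (U n) by apply: IB; apply: bigsetU_measurable => i _; exact: mF.
  have -> : \bigcup_k F k `&` B = \bigcup_n U n.
    rewrite -setI_bigcupl; congr (_ `&` _); apply/seteqP; split => w.
      move=> [k _ Fkw]; exists k.+1 => //; rewrite -bigcup_mkord.
      by exists k => /=.
    by move=> [n _]; rewrite -bigcup_mkord => -[k _ Fkw]; exists k.
  apply: trans_cont_incr => //.
  + move=> i j ij; apply/subsetPset; apply: setSI.
    by rewrite -!bigcup_mkord; apply: bigcup_subset => k /= ki; exact: leq_trans ij.
  + apply: le_lt_trans Boo; rewrite le_measure ?inE//; first exact: bigcupT_measurable.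
    by move=> w [n _ []].
  + elim => [|n IH].
      by rewrite /U big_ord0 set0I indic0; exact: trans_cont0.
    rewrite (_ : \1__ = (fun w => \1_(U n) w + \1_(F n `&` B) w)); last first.
      apply/funext => w; rewrite /U big_ord_recr/= !indicE setIUl in_setU.
      have : ~ (w \in \big[setU/set0]_(k < n) F k `&` B /\ w \in F n `&` B).
        rewrite !inE -bigcup_mkord => -[[[k /= kn Fk] _] [Fn _]].
        move/trivIsetP : tF => /(_ k n I I); rewrite neq_ltn kn => /(_ isT).
        by move=> /seteqP[/(_ w) + _]; apply.
      suff H (a b : bool) : ~ (a /\ b) -> (a || b)%:R = a%:R + b%:R :> R by exact: H.
      by case: a; case: b => h; rewrite /= ?addr0 ?add0r//; case: h.
    apply: trans_contD => //; [apply: measurable_ind => //..|].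
      exact: IB.
    by have [] := DF n.
Qed.

Lemma lebesgue_Q_ball (r : R) :
  (m (ball ((0%R, 0%R) : 'rV[R]_N * R) r) < +oo)%E.
Proof.
have [r0|r0] := ltP 0 r; last first.
  rewrite (_ : ball _ _ = set0) ?measure0//.
  by apply/seteqP; split => // -[x t] [_]; rewrite -ball_normE/= => /(le_lt_trans (normr_ge0 _)); rewrite ltNge r0.
pose I : set R := `]- r, r[%classic.
pose A := [set v : 'rV[R]_N | forall i : 'I_N, I (v ord0 i)].
have mA : measurable A.
  rewrite (_ : A = \bigcap_(i in [set: 'I_N]) ((fun v : 'rV[R]_N => v ord0 i) @^-1` `]-r, r[)); last first.
    by apply/seteqP; split => v h i //=; [move=> _|]; exact: h.
  apply: fin_bigcap_measurable => // i _; rewrite -[X in measurable X]setTI.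
  by apply: measurable_coord => //; exact: measurable_itv.
apply: (@le_lt_trans _ _ (m (A `*` I))).
  rewrite le_measure ?inE//.
  - by apply: open_measurable_prod; exact: ball_open.
  - by apply: measurableX => //; exact: measurable_itv.
  - move=> [x t] [[_ bx] bt]; split => [i|] /=.
      by have := bx ord0 i; rewrite -ball_normE/= mxE sub0r normrN /I/= in_itv/= ltr_norml.
    by move: bt; rewrite -ball_normE/= sub0r normrN /I/= in_itv/= ltr_norml.
rewrite /lebesgue_Q product_measure1E//; last exact: measurable_itv.
rewrite [X in (X * _)%E](_ : _ = \prod_(i < N) lebesgue_measure I)%E; last first.
  exact: (@lebesgue_rV_box R N (fun=> I) (fun _ => measurable_itv _)).
have I2 : lebesgue_measure I = (r + r)%:E :> \bar R.
  by rewrite /I lebesgue_measure_itv/= lte_fin gtrN// -EFinB opprK.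
rewrite [X in (_ * X)%E](_ : _ = (r + r)%:E)//.
rewrite (_ : (\prod_(i < N) _)%E = ((r + r) ^+ N)%:E); first by rewrite -EFinM ltry.
by elim: N => [|n IH]; [rewrite big_ord0|rewrite big_ord_recr/= IH I2 -EFinM exprSr].
Qed.

Lemma trans_cont_indic (E : set Om) : measurable E -> (m E < +oo)%E ->
  trans_cont (\1_E).
Proof.
move=> mE Eoo.
pose B k : set ('rV[R]_N * R) := ball (0, 0) k.+1%:R.
have mB k : measurable (B k : set Om) by apply: open_measurable_prod; exact: ball_open.
have EB : E = \bigcup_k (E `&` B k).
  rewrite -setI_bigcupr; apply/seteqP; split => [[x t] Ew|w []//]; split => //.
  pose r := Num.max `|x| `|t|.
  exists (Num.bound r) => //; have rb : r < (Num.bound r).+1%:R.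
    have := archi_boundP (le_trans (normr_ge0 x) (_ : `|x| <= r)).
    rewrite le_max lexx => /(_ isT) /lt_le_trans; apply.
    by rewrite ler_nat.
  by split; rewrite -ball_normE/= sub0r normrN; apply: le_lt_trans rb; rewrite le_max lexx ?orbT.
rewrite EB; apply: trans_cont_incr => //.
- by move=> k; exact: measurableI.
- move=> i j ij; apply/subsetPset; apply: setIS; apply: le_ball.
  by rewrite ler_nat.
- by rewrite -EB.
- move=> k; apply: trans_cont_setI => //; first exact: ball_open.
  exact: lebesgue_Q_ball.
Qed.

Import HBSimple.

(** Integrable simple functions are dense in L^1 and are finite combinations of indicators; the
    level set of a nonzero value has finite measure by Chebyshev. *)
Lemma trans_cont_L1 f : m.-integrable setT (EFin \o f) -> trans_cont f.
Proof.
move=> fi; have mf := integrable_measurable fi.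
apply: trans_cont_lim => // e e0.
have [g [ig _ cg]] := approximation_sfun_integrable measurableT fi.
have [n ne] : exists n, (nrm1 (fun w => f w - g n w)%R <= e%:E)%E.
  move: cg => /fine_cvgP[[k1 _ fin1] /cvgrPdist_le /(_ e e0)[k2 _ kP]].
  exists (maxn k1 k2).
  have := kP (maxn k1 k2) (leq_maxr _ _); have := fin1 (maxn k1 k2) (leq_maxl _ _).
  rewrite /= sub0r normrN => fin; rewrite ger0_norm ?fine_ge0 ?integral_ge0// => h.
  by rewrite /nrm1 -[leLHS]fineK.
exists (g n); split => //.
have [s hs] : exists s : seq R, (g n : Om -> R) =
    (fun w => \sum_(y <- s) y * \1_(g n @^-1` [set y]) w).
  exists (finmap.enum_fset (fset_set (range (g n)))).
  by apply/funext => w; rewrite {1}fimfunE fsbig_finite.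
rewrite hs {hs}.
have mI y : measurable_fun setT (fun w : Om => y * \1_(g n @^-1` [set y]) w : R).
  by apply: measurable_funM => //; exact: measurable_ind.
elim: s => [|y s IH].
  by under eq_fun do rewrite big_nil; exact: trans_cont0.
rewrite (_ : (fun w => _) = (fun w => y * \1_(g n @^-1` [set y]) w + \sum_(y <- s) y * \1_(g n @^-1` [set y]) w)); last first.
  by apply/funext => w; rewrite big_cons.
apply: trans_contD => //; first exact: measurable_sum.
have [->|y0] := eqVneq y 0.
  by under eq_fun do rewrite mul0r; exact: trans_cont0.
have mgy : measurable (g n @^-1` [set y]) by exact: measurable_sfunP.
apply: trans_contZ; first exact: measurable_ind.
apply: trans_cont_indic => //.
have : m.-integrable setT (EFin \o (\1_(g n @^-1` [set y]) : Om -> R)).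
  apply: (@le_Rintegrable _ _ _ _ _ (fun w => `|y|^-1 * `|g n w|)).
  - exact: measurable_ind.
  - move=> w; rewrite indicE; case: (boolP (w \in _)) => [|_]; last by rewrite normr0 mulr_ge0.
    by rewrite inE/= => ->; rewrite normr1 mulVf// normr_eq0.
  - by apply: RintegrableZl; apply: integrable_norm; exact: ig.
move=> /integrableP[_]; under eq_integral do rewrite /= ger0_norm//.
by rewrite integral_indic// setIT.
Qed.

End L1_translation.

(** * Test functions *)

Section Ck_theory.
Context {R : realType}.

Section general.
Context {V : normedModType R}.
Implicit Types f g : V -> R.

Lemma CkS k f : Ck k.+1 f -> Ck k f.
Proof.
elim: k f => [|k IH] f [df h]; first by move=> p; exact: differentiable_continuous.
by split => // v; exact: IH.
Qed.

Lemma Ck_cst k (c : R) : Ck k (cst c : V -> R).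
Proof.
elim: k c => [|k IH] c; first by move=> p; exact: cvg_cst.
split => [p|v]; first exact: differentiable_cst.
rewrite (_ : (fun p => _) = cst 0); first exact: IH.
by apply/funext => p; exact: derive_cst.
Qed.

Lemma CkD k f g : Ck k f -> Ck k g -> Ck k (fun p => f p + g p).
Proof.
elim: k f g => [|k IH] f g; first by move=> cf cg p; exact: cvgD (cf p) (cg p).
move=> [df hf] [dg hg]; split => [p|v]; first exact: differentiableD.
rewrite (_ : (fun p => _) = (fun p => 'D_v f p + 'D_v g p)).
  exact: IH (hf v) (hg v).
by apply/funext => p; rewrite -deriveD//; exact: diff_derivable.
Qed.

Lemma CkM k f g : Ck k f -> Ck k g -> Ck k (fun p => f p * g p).
Proof.
elim: k f g => [|k IH] f g; first by move=> cf cg p; exact: cvgM (cf p) (cg p).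
move=> fk gk; have [df hf] := fk; have [dg hg] := gk.
split => [p|v]; first exact: differentiableM.
rewrite (_ : (fun p => _) = (fun p => f p * 'D_v g p + g p * 'D_v f p)).
  by apply: CkD; [exact: IH (CkS fk) (hg v)|exact: IH (CkS gk) (hf v)].
by apply/funext => p; rewrite deriveM//; exact: diff_derivable.
Qed.

Lemma Ck_prod k (I : Type) (s : seq I) (F : I -> V -> R) :
  (forall i, Ck k (F i)) -> Ck k (fun p => \prod_(i <- s) F i p).
Proof.
move=> hF; elim: s => [|i s IH].
  by under eq_fun do rewrite big_nil; exact: Ck_cst.
by under eq_fun do rewrite big_cons; exact: CkM.
Qed.

Definition affine_fun (l l0 : V -> R) := (forall p, differentiable l p) /\
  forall v p h, l (h *: v + p) = h * l0 v + l p.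

Lemma derive_affine l l0 v p : affine_fun l l0 -> 'D_v l p = l0 v.
Proof.
move=> [_ h]; rewrite /derive; apply: cvg_lim => //.
apply: (@cvg_trans _ (cst (l0 v) @ 0^')); last exact: cvg_cst.
apply: near_eq_cvg; near=> e.
have e0 : e != 0 by near: e; exact: nbhs_dnbhs_neq.
by rewrite /= h addrK /GRing.scale/= mulrA mulVf// mul1r.
Unshelve. all: by end_near. Qed.

Lemma affine_scale (a b : R) l l0 : affine_fun l l0 ->
  affine_fun (fun p => a * l p + b) (fun v => a * l0 v).
Proof.
move=> [dl h]; split => [p|v p e]; last by rewrite h; ring.
by apply: differentiableD => //; apply: differentiableM.
Qed.

(** The chain rule reproduces the form of the statement: the derivative along [v] is the constant
    [l0 v] times ['D_1 h] composed with [l], so the induction on [k] closes. *)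
Lemma Ck_comp k (h : R -> R) l l0 : affine_fun l l0 -> Ck k h ->
  Ck k (fun p => h (l p)).
Proof.
move=> al; elim: k h => [|k IH] h.
  by move=> ch p; apply: continuous_comp; [exact: differentiable_continuous (al.1 p)|exact: ch].
move=> [dh hh]; split => [p|v]; first by apply: differentiable_comp => //; exact: al.1.
rewrite (_ : (fun p => _) = (fun p => l0 v * 'D_1 h (l p))).
  by apply: CkM; [exact: Ck_cst|exact: IH (hh 1)].
apply/funext => p; rewrite deriveE; last by apply: differentiable_comp => //; exact: al.1.
rewrite diff_comp; [|exact: al.1|exact: dh].
have -> : ('d h (l p) \o 'd l p) v = 'd h (l p) (l0 v *: 1).
  by rewrite /= -(deriveE _ (al.1 p)) (derive_affine _ _ al) /GRing.scale/= mulr1.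
by rewrite linearZ -deriveE.
Qed.

End general.

Lemma Ck1 k (h dh : R -> R) : (forall x : R, is_derive x (1 : R) h (dh x)) -> Ck k dh -> Ck k.+1 h.
Proof.
move=> hd hk; split => [p|v]; first by apply/derivable1_diffP; have [] := hd p.
rewrite (_ : (fun p => _) = (fun p => v * dh p)); first by apply: CkM => //; exact: Ck_cst.
apply/funext => p; have [dp <-] := hd p; have := dp => /derivable1_diffP dfp.
rewrite deriveE// (_ : 'd h p v = 'd h p (v *: 1)); last by rewrite /GRing.scale/= mulr1.
by rewrite linearZ -deriveE.
Qed.

Lemma Ck_expR k (a : R) : Ck k (fun x : R => expR (a * x)).
Proof.
suff h (c : R) : Ck k (fun x : R => c * expR (a * x)).
  by have := h 1; under eq_fun do rewrite mul1r.
elim: k c => [|k IH] c.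
  move=> x; apply: cvgM; first exact: cvg_cst.
  apply: continuous_comp; last exact: continuous_expR.
  by apply: cvgM; [exact: cvg_cst|exact: cvg_id].
apply: (@Ck1 _ _ (fun x => (c * a) * expR (a * x))) => // x.
apply: is_derive_eq; rewrite /GRing.scale/=; ring.
Qed.

(** The case j = 0 is the classical flat function e^(-1/r); the other powers make the family closed
    under differentiation, up to linear combinations. *)
Definition flat (j : nat) (r : R) : R :=
  if 0 < r then r^-1 ^+ j * expR (- r^-1) else 0.

(** One term of the exponential series, (1/r)^(j+2) / (j+2)!, bounds e^(1/r) from below. The
    quadratic decay gives derivative 0 at the origin. *)
Lemma flat_bound j r : `|flat j r| <= j.+2`!%:R * r ^+ 2.
Proof.
rewrite /flat; case: ifPn => [r0|_]; last by rewrite normr0 mulr_ge0// sqr_ge0.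
have ri0 : 0 < r^-1 by rewrite invr_gt0.
rewrite ger0_norm; last by rewrite mulr_ge0 ?expR_ge0// exprn_ge0// ltW.
have h : r^-1 ^+ j.+2 / j.+2`!%:R <= expR r^-1.
  by apply: le_trans (@expR_ge1Dxn R r^-1 j.+1 (ltW ri0)); rewrite lerDr.
have h0 : 0 < r^-1 ^+ j.+2 / j.+2`!%:R :> R by rewrite divr_gt0 ?exprn_gt0// ltr0n fact_gt0.
have f0 : j.+2`!%:R != 0 :> R by rewrite pnatr_eq0 -lt0n fact_gt0.
rewrite expRN; apply: (@le_trans _ _ (r^-1 ^+ j * (r^-1 ^+ j.+2 / j.+2`!%:R)^-1)).
  apply: ler_wpM2l; first by rewrite exprn_ge0// ltW.
  by rewrite lef_pV2 ?posrE ?expR_gt0.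
rewrite invf_div le_eqVlt; apply/orP; left; apply/eqP.
rewrite -addn2 exprD exprVn (exprVn _ 2); have rj : r ^+ j != 0 by rewrite expf_neq0// gt_eqF.
have r2 : r != 0 by rewrite gt_eqF.
by field; rewrite r2 rj.
Qed.

Lemma flat_le0 j r : r <= 0 -> flat j r = 0.
Proof. by rewrite /flat ltNge => ->. Qed.

Lemma is_derive_flat j r :
  is_derive r (1 : R) (flat j) (flat j.+2 r - j%:R * flat j.+1 r).
Proof.
have [r0|r0|->] := ltgtP r 0.
- rewrite !(flat_le0 _ (ltW r0)) mulr0 subr0.
  apply: (@near_eq_is_derive R R R (cst 0) (flat j) r 1 0).
  near=> x; rewrite flat_le0//; apply: ltW; near: x.
  exact: lt_nbhsl.
- have r1 : r != 0 by rewrite gt_eqF.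
  have dV : is_derive r (1 : R) (fun y : R => y^-1) (- r ^- 2).
    have := @is_deriveV R (fun y : R => y) r 1 1 r1 (is_derive_id _ _).
    by rewrite /GRing.scale/= mulr1.
  have D : is_derive r (1 : R) (fun r : R => r^-1 ^+ j * expR (- r^-1))
      (flat j.+2 r - j%:R * flat j.+1 r).
    have D1 : is_derive r (1 : R) (fun y : R => y^-1 ^+ j)
        (j%:R * r^-1 ^+ j.-1 * - r ^- 2).
      by have := is_deriveX j dV; rewrite exprfctE.
    have D2 : is_derive r (1 : R) (fun y : R => expR (- y^-1)) (expR (- r^-1) * (- - r ^- 2)).
      exact: (@is_derive1_comp R expR (fun y => - y^-1) r _ _ (is_derive_expR _) (is_deriveN dV)).
    have D3 := is_deriveM D1 D2; apply: DeriveDef; first by case: D3.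
    case: D3 => _ ->; rewrite /flat r0 /GRing.scale/=.
    case: j D1 => [|j] D1; first by rewrite -exprVn; ring.
    by rewrite -exprVn /= !exprS; ring.
  apply: near_eq_is_derive D; near=> x; rewrite /flat (_ : 0 < x)//; near: x.
  exact: lt_nbhsr.
- rewrite !(flat_le0 _ (lexx 0)) mulr0 subr0.
  have cv : h^-1 *: (flat j (h *: 1 + 0) - flat j 0) @[h --> (0:R)^'] --> (0 : R).
    apply/cvgrPdist_le => e e0; near=> h.
    have h0 : h != 0 by near: h; exact: nbhs_dnbhs_neq.
    rewrite sub0r normrN addr0 (flat_le0 _ (lexx 0)) subr0 /GRing.scale/= mulr1 normrM normfV.
    rewrite ler_pdivrMl ?normr_gt0//; apply: le_trans (flat_bound _ _) _.
    rewrite -real_normK ?num_real// expr2 mulrCA ler_wpM2l//.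
    rewrite -ler_pdivlMl ?ltr0n ?fact_gt0//; near: h; apply: dnbhs0_le.
    by rewrite mulr_gt0// invr_gt0 ltr0n fact_gt0.
  by apply: DeriveDef; [apply/cvg_ex; exists 0|exact: cvg_lim cv].
Unshelve. all: by end_near. Qed.

Lemma Ck_flat k j : Ck k (flat j).
Proof.
elim: k j => [|k IH] j.
  move=> x; apply: differentiable_continuous; apply/derivable1_diffP.
  by have [] := is_derive_flat j x.
apply: Ck1 (is_derive_flat j) _.
rewrite (_ : (fun x => _) = (fun x => flat j.+2 x + (- j%:R) * flat j.+1 x)).
  by apply: CkD => //; apply: CkM => //; exact: Ck_cst.
by apply/funext => x; rewrite mulNr.
Qed.

Lemma flat_ge0 j r : 0 <= flat j r.
Proof.
rewrite /flat; case: ifPn => // r0; rewrite mulr_ge0 ?expR_ge0//.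
by rewrite exprn_ge0// invr_ge0 ltW.
Qed.

Lemma flat0_gt0 r : 0 < r -> 0 < flat 0 r.
Proof. by move=> r0; rewrite /flat r0 expr0 mul1r expR_gt0. Qed.

Lemma flat0_le1 r : flat 0 r <= 1.
Proof.
rewrite /flat; case: ifPn => // r0; rewrite expr0 mul1r expR_le1.
by rewrite oppr_le0 invr_ge0 ltW.
Qed.

End Ck_theory.

Section slices.
Context {R : realType} {N : nat}.
Notation V := ('rV[R]_N * R)%type.
Implicit Types (z x : 'rV[R]_N) (p v : V) (g : V -> R) (t : R).

Lemma is_derive_line g p v (s : R) : (forall q, differentiable g q) ->
  is_derive s (1 : R) (fun s : R => g (p + s *: v)) ('D_v g (p + s *: v)).
Proof.
move=> dg.
have dv : derivable g (p + s *: v) v by exact: diff_derivable.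
have E : (fun h : R => h^-1 *: (g (p + (h *: (1:R) + s) *: v) - g (p + s *: v)))
  = (fun h : R => h^-1 *: (g (h *: v + (p + s *: v)) - g (p + s *: v))).
  apply/funext => h; congr (_ *: (g _ - _)).
  by rewrite scalerDl /GRing.scale/= mulr1 addrCA.
by apply: DeriveDef; rewrite /derivable /derive E.
Qed.

(** The mean value theorem twice: f 1 - f 0 = f1 c, then f1 c - f1 0 = c * f2 e with 0 < c < 1. *)
Lemma taylor2 (f f1 f2 : R -> R) (C : R) :
  (forall s : R, is_derive s (1 : R) f (f1 s)) ->
  (forall s : R, is_derive s (1 : R) f1 (f2 s)) ->
  (forall s, `|f2 s| <= C) -> `|f 1 - f 0 - f1 0| <= C.
Proof.
move=> df df1 f2C.
have cont (h h1 : R -> R) (a b : R) : (forall s : R, is_derive s (1 : R) h (h1 s)) ->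
    {within `[a, b], continuous h}.
  move=> dh; apply: continuous_subspaceT => s.
  by apply: differentiable_continuous; apply/derivable1_diffP; case: (dh s).
have [c c01 ->] := MVT (@ltr01 R) (fun (x : R) _ => df x) (cont f f1 0 1 df).
move: c01; rewrite in_itv/= => /andP[c0 c1].
have [e _ E] := MVT c0 (fun (x : R) _ => df1 x) (cont f1 f2 0 c df1).
rewrite subr0 mulr1 E normrM; apply: le_trans (f2C e).
by rewrite ler_piMr// subr0 ger0_norm ltW.
Qed.

Lemma mvt01 (f f1 : R -> R) (C : R) :
  (forall s : R, is_derive s (1 : R) f (f1 s)) ->
  (forall s, `|f1 s| <= C) -> `|f 1 - f 0| <= C.
Proof.
move=> df f1C; have cf : {within `[(0:R), 1], continuous f}.
  apply: continuous_subspaceT => s.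
  by apply: differentiable_continuous; apply/derivable1_diffP; case: (df s).
have [c _ ->] := MVT (@ltr01 R) (fun (x : R) _ => df x) cf.
by rewrite subr0 mulr1.
Qed.

Definition unitv (i : 'I_N) : V := (delta_mx ord0 i, 0).

Lemma pair_sum_unitv z : (z, 0) = \sum_i z ord0 i *: unitv i :> V.
Proof.
have E1 (s : seq 'I_N) : (\sum_(i <- s) z ord0 i *: unitv i).1 =
    \sum_(i <- s) z ord0 i *: (delta_mx ord0 i : 'rV[R]_N).
  by elim: s => [|i s IH]; rewrite ?big_nil// !big_cons -IH.
have E2 (s : seq 'I_N) : (\sum_(i <- s) z ord0 i *: unitv i).2 = 0.
  by elim: s => [|i s IH]; rewrite ?big_nil// big_cons/= IH addr0 /GRing.scale/= mulr0.
by rewrite [RHS]surjective_pairing E1 E2 -row_sum_delta.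
Qed.

Lemma derive_slice g z p : (forall q, differentiable g q) ->
  'D_(z, 0) g p = \sum_i z ord0 i * 'D_(unitv i) g p.
Proof.
move=> dg; rewrite deriveE// pair_sum_unitv linear_sum.
by apply: eq_bigr => i _; rewrite linearZ -deriveE.
Qed.

Lemma euclidean_norm_ge0 z : 0 <= euclidean_norm z.
Proof. exact: sqrtr_ge0. Qed.

Lemma coord_le_euclidean z i : `|z ord0 i| <= euclidean_norm z.
Proof.
rewrite /euclidean_norm -sqrtr_sqr ler_wsqrtr// (bigD1 i)//= lerDl.
by apply: sumr_ge0 => j _; exact: sqr_ge0.
Qed.

Lemma derive_slice_le g z p (B : R) : (forall q, differentiable g q) ->
  (forall i, `|'D_(unitv i) g p| <= B) ->
  `|'D_(z, 0) g p| <= N%:R * (euclidean_norm z * B).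
Proof.
move=> dg gB; rewrite derive_slice//; apply: le_trans (ler_norm_sum _ _ _) _.
apply: (@le_trans _ _ (\sum_(i < N) euclidean_norm z * B)); last first.
  by rewrite sumr_const card_ord mulr_natl.
apply: ler_sum => i _; rewrite normrM ler_pM//.
exact: coord_le_euclidean.
Qed.

Lemma derive_slice2_le g z p (B : R) : Ck 2 g ->
  (forall i j, `|'D_(unitv j) ('D_(unitv i) g) p| <= B) ->
  `|'D_(z, 0) ('D_(z, 0) g) p| <= N%:R * (euclidean_norm z * (N%:R * (euclidean_norm z * B))).
Proof.
move=> [dg hg] gB; apply: derive_slice_le => [q|i]; first by have [] := hg (z, 0).
have di j q : differentiable ('D_(unitv j) g) q by have [] := hg (unitv j).
have dZ : differentiable ('D_(z, 0) g) p by have [] := hg (z, 0).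
rewrite (_ : 'D_(z, 0) g = \sum_j (z ord0 j *: 'D_(unitv j) g)); last first.
  by apply/funext => q; rewrite derive_slice// fct_sumE.
rewrite derive_sum; last by move=> j; apply: derivableZ; exact: diff_derivable.
apply: le_trans (ler_norm_sum _ _ _) _.
apply: (@le_trans _ _ (\sum_(i < N) euclidean_norm z * B)); last first.
  by rewrite sumr_const card_ord mulr_natl.
apply: ler_sum => j _; rewrite deriveZ; last exact: diff_derivable.
by rewrite normrM ler_pM//; exact: coord_le_euclidean.
Qed.

Variable (T : R) (K : set V).
Hypotheses (cK : compact K) (KT : K `<=` [set p | 0 <= p.2 < T]).

Definition vanishes g := forall p, 0 <= p.2 < T -> ~ K p -> g p = 0.

(** A direction (z, 0) does not change the time, so the difference quotients stay in the slab where
    [vanishes] speaks, including at t = 0; off the closed set [K] they are zero for small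
    increments. *)
Lemma vanishes_derive g z : vanishes g -> vanishes ('D_(z, 0) g).
Proof.
move=> vg p pT Kp.
have cl : closed K by apply: compact_closed => //; exact: norm_hausdorff.
have oK : open (~` K) by exact: closed_openC.
have nK : \forall e \near (0 : R), ~ K (e *: ((z, 0) : V) + p).
  have c0 : (fun e : R => e *: ((z, 0) : V) + p) @ (0:R) --> p.
    suff : (fun e : R => e *: ((z, 0) : V) + p) @ (0:R) --> 0 *: ((z, 0) : V) + p.
      by rewrite scale0r add0r.
    by apply: cvgD; [apply: cvgZ; [exact: cvg_id|exact: cvg_cst]|exact: cvg_cst].
  have : nbhs p (~` K) by exact: open_nbhs_nbhs.
  exact: (c0 (~` K)).
rewrite /derive; apply: cvg_lim => //.
apply: (@cvg_trans _ (cst (0:R) @ 0^')); last exact: cvg_cst.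
apply: near_eq_cvg; near=> e => /=.
rewrite (vg p)// vg ?subrr ?scaler0//.
  by rewrite /= /GRing.scale/= mulr0 add0r.
by near: e; exact: nbhs_dnbhs.
Unshelve. all: by end_near. Qed.

Lemma vanishes_bounded g : continuous g -> vanishes g ->
  exists2 B : R, 0 <= B & forall p, 0 <= p.2 < T -> `|g p| <= B.
Proof.
move=> cg vg; have /compact_bounded[M [_ MP]] : compact (g @` K).
  by apply: continuous_compact => //; exact: continuous_subspaceT.
exists (`|M| + 1); first by rewrite addr_ge0.
move=> p pT; have [Kp|Kp] := pselect (K p).
  by apply: (MP (`|M| + 1)); [rewrite (le_lt_trans (ler_norm _))// ltrDl|exists p].
by rewrite vg// normr0 addr_ge0.
Qed.

Hypothesis T0 : 0 < T.

(** Spatial derivatives up to order two are continuous and vanish off [K], hence are bounded on the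
    slab; the three summands of the constant belong to the orders 0, 1 and 2. *)
Lemma slice_bounds g : Ck 2 g -> vanishes g ->
  exists2 B : R, 0 <= B & forall x z t, 0 <= t < T ->
  [/\ `|g (x, t)| <= B, `|g (x + z, t) - g (x, t)| <= B * euclidean_norm z
    & `|g (x + z, t) - g (x, t) - 'D_(z, 0) g (x, t)| <= B * euclidean_norm z ^+ 2].
Proof.
move=> g2 vg; have [dg hg] := g2.
have cg : continuous g by move=> p; exact: differentiable_continuous.
have [B0 B00 B0P] := vanishes_bounded cg vg.
have [B1 B10 B1P] : exists2 B : R, 0 <= B & forall i p, 0 <= p.2 < T -> `|'D_(unitv i) g p| <= B.
  have h i := @vanishes_bounded ('D_(unitv i) g) (fun p => differentiable_continuous ((hg (unitv i)).1 p)) (@vanishes_derive g (delta_mx ord0 i) vg).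
  exists (\sum_i sval (cid2 (h i))) => [|i p pT].
    by apply: sumr_ge0 => i _; case: cid2.
  apply: (@le_trans _ _ (sval (cid2 (h i)))); first by case: cid2 => B /= _; exact.
  by rewrite (bigD1 i)//= lerDl; apply: sumr_ge0 => j _; case: cid2.
have [B2 B20 B2P] : exists2 B : R, 0 <= B & forall i j p, 0 <= p.2 < T -> `|'D_(unitv j) ('D_(unitv i) g) p| <= B.
  have h (ij : 'I_N * 'I_N) := @vanishes_bounded ('D_(unitv ij.2) ('D_(unitv ij.1) g)) ((hg (unitv ij.1)).2 (unitv ij.2)) (@vanishes_derive _ (delta_mx ord0 ij.2) (@vanishes_derive g (delta_mx ord0 ij.1) vg)).
  exists (\sum_i sval (cid2 (h i))) => [|i j p pT].
    by apply: sumr_ge0 => i _; case: cid2.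
  apply: (@le_trans _ _ (sval (cid2 (h (i, j))))); first by case: cid2 => B /= _; exact.
  by rewrite (bigD1 (i, j))//= lerDl; apply: sumr_ge0 => k _; case: cid2.
exists (B0 + N%:R * B1 + N%:R * (N%:R * B2)) => [|x z t tT]; first by rewrite !addr_ge0 ?mulr_ge0.
have e0 := euclidean_norm_ge0 z.
have E s : (x, t) + s *: ((z, 0) : V) = (x + s *: z, t).
  by congr pair; rewrite /= /GRing.scale/= mulr0 addr0.
have E1 : ((x + z, t) : V) = (x, t) + (1 : R) *: ((z, 0) : V) by rewrite E scale1r.
have E0 : ((x, t) : V) = (x, t) + (0 : R) *: ((z, 0) : V) by rewrite E scale0r addr0.
pose f s := g ((x, t) + s *: ((z, 0) : V)).
pose f1 s := 'D_(z, 0) g ((x, t) + s *: ((z, 0) : V)).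
pose f2 s := 'D_(z, 0) ('D_(z, 0) g) ((x, t) + s *: ((z, 0) : V)).
have df (s : R) : is_derive s (1 : R) f (f1 s) by exact: is_derive_line.
have df1 (s : R) : is_derive s (1 : R) f1 (f2 s).
  by apply: is_derive_line => q; have [] := hg (z, 0).
have f1B s : `|f1 s| <= N%:R * (euclidean_norm z * B1).
  by apply: derive_slice_le => // i; apply: B1P; rewrite E.
have f2B s : `|f2 s| <= N%:R * (euclidean_norm z * (N%:R * (euclidean_norm z * B2))).
  by apply: derive_slice2_le => // i j; apply: B2P; rewrite E.
split.
- apply: le_trans (B0P _ _) _ => //.
  by rewrite -addrA lerDl addr_ge0 ?mulr_ge0.
- have := mvt01 df f1B; rewrite /f -E1 -E0 => /le_trans; apply.
  rewrite mulrCA mulrC ler_wpM2r// -addrA addrCA lerDl addr_ge0 ?mulr_ge0//.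
- have := taylor2 df df1 f2B; rewrite /f /f1 -E1 -E0 => /le_trans; apply.
  rewrite (_ : _ * _ = (N%:R * (N%:R * B2)) * euclidean_norm z ^+ 2); last by ring.
  by rewrite ler_wpM2r ?sqr_ge0// lerDr addr_ge0 ?mulr_ge0.
Qed.

End slices.

Section sublevel.
Context d (T : measurableType d) (R : realType) (f : T -> R).
Hypothesis mf : measurable_fun setT f.

Lemma measurable_lec (c : R) : measurable [set x | f x <= c].
Proof.
rewrite (_ : [set x | _] = setT `&` f @^-1` `]-oo, c]%classic); first exact: mf.
by rewrite setTI; apply/seteqP; split => x /=; rewrite in_itv.
Qed.

Lemma measurable_gec (c : R) : measurable [set x | c <= f x].
Proof.
rewrite (_ : [set x | _] = setT `&` f @^-1` `[c, +oo[%classic); first exact: mf.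
by rewrite setTI; apply/seteqP; split => x /=; rewrite in_itv/= andbT.
Qed.

Lemma measurable_gtc (c : R) : measurable [set x | c < f x].
Proof.
rewrite (_ : [set x | _] = setT `&` f @^-1` `]c, +oo[%classic); first exact: mf.
by rewrite setTI; apply/seteqP; split => x /=; rewrite in_itv/= andbT.
Qed.

End sublevel.

(** * The Levy operator and its bilinear form *)

Section levy_measure.
Context {R : realType} {N : nat}.
Notation X := ('rV[R]_N).
Notation Om := ('rV[R]_N * measurableTypeR R)%type.
Implicit Types (x z : X) (f : Om -> R) (t : R).

Lemma measurable_euclidean_norm : measurable_fun setT (@euclidean_norm R N).
Proof.
have ms : measurable_fun setT (Num.sqrt : R -> R).
  by apply: continuous_measurable_fun; exact: sqrt_continuous.
apply: (measurableT_comp ms).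
apply: measurable_sum => i; apply: measurable_funX; exact: measurable_coord.
Qed.

(** The weight of the Levy condition: [levy_integrable] says that it is [mu]-integrable, and a
    multiple of it dominates the second differences and the squared first differences of a test
    function. *)
Definition kap z : R := Num.min 1 (euclidean_norm z ^+ 2).

Lemma measurable_kap : measurable_fun setT kap.
Proof.
apply: measurable_minr => //; apply: measurable_funX.
exact: measurable_euclidean_norm.
Qed.

Lemma kap_ge0 z : 0 <= kap z.
Proof. by rewrite le_min ler01 sqr_ge0. Qed.

Lemma kap_small z : euclidean_norm z <= 1 -> kap z = euclidean_norm z ^+ 2.
Proof.
by move=> z1; apply/min_idPr; rewrite expr_le1// euclidean_norm_ge0.
Qed.

Lemma kap_large z : 1 < euclidean_norm z -> kap z = 1.
Proof.
move=> z1; apply/min_idPl; rewrite expr_ge1// ?(ltW z1)//.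
exact: euclidean_norm_ge0.
Qed.

Lemma euclidean_normN z : euclidean_norm (- z) = euclidean_norm z.
Proof. by congr Num.sqrt; apply: eq_bigr => i _; rewrite mxE sqrrN. Qed.

Lemma euclidean_norm0 : euclidean_norm (0 : X) = 0.
Proof. by rewrite /euclidean_norm big1 ?sqrtr0// => i _; rewrite mxE expr0n. Qed.

Lemma kapN z : kap (- z) = kap z.
Proof. by rewrite /kap euclidean_normN. Qed.

Lemma euclidean_norm_eq0 z : euclidean_norm z = 0 -> z = 0.
Proof.
move=> z0; apply/rowP => i; rewrite mxE; apply/eqP; rewrite -normr_eq0.
by rewrite eq_le normr_ge0 andbT -z0; exact: coord_le_euclidean.
Qed.

Lemma measurable_set1_rV0 : measurable [set (0 : X)].
Proof.
rewrite (_ : [set 0] = [set z | euclidean_norm z = 0]).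
  have := @measurable_euclidean_norm measurableT [set 0] (measurable_set1 0).
  by rewrite setTI.
by apply/seteqP; split => z /=; [move=> ->; exact: euclidean_norm0|exact: euclidean_norm_eq0].
Qed.

Variable mu : {measure set X -> \bar R}.
Hypotheses (mu0 : mu [set 0] = 0%E) (mu_levy : levy_integrable mu).

Lemma kap_integrable : mu.-integrable setT (EFin \o kap).
Proof.
have mk := measurable_kap.
apply: ge0_RintegrableE => //; first exact: kap_ge0.
apply: le_lt_trans mu_levy.
have me := measurable_euclidean_norm.
have mA : measurable [set z : X | z != 0 /\ euclidean_norm z <= 1].
  rewrite (_ : [set z | _] = ~` [set 0] `&` [set z | euclidean_norm z <= 1]).
    apply: measurableI; first exact: measurableC measurable_set1_rV0.
    exact: measurable_lec.
  by apply/seteqP; split => z /= [/eqP z0 z1].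
have mB : measurable [set z : X | 1 < euclidean_norm z].
  exact: measurable_gtc.
rewrite [leRHS](_ : _ = (\int[mu]_(z in [set z | z != 0%R /\ (euclidean_norm z <= 1)%R]) (kap z)%:E +
   \int[mu]_(z in [set z | (1 < euclidean_norm z)%R]) (kap z)%:E)%E); last first.
  congr (_ + _)%E; apply: eq_integral => z; rewrite inE/=.
    by move=> [_ z1]; rewrite kap_small.
  by move=> z1; rewrite kap_large.
rewrite -ge0_integral_setU//; last 3 first.
- by apply: measurable_funTS; exact/measurable_EFinP.
- by move=> z _; rewrite lee_fin kap_ge0.
- by rewrite disj_set2E; apply/eqP/seteqP; split => // z /= [[_]]; rewrite leNgt => /negP.
rewrite [leRHS]integral_mkcond; apply: ge0_le_integral => //.
- by move=> z _; rewrite lee_fin kap_ge0.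
- exact/measurable_EFinP.
- apply/(measurable_restrictT _ _).1 => //; first exact: measurableU.
  by apply: measurable_funTS; exact/measurable_EFinP.
move=> z _; rewrite patchE; case: ifPn => // /negP zAB.
have -> : kap z = 0.
  have [z1|z1] := leP (euclidean_norm z) 1; last by exfalso; apply: zAB; rewrite inE; right.
  rewrite kap_small//; have [->|z0] := eqVneq z 0; first by rewrite euclidean_norm0 expr0n.
  by exfalso; apply: zAB; rewrite inE; left.
by [].
Qed.

(** Chebyshev for the integrable [kap]: each set where it is at least 1/(n+1) has finite measure.
    Together they miss only the origin, which is null. *)
Lemma levy_sigma_finite : sigma_finite setT mu.
Proof.
have mk := measurable_kap.
pose F n := [set z : X | n.+1%:R^-1 <= kap z].
have mF n : measurable (F n).
  exact: measurable_gec.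
exists (fun n => [set 0] `|` F n).
  apply/seteqP; split => // z _.
  have [->|z0] := eqVneq z 0; first by exists 0%N => //; left.
  have kz : 0 < kap z.
    rewrite lt_min ltr01 exprn_gt0// lt_neqAle euclidean_norm_ge0 andbT eq_sym.
    by apply: contra_neq z0 => /euclidean_norm_eq0.
  have [n] := ltr_add_invr kz; rewrite add0r => nk.
  by exists n => //; right; exact: ltW.
move=> n; split; first by apply: measurableU => //; exact: measurable_set1_rV0.
apply: (@le_lt_trans _ _ (mu [set 0%R] + mu (F n))%E).
  by apply: measureU2 => //; exact: measurable_set1_rV0.
rewrite mu0 add0e.
apply: (@le_lt_trans _ _ (\int[mu]_z (n.+1%:R * kap z)%:E)%E); last first.
  by have /integrableP[_] := RintegrableZl n.+1%:R kap_integrable;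
     under eq_integral do rewrite /= ger0_norm ?mulr_ge0 ?kap_ge0//.
rewrite -[X in mu X]setIT -integral_indic//; apply: ge0_le_integral => //.
- by apply/measurable_EFinP; exact: measurable_indic.
- by apply/measurable_EFinP; exact: measurable_funM.
move=> z _; rewrite lee_fin indicE; case: (boolP (z \in F n)) => [|_]; last by rewrite mulr_ge0// kap_ge0.
by rewrite inE/= /F/= => h; rewrite -ler_pdivrMl// mulr1.
Qed.

Hypothesis mu_even : even_measure mu.

Lemma mpres_opp : mpres mu (fun z => - z).
Proof.
have mN : measurable_fun setT (fun z : X => - z) by apply: measurable_rVN.
split => // f mf f0.
rewrite -(ge0_integral_pushforward mN _ measurableT)//.
apply: eq_measure_integral => A mA _; rewrite mu_even// /pushforward/=.
congr (mu _); apply/seteqP; split => z /=; last by move=> [y Ay <-]; rewrite opprK.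
by move=> Az; exists (- z); rewrite ?opprK.
Qed.

(* By evenness of mu, L^mu is LL: see levy_operatorE. *)
Definition dz z f : Om -> R := fun w => f (sh (z, 0) w) - f w.
Definition ddz z f : Om -> R := fun w => f (sh (z, 0) w) + f (sh (- z, 0) w) - 2 * f w.
Definition LL f : Om -> R := fun w => 2^-1 * \int[mu]_z ddz z f w.

Variable T : R.
Variable psi : X * R -> R.
Hypothesis psiT : test_function T psi.

Lemma test_continuous : continuous psi.
Proof. exact: (psiT.1 0%N). Qed.

Lemma test_measurable : measurable_fun setT (psi : Om -> R).
Proof. exact: continuous_measurable_prod test_continuous. Qed.

Lemma gradient_slice x t i : 'D_(delta_mx ord0 i : X) (fun x => psi (x, t)) x =
  'D_(unitv i) psi (x, t).
Proof.
have E : (fun h : R => h^-1 *: (psi (h *: (delta_mx ord0 i : X) + x, t) - psi (x, t))) =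
    (fun h : R => h^-1 *: (psi (h *: unitv i + (x, t)) - psi (x, t))).
  apply/funext => h; congr (_ *: (psi _ - _)).
  by rewrite /unitv; congr pair; rewrite /= /GRing.scale/= mulr0 add0r.
by rewrite /derive E.
Qed.

Lemma dot_gradient x t z : dot z (gradient (fun x => psi (x, t)) x) = 'D_(z, 0) psi (x, t).
Proof.
rewrite derive_slice; last by have [] := psiT.1 1%N.
by apply: eq_bigr => i _; rewrite mxE gradient_slice.
Qed.

(** Taylor's formula for |z| <= 1 and the bound on [psi] for |z| > 1 are both expressed by [kap].
    The second difference is the sum of the compensated first differences for z and -z, in which the
    gradient terms cancel; hence the constant [2 * C]. *)
Lemma test_bounds : exists2 B : R, 0 <= B & forall x z t, 0 <= t < T ->
  [/\ `|psi (x, t)| <= B, `|psi (x + z, t) - psi (x, t)| ^+ 2 <= B * kap z,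
      `|psi (x + z, t) - psi (x, t)
        - 'D_(z, 0) psi (x, t) * (euclidean_norm z <= 1)%R%:R| <= B * kap z
    & `|ddz z psi (x, t)| <= B * kap z].
Proof.
have [cK [K [KK KT vK]]] := psiT.
have [B B0 h] := slice_bounds KK (cK 2%N) vK.
pose C := B + B * B + (2 * B) ^+ 2 + 2 * B.
have C1 : B <= C by rewrite /C; have := sqr_ge0 (2 * B); nra.
have C2 : B * B <= C by rewrite /C; have := sqr_ge0 (2 * B); nra.
have C3 : (2 * B) ^+ 2 <= C by rewrite /C; nra.
have C4 : 2 * B <= C by rewrite /C; have := sqr_ge0 (2 * B); nra.
have C0 : 0 <= C by exact: le_trans C1.
have F1 x z t : 0 <= t < T -> `|psi (x + z, t) - psi (x, t)
        - 'D_(z, 0) psi (x, t) * (euclidean_norm z <= 1)%R%:R| <= C * kap z.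
  move=> tT; have [h1 h2 h3] := h x z t tT; have [h1' _ _] := h (x + z) z t tT.
  have [z1|z1] := leP (euclidean_norm z) 1.
    by rewrite mulr1 kap_small//; apply: le_trans h3 _; rewrite ler_wpM2r// sqr_ge0.
  rewrite mulr0 subr0 kap_large// mulr1; apply: le_trans C4.
  by apply: le_trans (ler_normB _ _) _; rewrite mulr2n mulrDl mul1r lerD.
exists (2 * C) => [|x z t tT]; first by rewrite mulr_ge0.
have [h1 h2 h3] := h x z t tT; have [h1' _ _] := h (x + z) z t tT.
have k0 := kap_ge0 z; have Ck := mulr_ge0 C0 k0.
have C2k : C * kap z <= 2 * C * kap z by rewrite -mulrA ler_peMl// ler1n.
split.
- by apply: le_trans h1 _; apply: le_trans C1 _; rewrite ler_peMl// ler1n.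
- apply: le_trans C2k; have [z1|z1] := leP (euclidean_norm z) 1.
    rewrite kap_small//; apply: (@le_trans _ _ ((B * euclidean_norm z) ^+ 2)).
      by rewrite lerXn2r// nnegrE// mulr_ge0// euclidean_norm_ge0.
    by rewrite exprMn ler_wpM2r ?sqr_ge0// expr2.
  rewrite kap_large// mulr1; apply: le_trans C3.
  rewrite lerXn2r ?nnegrE ?mulr_ge0//.
  by apply: le_trans (ler_normB _ _) _; rewrite mulr2n mulrDl mul1r lerD.
- by apply: le_trans (F1 x z t tT) _.
- have G1 := F1 x z t tT; have := F1 x (- z) t tT; rewrite euclidean_normN kapN.
  rewrite -!dot_gradient (_ : dot (- z) _ = - dot z (gradient (fun x => psi (x, t)) x)); last first.
    by rewrite /dot -sumrN; apply: eq_bigr => i _; rewrite mxE mulNr.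
  move=> G2; rewrite /ddz /sh/= addr0; move: G1 G2; rewrite -dot_gradient !mulNr opprK => G1 G2.
  rewrite (_ : 2 * C * kap z = C * kap z + C * kap z); last by ring.
  apply: le_trans (lerD G1 G2); apply: le_trans (ler_normD _ _).
  by rewrite le_eqVlt; apply/orP; left; apply/eqP; congr `|_|; ring.
Qed.

(** The integral is added to its reflection under z -> -z: the gradient terms cancel and [ddz]
    remains. The origin contributes nothing because the integrand is 0 there. *)
Lemma levy_operatorE x t : 0 <= t < T ->
  levy_operator mu (fun x => psi (x, t)) x = LL psi (x, t).
Proof.
move=> tT; have [B B0 h] := test_bounds.
pose F z := psi (x + z, t) - psi (x, t)
        - 'D_(z, 0) psi (x, t) * (euclidean_norm z <= 1)%R%:R.
have mF : measurable_fun setT F.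
  apply: measurable_funB; last first.
    apply: measurable_funM.
      rewrite (_ : (fun z => _) = (fun z => dot z (gradient (fun x => psi (x, t)) x))); last first.
        by apply/funext => z; rewrite dot_gradient.
      apply: measurable_sum => i; apply: measurable_funM => //; exact: measurable_coord.
    rewrite (_ : (fun z => _) = \1_[set z : X | euclidean_norm z <= 1]); last first.
      apply/funext => z; rewrite indicE; have [z1|z1] := leP (euclidean_norm z) 1.
        by rewrite mem_set.
      by rewrite memNset//= leNgt z1.
    apply: measurable_indic.
    apply: measurable_lec; exact: measurable_euclidean_norm.
  apply: measurable_funB => //.
  apply: (measurableT_comp test_measurable) => /=; apply: measurable_fun_pair => //.
  exact: measurable_rVD.
have iF : mu.-integrable setT (EFin \o F).
  apply: (@le_Rintegrable _ _ _ _ _ (fun z => B * kap z)) => //.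
    by move=> z; have [] := h x z t tT.
  by apply: RintegrableZl; exact: kap_integrable.
have iFN := mpres_integrable mpres_opp iF.
have FN := mpres_Rintegral mpres_opp mF.
have E : levy_operator mu (fun x => psi (x, t)) x = \int[mu]_z F z.
  rewrite /levy_operator Rintegral_mkcond; apply: eq_Rintegral => z _; rewrite patchE.
  rewrite dot_gradient; case: ifPn => // /negP z0.
  have -> : z = 0 by apply: contrapT => /eqP zn0; apply: z0; rewrite inE.
  rewrite /F addr0 subrr euclidean_norm0 ler01 mulr1 sub0r -dot_gradient.
  by rewrite /dot big1 ?oppr0// => i _; rewrite mxE mul0r.
rewrite E /LL; apply: (mulfI (_ : 2 != 0)); first by rewrite pnatr_eq0.
rewrite mulrA divff ?pnatr_eq0// mul1r mulr2n mulrDl mul1r -{2}FN -RintegralD//.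
apply: eq_Rintegral => z _; rewrite /F/= -!dot_gradient euclidean_normN.
rewrite (_ : dot (- z) _ = - dot z (gradient (fun x => psi (x, t)) x)); last first.
  by rewrite /dot -sumrN; apply: eq_bigr => i _; rewrite mxE mulNr.
by rewrite /ddz /sh/= !addr0; ring.
Qed.

End levy_measure.

(** * Limits of integrals and soft thresholding *)

Section limits_of_integrals.
Context d (T : measurableType d) (R : realType).
Variable m : {measure set T -> \bar R}.

Lemma fatou_bound (f_ : (T -> R)^nat) (f : T -> R) (K : R) :
  (forall n, measurable_fun setT (f_ n)) -> (forall n x, 0 <= f_ n x) ->
  (forall x, f_ ^~ x @ \oo --> f x) ->
  (forall n, (\int[m]_x (f_ n x)%:E <= K%:E)%E) ->
  (\int[m]_x (f x)%:E <= K%:E)%E.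
Proof.
move=> mf f0 ff fK.
have -> : (\int[m]_x (f x)%:E = \int[m]_x limn_einf (fun n => (f_ n x)%:E))%E.
  apply: eq_integral => x _; apply/esym.
  have c : (fun n => (f_ n x)%:E) @ \oo --> (f x)%:E.
    by apply: cvg_EFin; [exact: nearW|exact: ff].
  have [+ _] := cvg_limn_einf_sup c; exact.
apply: le_trans (@fatou _ _ _ m setT measurableT (fun n x => (f_ n x)%:E) _ _) _.
- by move=> n; exact/measurable_EFinP.
- by move=> n x _; rewrite lee_fin.
rewrite limn_einf_lim; apply: lime_le; first exact: is_cvg_einfs.
near=> n; apply: le_trans (fK n); apply: ereal_inf_lbound.
by exists n => /=.
Unshelve. all: by end_near. Qed.

Lemma Rdct (f_ : (T -> R)^nat) (f g : T -> R) :
  (forall n, measurable_fun setT (f_ n)) -> measurable_fun setT f ->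
  (forall x, f_ ^~ x @ \oo --> f x) ->
  m.-integrable setT (EFin \o g) -> (forall n x, `|f_ n x| <= g x) ->
  m.-integrable setT (EFin \o f) /\
  (fun n => \int[m]_x f_ n x) @ \oo --> \int[m]_x f x.
Proof.
move=> mf_ mf ff ig fg.
have [] := @dominated_convergence _ _ _ m setT measurableT (fun n x => (f_ n x)%:E) (EFin \o f) (EFin \o g).
- by move=> n; exact/measurable_EFinP.
- exact/measurable_EFinP.
- by apply: aeW => x _; apply: cvg_EFin; [exact: nearW|exact: ff].
- by [].
- by apply: aeW => x n _; rewrite lee_fin.
move=> fi _ c; split => //.
have : (\int[m]_x (f x)%:E)%E \is a fin_num by exact: integrable_fin_num.
by move=> /fineK E; move: c; rewrite -E => /fine_cvgP[].
Qed.

End limits_of_integrals.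

Section trunc.
Context {R : realType}.
Implicit Types e x y : R.

(** Soft thresholding: values in [-e, e] become 0 and the others move towards 0 by [e]. It is
    monotone and 1-Lipschitz, and it gives a function whose level sets have finite measure a support
    of finite measure. *)
Definition trunc e x : R := x - Num.max (- e) (Num.min e x).

Lemma truncP e x : 0 <= e ->
  [\/ (x <= - e) /\ trunc e x = x + e, (- e <= x <= e) /\ trunc e x = 0 |
      (e <= x) /\ trunc e x = x - e].
Proof.
move=> e0; rewrite /trunc.
have [xe|ex] := leP e x.
  by constructor 3; split => //; rewrite (max_idPr _)// lerNl; lra.
have [xe|ex'] := leP x (- e).
  by constructor 1; split => //; rewrite opprK.
by constructor 2; rewrite subrr; split => //; rewrite !ltW.
Qed.

Lemma trunc_mono e x y : 0 <= e -> 0 <= (x - y) * (trunc e x - trunc e y).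
Proof.
move=> e0; have [xy|xy] := leP x y.
  apply: mulr_le0; first by rewrite subr_le0.
  case: (truncP x e0) => -[hx ->]; case: (truncP y e0) => -[hy ->];
    move: hx hy; do ?[move=> /andP[]]; lra.
apply: mulr_ge0; first by rewrite subr_ge0 ltW.
case: (truncP x e0) => -[hx ->]; case: (truncP y e0) => -[hy ->]; lra.
Qed.

Lemma trunc_lip e x y : 0 <= e -> `|trunc e x - trunc e y| <= `|x - y|.
Proof.
move=> e0; rewrite ler_norml; case: (leP 0 (x - y)) => xy; [rewrite ger0_norm//|rewrite ltr0_norm//];
by case: (truncP x e0) => -[hx ->]; case: (truncP y e0) => -[hy ->]; lra.
Qed.

Lemma trunc0 e : 0 <= e -> trunc e 0 = 0.
Proof. by move=> e0; case: (truncP 0 e0) => -[hx ->]; lra. Qed.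

Lemma trunc_le e x : 0 <= e -> `|trunc e x| <= `|x|.
Proof. by move=> e0; have := trunc_lip x 0 e0; rewrite trunc0// !subr0. Qed.

Lemma trunc_neq0 e x : 0 <= e -> trunc e x != 0 -> e < `|x|.
Proof.
move=> e0; rewrite ltNge; apply: contra_neqN; rewrite ler_norml => xe.
by case: (truncP x e0) => -[hx ->]; lra.
Qed.

Lemma trunc_near e x : 0 <= e -> `|x - trunc e x| <= e.
Proof. by move=> e0; rewrite ler_norml; case: (truncP x e0) => -[hx ->]; lra. Qed.

Lemma measurable_trunc d (T : measurableType d) (f : T -> R) e :
  measurable_fun setT f -> measurable_fun setT (fun w => trunc e (f w)).
Proof.
by move=> mf; apply: measurable_funB => //; apply: measurable_maxr => //; exact: measurable_minr.
Qed.

Lemma trunc_cvg x : (fun n : nat => trunc n.+1%:R^-1 x) @ \oo --> x.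
Proof.
apply/cvgrPdist_le => e e0; near=> n.
apply: le_trans (trunc_near _ _) _; first by rewrite invr_ge0.
near: n; have [k] := ltr_add_invr e0; rewrite add0r => ke.
exists k => // n /= kn; apply: le_trans (ltW ke).
by rewrite lef_pV2 ?posrE// ler_nat.
Unshelve. all: by end_near. Qed.

End trunc.

Lemma normM_le_sqr (R : realType) (x y v : R) : `|v| <= `|y| ->
  `|x * v| <= x ^+ 2 + y ^+ 2.
Proof.
move=> vy; rewrite normrM -(real_normK (num_real x)) -(real_normK (num_real y)).
apply: (@le_trans _ _ (`|x| * `|y|)); first by rewrite ler_wpM2l.
have := normr_ge0 x; have := normr_ge0 y; nra.
Qed.

(** * Integration by parts in the nonlocal form *)

Section nonlocal_form.
Context {R : realType} {N : nat}.
Notation X := ('rV[R]_N).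
Notation Om := ('rV[R]_N * measurableTypeR R)%type.
Notation m := (@lebesgue_Q R N).
Variable mu : {sigma_finite_measure set X -> \bar R}.
Notation M := (lebesgue_Q \x mu)%E.
Implicit Types (z : X) (f g p q a b : Om -> R) (w : Om).

Definition shx z : Om -> Om := sh (z, 0).

Lemma mpres_shx z : mpres m (shx z).
Proof. exact: mpres_sh. Qed.

Lemma shxN z w : shx (- z) (shx z w) = w.
Proof. by rewrite /shx /sh/= !addr0 addrK -surjective_pairing. Qed.

Lemma measurable_shx2 : measurable_fun setT (fun r : Om * X => shx r.2 r.1).
Proof.
have m1 : measurable_fun setT (fun r : Om * X => r.1.1) by exact: measurableT_comp.
have m2 : measurable_fun setT (fun r : Om * X => r.1.2) by exact: measurableT_comp.
apply: measurable_fun_pair => /=; first exact: measurable_rVD.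
exact: measurable_funD.
Qed.

Lemma measurable_shxN2 : measurable_fun setT (fun r : Om * X => shx (- r.2) r.1).
Proof.
have m1 : measurable_fun setT (fun r : Om * X => r.1.1) by exact: measurableT_comp.
have m2 : measurable_fun setT (fun r : Om * X => r.1.2) by exact: measurableT_comp.
apply: measurable_fun_pair => /=; last exact: measurable_funD.
by apply: measurable_rVD => //; exact: measurable_rVN.
Qed.

Lemma measurable_dz2 f : measurable_fun setT f ->
  measurable_fun setT (fun r : Om * X => dz r.2 f r.1).
Proof.
move=> mf; apply: measurable_funB; last exact: measurableT_comp mf measurable_fst.
exact: measurableT_comp mf measurable_shx2.
Qed.

Lemma measurable_ddz2 f : measurable_fun setT f ->
  measurable_fun setT (fun r : Om * X => ddz r.2 f r.1).
Proof.
move=> mf; apply: measurable_funB.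
  apply: measurable_funD; first exact: measurableT_comp mf measurable_shx2.
  exact: measurableT_comp mf measurable_shxN2.
by apply: measurable_funM => //; exact: measurableT_comp mf measurable_fst.
Qed.

Lemma measurable_pair1 (w : Om) : measurable_fun setT (fun z : X => (w, z)).
Proof. exact: measurable_fun_pair. Qed.

Lemma measurable_pair2 z : measurable_fun setT (fun w : Om => (w, z)).
Proof. exact: measurable_fun_pair. Qed.

Lemma measurable_LL f : measurable_fun setT f -> measurable_fun setT (LL mu f).
Proof.
move=> mf; apply: measurable_funM => //.
exact: (measurable_Rintegral2 mu (measurable_ddz2 mf)).
Qed.

Lemma shx_integral z f : measurable_fun setT f ->
  \int[m]_w f (shx z w) = \int[m]_w f w.
Proof. by move=> mf; exact: (mpres_Rintegral (mpres_shx z) mf). Qed.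

Lemma shx_integrable z f : m.-integrable setT (EFin \o f) ->
  m.-integrable setT (EFin \o (fun w => f (shx z w))).
Proof. by move=> fi; exact: (mpres_integrable (mpres_shx z) fi). Qed.

Hypothesis kapi : mu.-integrable setT (EFin \o kap).

(** For fixed [z] the four products are expanded, and translation invariance rewrites those with a
    shifted [q]; what remains is minus the pairing of [q] with the second difference of [p].
    Integrability over [M] then allows integration in [z]. *)
Lemma form_by_parts p q : measurable_fun setT p -> measurable_fun setT q ->
  M.-integrable setT (EFin \o (fun r => dz r.2 p r.1 * dz r.2 q r.1)) ->
  M.-integrable setT (EFin \o (fun r => q r.1 * ddz r.2 p r.1)) ->
  (forall z, m.-integrable setT (EFin \o (fun w => q w * p (shx z w)))) ->
  \int[M]_r (dz r.2 p r.1 * dz r.2 q r.1) = - \int[M]_r (q r.1 * ddz r.2 p r.1).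
Proof.
move=> mp mq H1 H2 H3; rewrite -(Rfubini2 H1).2 -(Rfubini2 H2).2.
have h2 := (Rfubini2 H2).1.
have -> : - (\int[mu]_z \int[m]_w (q w * ddz z p w)) =
    \int[mu]_z ((-1) * \int[m]_w (q w * ddz z p w)).
  by rewrite RintegralZl// mulN1r.
apply: eq_Rintegral => z _ /=; rewrite mulN1r.
pose I z := \int[m]_w (q w * p (shx z w)).
have i0 : m.-integrable setT (EFin \o (fun w => q w * p w)).
  have := H3 0; congr (_.-integrable _ _); apply/funext => w /=.
  by rewrite /shx sh0.
have iz := H3 z.
have iNz : m.-integrable setT (EFin \o (fun w => q (shx z w) * p w)).
  have := shx_integrable z (H3 (- z)); congr (_.-integrable _ _).
  by apply/funext => w /=; rewrite shxN.
have i0z := shx_integrable z i0.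
have mqp z' : measurable_fun setT (fun w => q w * p (shx z' w)).
  exact: integrable_measurable (H3 z').
have EN : \int[m]_w (q (shx z w) * p w) = I (- z).
  apply: etrans (shx_integral z (mqp (- z))); apply: eq_Rintegral => w _.
  by rewrite shxN.
have E0 : \int[m]_w (q (shx z w) * p (shx z w)) = \int[m]_w (q w * p w).
  exact: (shx_integral z (integrable_measurable i0)).
transitivity (\int[m]_w (q (shx z w) * p (shx z w)) + \int[m]_w (q w * p w) - I z
    - \int[m]_w (q (shx z w) * p w)).
  rewrite /I -RintegralD// -RintegralB//; last exact: RintegrableD.
  rewrite -RintegralB//; last by apply: RintegrableB => //; exact: RintegrableD.
  by apply: eq_Rintegral => w _; rewrite /dz -/(shx z w); ring.
rewrite E0 EN.
have -> : \int[m]_w (q w * ddz z p w) = I z + I (- z) - 2 * \int[m]_w (q w * p w).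
  rewrite /I -RintegralZl// -RintegralD// -RintegralB//; last first.
  - exact: RintegrableZl.
  - exact: RintegrableD.
  by apply: eq_Rintegral => w _; rewrite /ddz -/(shx z w) -/(shx (- z) w); ring.
by ring.
Qed.

Lemma integral_ddz_LL p q (C : R) : measurable_fun setT p ->
  (forall z w, `|ddz z p w| <= C * kap z) ->
  M.-integrable setT (EFin \o (fun r => q r.1 * ddz r.2 p r.1)) ->
  m.-integrable setT (EFin \o (fun w => q w * LL mu p w)) /\
  \int[M]_r (q r.1 * ddz r.2 p r.1) = 2 * \int[m]_w (q w * LL mu p w).
Proof.
move=> mp pC H2; have [h1 h2] := Rfubini1 H2.
have ip w : mu.-integrable setT (EFin \o (fun z => ddz z p w)).
  apply: (@le_Rintegrable _ _ _ _ _ (fun z => C * kap z)) => //.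
    exact: measurableT_comp (measurable_ddz2 mp) (measurable_pair1 w).
  exact: RintegrableZl.
have E w : \int[mu]_z (q w * ddz z p w) = 2 * (q w * LL mu p w).
  by rewrite RintegralZl// /LL; field.
have iL : m.-integrable setT (EFin \o (fun w => q w * LL mu p w)).
  have := RintegrableZl 2^-1 h1; congr (_.-integrable _ _).
  by apply/funext => w /=; rewrite E mulrA mulVf ?mul1r// pnatr_eq0.
split => //; rewrite -h2 -RintegralZl//.
by apply: eq_Rintegral => w _; exact: E.
Qed.

(** The integral over [M] lacks the factor 1/2 of the energy and [LL] contains one, hence the
    constant -2. *)
Lemma form_LL p q (C : R) : measurable_fun setT p -> measurable_fun setT q ->
  (forall z w, `|ddz z p w| <= C * kap z) ->
  M.-integrable setT (EFin \o (fun r => dz r.2 p r.1 * dz r.2 q r.1)) ->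
  M.-integrable setT (EFin \o (fun r => q r.1 * ddz r.2 p r.1)) ->
  (forall z, m.-integrable setT (EFin \o (fun w => q w * p (shx z w)))) ->
  \int[M]_r (dz r.2 p r.1 * dz r.2 q r.1) = - 2 * \int[m]_w (q w * LL mu p w).
Proof.
move=> mp mq pC H1 H2 H3; rewrite form_by_parts//.
by rewrite (integral_ddz_LL mp pC H2).2 mulNr.
Qed.

(** The class for integration by parts: in place of integrability it asks that the sets above each
    positive level have finite measure, which truncation turns into a support of finite measure. *)
Definition tame (C : R) b := [/\ measurable_fun setT b, forall w, `|b w| <= C,
  forall z w, `|dz z b w| ^+ 2 <= C * kap z &
  forall e : R, 0 < e -> (m [set w | (e < `|b w|)%R] < +oo)%E].

Lemma integrable_finite_support (c : Om -> R) (E : set Om) (K : R) : measurable_fun setT c ->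
  measurable E -> (m E < +oo)%E -> (forall w, `|c w| <= K * \1_E w) ->
  m.-integrable setT (EFin \o c).
Proof.
move=> mc mE Eoo cE; apply: (@le_Rintegrable _ _ _ _ _ (fun w => K * \1_E w)) => //.
by apply: RintegrableZl; exact: Rintegrable_indic.
Qed.

(** The truncation of [b] lives on a set [E] of finite measure. The product of differences is at
    most C kap z and vanishes unless [w] or its shift lies in [E], so it is integrable, and so is
    the pairing with the second difference of [a]. *)
Lemma form_trunc C a b (e : R) : 0 < e -> tame C a -> tame C b ->
  (forall z w, `|ddz z a w| <= C * kap z) ->
  M.-integrable setT (EFin \o (fun r => dz r.2 a r.1 * dz r.2 (trunc e \o b) r.1)) /\
  \int[M]_r (dz r.2 a r.1 * dz r.2 (trunc e \o b) r.1) =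
   - 2 * \int[m]_w (trunc e (b w) * LL mu a w).
Proof.
move=> e0 [ma aC da _] [mb bC db fb] ddaC; have e0' := ltW e0.
have C0 : 0 <= C by apply: le_trans (aC (0, 0)).
pose c w := trunc e (b w); have mc : measurable_fun setT c by exact: measurable_trunc.
pose E := [set w | (e < `|b w|)%R].
have mE : measurable E by apply: measurable_gtc; exact: measurableT_comp.
have Eoo := fb e e0; rewrite -/E in Eoo.
have cC w : `|c w| <= C by apply: le_trans (bC w); exact: trunc_le.
have cE w : `|c w| <= C * \1_E w.
  rewrite indicE; have [Ew|Ew] := pselect (E w); first by rewrite mem_set// mulr1.
  have -> : c w = 0 by apply: contra_notP Ew => /eqP /(trunc_neq0 e0').
  by rewrite normr0 mulr_ge0.
have ic : m.-integrable setT (EFin \o c) by exact: integrable_finite_support cE.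
have H2 : M.-integrable setT (EFin \o (fun r => c r.1 * ddz r.2 a r.1)).
  apply: (@le_Rintegrable _ _ _ _ _ (fun r => (C * \1_E r.1) * (C * kap r.2))).
  - apply: measurable_funM; last exact: measurable_ddz2.
    exact: measurableT_comp mc measurable_fst.
  - by move=> r; rewrite normrM ler_pM.
  - apply: (@Rintegrable_prodM _ _ _ _ _ _ _ (fun w => C * \1_E w) (fun z => C * kap z)); last exact: RintegrableZl.
    by apply: RintegrableZl; exact: Rintegrable_indic.
have dE z w : `|dz z a w * dz z c w| <= C * kap z * (\1_E w + \1_E (shx z w)).
  have k0 := mulr_ge0 C0 (kap_ge0 z).
  have [[Ew Ew']|/not_andP nE] := pselect (~ E w /\ ~ E (shx z w)).
    have -> : dz z c w = 0.
      have c1 : c w = 0 by apply: contra_notP Ew => /eqP /(trunc_neq0 e0').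
      have c2 : c (shx z w) = 0 by apply: contra_notP Ew' => /eqP /(trunc_neq0 e0').
      by rewrite /dz -/(shx z w) c1 c2 subrr.
    by rewrite mulr0 normr0 mulr_ge0// addr_ge0.
  have dc : `|dz z c w| <= `|dz z b w| by exact: trunc_lip.
  apply: (@le_trans _ _ (C * kap z)).
    rewrite normrM; apply: (@le_trans _ _ (`|dz z a w| * `|dz z b w|)); first by rewrite ler_wpM2l.
    have := da z w; have := db z w; set x := `|dz z a w|; set y := `|dz z b w|; nra.
  rewrite ler_peMr// !indicE; case: nE => /contrapT h; rewrite (mem_set h).
    by rewrite lerDl.
  by rewrite lerDr.
have mdd : measurable_fun setT (fun r : Om * X => dz r.2 a r.1 * dz r.2 c r.1).
  by apply: measurable_funM; exact: measurable_dz2.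
have iEE z : m.-integrable setT (EFin \o (fun w => C * kap z * (\1_E w + \1_E (shx z w)))).
  have iE := Rintegrable_indic mE Eoo.
  by apply: RintegrableZl; apply: RintegrableD => //; exact: shx_integrable.
have H1 : M.-integrable setT (EFin \o (fun r => dz r.2 a r.1 * dz r.2 c r.1)).
  have iEt := Rintegrable_indic mE Eoo.
  have idd z : m.-integrable setT (EFin \o (fun w => dz z a w * dz z c w)).
    apply: le_Rintegrable (dE z) (iEE z).
    exact: measurableT_comp mdd (measurable_pair2 z).
  apply: (@RintegrableX1 _ _ _ _ _ _ _ _ (fun z => (C * (2 * \int[m]_w \1_E w)) * kap z)) => //.
  - move=> z /=; apply: (@le_trans _ _ (\int[m]_w (C * kap z * (\1_E w + \1_E (shx z w))))).
      apply: le_Rintegral => //; first exact: integrable_norm.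
    rewrite RintegralZl//; last by apply: RintegrableD => //; exact: shx_integrable.
    rewrite RintegralD//; last exact: shx_integrable.
    rewrite (shx_integral z (measurable_ind mE)) le_eqVlt; apply/orP; left.
    by apply/eqP; ring.
  - exact: RintegrableZl.
split => //; apply: (form_LL ma mc ddaC H1 H2) => z.
have maz : measurable_fun setT (fun w => a (shx z w)).
  by apply: measurableT_comp ma _; exact: measurable_sh.
have := Rintegrable_bounded_mull maz (fun w => aC (shx z w)) ic.
by congr (_.-integrable _ _); apply/funext => w /=; rewrite mulrC.
Qed.

(* b need not be integrable, but trunc e b is, since it vanishes off a set of
   finite measure; then e goes to 0. *)
Lemma form_identity C a b : tame C a -> tame C b ->
  (forall z w, `|ddz z a w| <= C * kap z) ->
  m.-integrable setT (EFin \o LL mu a) ->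
  M.-integrable setT (EFin \o (fun r => dz r.2 a r.1 ^+ 2)) ->
  M.-integrable setT (EFin \o (fun r => dz r.2 b r.1 ^+ 2)) ->
  \int[M]_r (dz r.2 a r.1 * dz r.2 b r.1) = - 2 * \int[m]_w (b w * LL mu a w).
Proof.
move=> ta tb ddaC iL ia ib; have [ma aC _ _] := ta; have [mb bC _ _] := tb.
pose e n : R := n.+1%:R^-1; have e0 n : 0 < e n by rewrite invr_gt0.
pose c n w := trunc (e n) (b w).
have mc n : measurable_fun setT (c n) by exact: measurable_trunc.
have cb w : c ^~ w @ \oo --> b w by exact: trunc_cvg.
have mL := integrable_measurable iL.
have [_ c1] : m.-integrable setT (EFin \o (fun w => b w * LL mu a w)) /\
    (fun n => \int[m]_w (c n w * LL mu a w)) @ \oo --> \int[m]_w (b w * LL mu a w).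
  apply: (@Rdct _ _ _ _ _ _ (fun w => C * `|LL mu a w|)).
  - by move=> n; exact: measurable_funM.
  - exact: measurable_funM.
  - by move=> w; apply: cvgMl.
  - by apply: RintegrableZl; exact: integrable_norm.
  - move=> n w; rewrite normrM ler_wpM2r//; apply: le_trans (bC w).
    by apply: trunc_le; exact: ltW.
have [_ c2] : M.-integrable setT (EFin \o (fun r => dz r.2 a r.1 * dz r.2 b r.1)) /\
    (fun n => \int[M]_r (dz r.2 a r.1 * dz r.2 (c n) r.1)) @ \oo --> \int[M]_r (dz r.2 a r.1 * dz r.2 b r.1).
  apply: (@Rdct _ _ _ _ _ _ (fun r => dz r.2 a r.1 ^+ 2 + dz r.2 b r.1 ^+ 2)).
  - by move=> n; apply: measurable_funM; exact: measurable_dz2.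
  - by apply: measurable_funM; exact: measurable_dz2.
  - by move=> r; apply: cvgMr; apply: cvgB; exact: cb.
  - exact: RintegrableD.
  - by move=> n r; apply: normM_le_sqr; apply: trunc_lip; exact: ltW.
have E n : \int[M]_r (dz r.2 a r.1 * dz r.2 (c n) r.1) = - 2 * \int[m]_w (c n w * LL mu a w).
  by have [_] := form_trunc (e0 n) ta tb ddaC.
have c3 : (fun n => \int[M]_r (dz r.2 a r.1 * dz r.2 (c n) r.1)) @ \oo -->
    - 2 * \int[m]_w (b w * LL mu a w).
  by rewrite (funext E); apply: cvgMr c1.
by rewrite -(cvg_lim (@Rhausdorff R) c2); exact: (cvg_lim (@Rhausdorff R) c3).
Qed.

(** Against the truncations of [a] itself the integrand is nonnegative by monotonicity, the identity
    bounds its integral by 2 C times the L^1 norm of [LL mu a], and Fatou's lemma removes the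
    truncation. *)
Lemma form_finite C a : tame C a ->
  (forall z w, `|ddz z a w| <= C * kap z) ->
  m.-integrable setT (EFin \o LL mu a) ->
  M.-integrable setT (EFin \o (fun r => dz r.2 a r.1 ^+ 2)).
Proof.
move=> ta ddaC iL; have [ma aC _ _] := ta.
have C0 : 0 <= C by apply: le_trans (aC (0, 0)).
pose e n : R := n.+1%:R^-1; have e0 n : 0 < e n by rewrite invr_gt0.
pose c n w := trunc (e n) (a w).
have mc n : measurable_fun setT (c n) by exact: measurable_trunc.
have cb w : c ^~ w @ \oo --> a w by exact: trunc_cvg.
apply: ge0_RintegrableE.
- by apply: measurable_funX; exact: measurable_dz2.
- by move=> r; exact: sqr_ge0.
apply: (@le_lt_trans _ _ (2 * (C * \int[m]_w `|LL mu a w|))%:E); last exact: ltry.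
apply: (@fatou_bound _ _ _ _ (fun n r => dz r.2 a r.1 * dz r.2 (c n) r.1)).
- by move=> n; apply: measurable_funM; exact: measurable_dz2.
- by move=> n r; rewrite /dz -/(shx r.2 r.1); apply: trunc_mono; exact: ltW.
- by move=> r; rewrite expr2; apply: cvgMr; apply: cvgB; exact: cb.
move=> n; have [i1 E] := form_trunc (e0 n) ta ta ddaC.
rewrite -EFin_Rintegral// lee_fin E; apply: le_trans (ler_norm _) _.
rewrite normrM (_ : `|- 2| = 2 :> R); last by rewrite normrN ger0_norm.
rewrite ler_wpM2l//.
have cC w : `|c n w| <= C by apply: le_trans (aC w); apply: trunc_le; exact: ltW.
have icL := Rintegrable_bounded_mull (mc n) cC iL.
apply: le_trans (le_normr_Rintegral _ _) _ => //.
rewrite -RintegralZl//; last exact: integrable_norm.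
apply: le_Rintegral => //; first exact: integrable_norm.
  by apply: RintegrableZl; exact: integrable_norm.
by move=> w _; rewrite normrM; apply: ler_wpM2r => //; exact: cC.
Qed.

End nonlocal_form.

(** * Averages along kernels *)

Section averages.
Context {R : realType} {N : nat}.
Notation X := ('rV[R]_N).
Notation Om := ('rV[R]_N * measurableTypeR R)%type.
Notation m := (@lebesgue_Q R N).
Implicit Types (f g : Om -> R) (w : Om).

Definition close (e : R) (p : Om) : bool := (`|p.1| < e) && (`|p.2 : R| < e).

Lemma measurable_close e : measurable [set p : Om | close e p].
Proof.
apply: open_measurable_prod.
rewrite (_ : [set p : X * R | _] = ball ((0, 0) : X * R) e); first exact: ball_open.
apply/seteqP; split => [[x t]/andP[/= xe te]|[x t] [/= xe te]].
  by split; rewrite /= -ball_normE/= sub0r normrN.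
by apply/andP; split; [move: xe|move: te]; rewrite /= -ball_normE/= sub0r normrN.
Qed.

Definition modulus f (p : Om) : R := \int[m]_w `|f (sh p w) - f w|.

Lemma measurable_modulus f : measurable_fun setT f -> measurable_fun setT (modulus f).
Proof.
move=> mf.
have mfs : measurable_fun setT (fun r : Om * Om => f (sh r.2 r.1)).
  apply: (measurableT_comp mf).
  apply: measurable_fun_pair => /=.
    by apply: measurable_rVD; apply: measurableT_comp.
  by apply: measurable_funD; apply: measurableT_comp.
have mg : measurable_fun setT (fun r : Om * Om => `|f (sh r.2 r.1) - f r.1|).
  apply: measurableT_comp => //; apply: measurable_funB => //.
  exact: measurableT_comp mf measurable_fst.
exact: (measurable_Rintegral1 m mg).
Qed.

Lemma sh_integral p f : measurable_fun setT f -> \int[m]_w f (sh p w) = \int[m]_w f w.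
Proof. by move=> mf; exact: (mpres_Rintegral (mpres_sh p) mf). Qed.

Lemma sh_integrable p f : m.-integrable setT (EFin \o f) ->
  m.-integrable setT (EFin \o (fun w => f (sh p w))).
Proof. by move=> fi; exact: (mpres_integrable (mpres_sh p) fi). Qed.

Lemma modulus_le f p : m.-integrable setT (EFin \o f) ->
  modulus f p <= 2 * \int[m]_w `|f w|.
Proof.
move=> fi; have ia := integrable_norm fi; have ias := sh_integrable p ia.
have mn : measurable_fun setT (fun w => `|f w|) by exact: integrable_measurable ia.
apply: (@le_trans _ _ (\int[m]_w (`|f (sh p w)| + `|f w|))).
  apply: le_Rintegral => //.
  - by apply: integrable_norm; apply: RintegrableB => //; exact: sh_integrable.
  - exact: RintegrableD.
  - by move=> w _; exact: ler_normB.
rewrite RintegralD//.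
by rewrite (sh_integral p mn) mulr2n mulrDl mul1r.
Qed.

Lemma modulus_ge0 f p : 0 <= modulus f p.
Proof. exact: Rintegral_ge0. Qed.

Lemma modulus_cvg f (e : R) : m.-integrable setT (EFin \o f) -> 0 < e ->
  exists2 d : R, 0 < d & forall p, close d p -> modulus f p <= e.
Proof.
move=> fi e0; have [d d0 h] := trans_cont_L1 fi e0.
exists d => // p /andP[p1 p2]; have := h p p1 p2.
rewrite /nrm1 -EFin_Rintegral ?lee_fin//.
by apply: integrable_norm; apply: RintegrableB => //; exact: sh_integrable.
Qed.

Section kernel.
Context d0 (P : measurableType d0) (pi : {sigma_finite_measure set P -> \bar R}).
Implicit Types (k : P -> R) (j : P -> Om).

(** A probability density [k] on an auxiliary space, with a displacement [j p] attached to each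
    point. The mollifier in space and both exponential kernels in time are of this form. *)
Definition kernel k j := [/\ pi.-integrable setT (EFin \o k), (forall p, 0 <= k p),
  \int[pi]_p k p = 1 & measurable_fun setT j].

(** The mass of the displacements that are not [d]-close to 0: it measures how far the kernel is
    from an approximate identity. *)
Definition tail k j (d : R) := \int[pi]_p (k p * (~~ close d (j p))%:R).

Definition avg k j f : Om -> R := fun w => \int[pi]_p (k p * f (sh (j p) w)).

Variables (k : P -> R) (j : P -> Om).
Hypothesis kk : kernel k j.

Let ik : pi.-integrable setT (EFin \o k). Proof. by case: kk. Qed.
Let k0 : forall p, 0 <= k p. Proof. by case: kk. Qed.
Let k1 : \int[pi]_p k p = 1. Proof. by case: kk. Qed.
Let mj : measurable_fun setT j. Proof. by case: kk. Qed.
Let mk : measurable_fun setT k. Proof. exact: integrable_measurable ik. Qed.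

Lemma measurable_sh_kernel f : measurable_fun setT f ->
  measurable_fun setT (fun r : Om * P => f (sh (j r.2) r.1)).
Proof.
move=> mf.
have mj2 : measurable_fun setT (fun r : Om * P => j r.2) by exact: measurableT_comp.
have mj21 : measurable_fun setT (fun r : Om * P => (j r.2).1) by exact: measurableT_comp.
have mj22 : measurable_fun setT (fun r : Om * P => (j r.2).2) by exact: measurableT_comp.
apply: (measurableT_comp mf); apply: measurable_fun_pair => /=.
  by apply: measurable_rVD => //; exact: measurableT_comp.
by apply: measurable_funD => //; exact: measurableT_comp.
Qed.

Lemma measurable_kernel_integrand f : measurable_fun setT f ->
  measurable_fun setT (fun r : Om * P => k r.2 * f (sh (j r.2) r.1)).
Proof.
move=> mf; apply: measurable_funM; last exact: measurable_sh_kernel.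
exact: measurableT_comp.
Qed.

Lemma measurable_avg f : measurable_fun setT f -> measurable_fun setT (avg k j f).
Proof.
by move=> mf; exact: (measurable_Rintegral2 pi (measurable_kernel_integrand mf)).
Qed.

Lemma kernel_bounded_integrable (C : R) (h : P -> R) : measurable_fun setT h ->
  (forall p, `|h p| <= C) -> pi.-integrable setT (EFin \o (fun p => k p * h p)).
Proof.
move=> mh hC; have := Rintegrable_bounded_mull mh hC ik.
by congr (_.-integrable _ _); apply/funext => p /=; rewrite mulrC.
Qed.

Lemma measurable_sh_kernel1 f w : measurable_fun setT f ->
  measurable_fun setT (fun p : P => f (sh (j p) w)).
Proof.
move=> mf; have h : measurable_fun setT (fun p : P => (w, p)) by exact: measurable_fun_pair.
exact: measurableT_comp (measurable_sh_kernel mf) h.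
Qed.

Lemma avg_integrable (C : R) f w : measurable_fun setT f -> (forall w, `|f w| <= C) ->
  pi.-integrable setT (EFin \o (fun p => k p * f (sh (j p) w))).
Proof.
move=> mf fC; apply: kernel_bounded_integrable => [|p]; last exact: fC.
exact: measurable_sh_kernel1.
Qed.

Lemma avg_le (C : R) f g w : measurable_fun setT f -> (forall w, `|f w| <= C) ->
  measurable_fun setT g -> (forall w, `|g w| <= C) ->
  (forall w, f w <= g w) -> avg k j f w <= avg k j g w.
Proof.
move=> mf fC mg gC fg; apply: le_Rintegral => //; [exact: (avg_integrable w mf fC)|exact: (avg_integrable w mg gC)|].
by move=> p _; apply: ler_wpM2l.
Qed.

Lemma avg_cst (c : R) w : avg k j (cst c) w = c.
Proof.
rewrite /avg; under eq_Rintegral do rewrite mulrC.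
by rewrite RintegralZl// k1 mulr1.
Qed.

Lemma avg_norm_le (C : R) f w : measurable_fun setT f -> (forall w, `|f w| <= C) ->
  `|avg k j f w| <= avg k j (fun w => `|f w|) w.
Proof.
move=> mf fC; apply: le_trans (le_normr_Rintegral _ _) _ => //.
  exact: (avg_integrable w mf fC).
rewrite le_eqVlt; apply/orP; left; apply/eqP; apply: eq_Rintegral => p _.
by rewrite normrM ger0_norm.
Qed.

Lemma avg_bounded (C : R) f w : measurable_fun setT f -> (forall w, `|f w| <= C) ->
  `|avg k j f w| <= C.
Proof.
move=> mf fC; have C0 : 0 <= C by apply: le_trans (fC (0, 0)).
apply: le_trans (avg_norm_le w mf fC) _; rewrite -[leRHS](avg_cst C w).
apply: (@avg_le C) => //; first exact: measurableT_comp.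
- by move=> w'; rewrite normr_id.
- by move=> w'; rewrite ger0_norm.
Qed.

Lemma avgD (C : R) f g w : measurable_fun setT f -> (forall w, `|f w| <= C) ->
  measurable_fun setT g -> (forall w, `|g w| <= C) ->
  avg k j (fun w => f w + g w) w = avg k j f w + avg k j g w.
Proof.
move=> mf fC mg gC; rewrite /avg -RintegralD//; [|exact: (avg_integrable w mf fC)|exact: (avg_integrable w mg gC)].
by apply: eq_Rintegral => p _; rewrite mulrDr.
Qed.

Lemma avgZ (C a : R) f w : measurable_fun setT f -> (forall w, `|f w| <= C) ->
  avg k j (fun w => a * f w) w = a * avg k j f w.
Proof.
move=> mf fC; rewrite /avg -RintegralZl//; last exact: (avg_integrable w mf fC).
by apply: eq_Rintegral => p _; rewrite mulrCA.
Qed.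

Lemma shC p q w : sh p (sh q w) = sh q (sh p w).
Proof. by rewrite !shA; congr sh; congr pair; rewrite addrC. Qed.

Lemma avg_sh f q w : avg k j f (sh q w) = avg k j (f \o sh q) w.
Proof. by apply: eq_Rintegral => p _; rewrite /= shC. Qed.

Lemma avg_dz (C : R) f z w : measurable_fun setT f -> (forall w, `|f w| <= C) ->
  dz z (avg k j f) w = avg k j (dz z f) w.
Proof.
move=> mf fC; have mfs : measurable_fun setT (f \o sh (z, 0)) by exact: measurable_sh_comp.
rewrite /dz avg_sh -[in LHS](mulN1r (avg k j f w)) -(avgZ (-1) w mf fC).
rewrite -(@avgD C)//.
- by congr avg; apply/funext => w' /=; rewrite mulN1r.
- by move=> w'; exact: fC.
- exact: measurable_funM.
- by move=> w'; rewrite mulN1r normrN.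
Qed.

Lemma avg_ddz (C : R) f z w : measurable_fun setT f -> (forall w, `|f w| <= C) ->
  ddz z (avg k j f) w = avg k j (ddz z f) w.
Proof.
move=> mf fC.
have mfs z' : measurable_fun setT (f \o sh (z', 0)) by exact: measurable_sh_comp.
have C0 : 0 <= C by apply: le_trans (fC (0, 0)).
rewrite /ddz !avg_sh -(mulNr 2 (avg k j f w)) -(avgZ (- 2) w mf fC).
have C2 a : a <= C -> a <= 2 * C by move=> /le_trans; apply; rewrite ler_peMl// ler1n.
have bs z' w' : `|(f \o sh (z', 0)) w'| <= 2 * C by apply: C2; exact: fC.
rewrite -(@avgD (2 * C))// -(@avgD (2 * C + 2 * C))//.
- by congr avg; apply/funext => w' /=; rewrite mulNr.
- exact: measurable_funD.
- by move=> w'; apply: le_trans (ler_normD _ _) _; apply: lerD; exact: bs.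
- exact: measurable_funM.
- by move=> w'; have := fC w'; rewrite mulNr normrN normrM (ger0_norm (ler0n R 2)); lra.
Qed.

Lemma avg_L1_2 f : m.-integrable setT (EFin \o f) ->
  (m \x pi)%E.-integrable setT (EFin \o (fun r => k r.2 * f (sh (j r.2) r.1))).
Proof.
move=> fi; have mf := integrable_measurable fi.
have mn : measurable_fun setT (fun w => `|f w|) by exact: measurableT_comp.
apply: (@RintegrableX1 _ _ _ _ _ _ _ _ (fun p => (\int[m]_w `|f w|) * k p)).
- exact: measurable_kernel_integrand.
- by move=> p /=; apply: RintegrableZl; exact: sh_integrable.
- move=> p /=; under eq_Rintegral do rewrite normrM ger0_norm//.
  rewrite RintegralZl//; last by apply: integrable_norm; exact: sh_integrable.
  by rewrite (sh_integral (j p) mn) mulrC.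
- exact: RintegrableZl.
Qed.

Lemma avg_L1 f : m.-integrable setT (EFin \o f) ->
  m.-integrable setT (EFin \o avg k j f).
Proof. by move=> fi; have [] := Rfubini1 (avg_L1_2 fi). Qed.

(** Close displacements contribute at most [e], as [k] has mass 1; the others contribute at most [C]
    times their mass. *)
Lemma kernel_tail (d : R) (H : P -> R) (e C : R) : measurable_fun setT H ->
  (forall p, 0 <= H p <= C) -> 0 <= e ->
  (forall p, close d (j p) -> H p <= e) ->
  \int[pi]_p (k p * H p) <= e + C * tail k j d.
Proof.
move=> mH HC e0 He.
have mc : measurable_fun setT (fun p => (~~ close d (j p))%:R : R).
  rewrite (_ : (fun p => _) = (fun p => 1 - \1_[set q : Om | close d q] (j p))).
    apply: measurable_funB => //; apply: measurableT_comp mj; apply: measurable_indic.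
    exact: measurable_close.
  apply/funext => p; rewrite indicE; case: (boolP (close d (j p))) => h.
    by rewrite mem_set// subrr.
  by rewrite memNset ?subr0//= => h'; rewrite h' in h.
have ic : pi.-integrable setT (EFin \o (fun p => k p * (~~ close d (j p))%:R)).
  apply: (@kernel_bounded_integrable 1) => // p; case: (~~ _); rewrite ?normr1// normr0//.
have iH : pi.-integrable setT (EFin \o (fun p => k p * H p)).
  by apply: (@kernel_bounded_integrable C) => // p; have /andP[? ?] := HC p; rewrite ger0_norm.
apply: (@le_trans _ _ (\int[pi]_p (e * k p + C * (k p * (~~ close d (j p))%:R)))).
  apply: le_Rintegral => //.
    by apply: RintegrableD; exact: RintegrableZl.
  move=> p _; have /andP[H0 HC'] := HC p; case: (boolP (close d (j p))) => /= cp.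
    by rewrite !mulr0 addr0 mulrC ler_wpM2r// He.
  rewrite mulr1 -mulrDl mulrC ler_wpM2r//; apply: le_trans HC' _.
  by rewrite lerDr.
rewrite RintegralD//; [|exact: RintegrableZl|exact: RintegrableZl].
by rewrite !RintegralZl// k1 mulr1.
Qed.

End kernel.
End averages.

Lemma ler_mul_frac (R : realFieldType) (a b x : R) : 0 < b -> a <= b -> 0 <= x ->
  a * (x / b) <= x.
Proof. by move=> b0 ab x0; rewrite mulrCA ler_piMr// ler_pdivrMr// mul1r. Qed.

(** * Kernels as approximate identities *)

Section approximation.
Context {R : realType} {N : nat}.
Notation X := ('rV[R]_N).
Notation Om := ('rV[R]_N * measurableTypeR R)%type.
Notation m := (@lebesgue_Q R N).
Implicit Types (f g F Psi : Om -> R) (w : Om).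

Definition opq (p : Om) : Om := (- p.1, - p.2).

Lemma sh_opq p w : sh (opq p) (sh p w) = w.
Proof. by rewrite /sh/= !addrK -surjective_pairing. Qed.

Section kernel.
Context d0 (P : measurableType d0) (pi : {sigma_finite_measure set P -> \bar R}).
Variables (k : P -> R) (j : P -> Om).
Hypothesis kk : kernel pi k j.

Let ik : pi.-integrable setT (EFin \o k). Proof. by case: kk. Qed.
Let k0 : forall p, 0 <= k p. Proof. by case: kk. Qed.
Let k1 : \int[pi]_p k p = 1. Proof. by case: kk. Qed.
Let mj : measurable_fun setT j. Proof. by case: kk. Qed.
Let mk : measurable_fun setT k. Proof. exact: integrable_measurable ik. Qed.

Lemma avg_sub_le (C : R) f : (forall w, `|f w| <= C) -> m.-integrable setT (EFin \o f) ->
  \int[m]_w `|avg pi k j f w - f w| <= \int[pi]_p (k p * modulus f (j p)).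
Proof.
move=> fC fi; have mf := integrable_measurable fi.
have i1 := avg_L1_2 kk fi.
have i2 : (m \x pi)%E.-integrable setT (EFin \o (fun r : Om * P => f r.1 * k r.2)).
  exact: Rintegrable_prodM.
have i3 := integrable_norm (RintegrableB i1 i2).
have [h1 h2] := Rfubini1 i3; have [h3 h4] := Rfubini2 i3.
have -> : \int[pi]_p (k p * modulus f (j p)) =
    \int[pi]_p \int[m]_w `|k p * f (sh (j p) w) - f w * k p|.
  apply: eq_Rintegral => p _; rewrite /modulus -RintegralZl//.
    by apply: eq_Rintegral => w _; rewrite -(mulrC (k p)) -mulrBr normrM ger0_norm.
  by apply: integrable_norm; apply: RintegrableB => //; exact: sh_integrable.
rewrite h4 -h2; apply: le_Rintegral => //.
  by apply: integrable_norm; apply: RintegrableB => //; exact: avg_L1.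
move=> w _ /=.
have -> : avg pi k j f w - f w = \int[pi]_p (k p * f (sh (j p) w) - f w * k p).
  rewrite RintegralB//; last exact: RintegrableZl.
    by rewrite RintegralZl// k1 mulr1.
  exact: (avg_integrable kk w mf fC).
apply: le_normr_Rintegral => //; apply: RintegrableB; last exact: RintegrableZl.
exact: (avg_integrable kk w mf fC).
Qed.

(** Translation invariance moves the displacement from [F], which is only bounded, to the integrable
    [Psi]; hence the opposite displacement [opq (j p)]. *)
Lemma avg_weak_le (C : R) F Psi : measurable_fun setT F -> (forall w, `|F w| <= C) ->
  m.-integrable setT (EFin \o Psi) ->
  `|\int[m]_w ((avg pi k j F w - F w) * Psi w)| <=
  \int[pi]_p (k p * (C * modulus Psi (opq (j p)))).
Proof.
move=> mF FC iP; have mP := integrable_measurable iP.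
have C0 : 0 <= C by apply: le_trans (FC (0, 0)).
have bd (p : P) w : `|F (sh (j p) w) - F w| <= C + C.
  by apply: le_trans (ler_normB _ _) _; exact: lerD.
have mFs := measurable_sh_kernel kk mF.
have mD : measurable_fun setT (fun r : Om * P => F (sh (j r.2) r.1) - F r.1).
  by apply: measurable_funB => //; exact: measurableT_comp mF measurable_fst.
have i0 : (m \x pi)%E.-integrable setT (EFin \o (fun r : Om * P => Psi r.1 * k r.2)).
  exact: Rintegrable_prodM.
have i1 := Rintegrable_bounded_mull mD (fun r => bd r.2 r.1) i0.
have [h1 h2] := Rfubini1 i1; have [h3 h4] := Rfubini2 i1.
have E : \int[m]_w ((avg pi k j F w - F w) * Psi w) =
    \int[m]_w \int[pi]_p ((F (sh (j p) w) - F w) * (Psi w * k p)).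
  apply: eq_Rintegral => w _.
  have ia := avg_integrable kk w mF FC.
  rewrite mulrC mulrBr /avg -RintegralZl// -[in X in _ - X](mulr1 (F w)) -k1.
  rewrite -RintegralZl// -RintegralZl//; last exact: RintegrableZl.
  rewrite -RintegralB//; [|exact: RintegrableZl|by apply: RintegrableZl; exact: RintegrableZl].
  by apply: eq_Rintegral => p _; ring.
rewrite E h2 -h4; apply: le_trans (le_normr_Rintegral _ _) _ => //.
have iR : pi.-integrable setT (EFin \o (fun p => k p * (C * modulus Psi (opq (j p))))).
  apply: (kernel_bounded_integrable kk (C := C * (2 * \int[m]_w `|Psi w|))).
    apply: measurable_funM => //.
    have mo : measurable_fun setT opq.
      apply: measurable_fun_pair; first exact: measurable_rVN.
      exact: measurableT_comp.
    exact: (measurableT_comp (measurable_modulus mP) (measurableT_comp mo mj)).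
  move=> p; rewrite normrM (ger0_norm C0) ler_wpM2l// ger0_norm ?modulus_ge0//.
  exact: modulus_le.
apply: le_Rintegral => //; first exact: integrable_norm.
move=> p _ /=.
pose FP w := F w * (Psi (sh (opq (j p)) w) - Psi w).
have iS : m.-integrable setT (EFin \o (fun w => Psi (sh (opq (j p)) w) - Psi w)).
  by apply: RintegrableB => //; exact: sh_integrable.
have -> : \int[m]_w ((F (sh (j p) w) - F w) * (Psi w * k p)) = k p * \int[m]_w FP w.
  have iA : m.-integrable setT (EFin \o (fun w => F w * Psi (sh (opq (j p)) w))).
    by apply: Rintegrable_bounded_mull FC _ => //; exact: sh_integrable.
  have iB : m.-integrable setT (EFin \o (fun w => F w * Psi w)).
    exact: Rintegrable_bounded_mull FC _.
  have iC : m.-integrable setT (EFin \o (fun w => F (sh (j p) w) * Psi w)).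
    by apply: (Rintegrable_bounded_mull _ (fun w => FC (sh (j p) w))) => //; exact: measurable_sh_comp.
  transitivity (k p * (\int[m]_w (F (sh (j p) w) * Psi w) - \int[m]_w (F w * Psi w))).
    rewrite -RintegralB// -RintegralZl//; last exact: RintegrableB.
    by apply: eq_Rintegral => w _; ring.
  congr (_ * _); rewrite /FP; under [RHS]eq_Rintegral do rewrite mulrBr.
  rewrite RintegralB//; congr (_ - _).
  apply: etrans (sh_integral (j p) (integrable_measurable iA)).
  by apply: eq_Rintegral => w _; rewrite sh_opq.
rewrite normrM ger0_norm// ler_wpM2l//.
have iFP : m.-integrable setT (EFin \o FP) by exact: Rintegrable_bounded_mull FC iS.
apply: le_trans (le_normr_Rintegral _ _) _ => //.
rewrite /modulus -RintegralZl//; last exact: integrable_norm.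
apply: le_Rintegral => //; first exact: integrable_norm.
  by apply: RintegrableZl; exact: integrable_norm.
by move=> w _; rewrite /FP normrM ler_wpM2r.
Qed.

End kernel.

Lemma avg_L1_approx (C : R) f (e : R) : (forall w, `|f w| <= C) ->
  m.-integrable setT (EFin \o f) -> 0 < e ->
  exists2 d : R, 0 < d &
  forall d0 (P : measurableType d0) (pi : {sigma_finite_measure set P -> \bar R})
    (k : P -> R) (j : P -> Om), kernel pi k j -> tail pi k j d <= d ->
  \int[m]_w `|avg pi k j f w - f w| <= e.
Proof.
move=> fC fi e0; have e20 : 0 < e / 2 by rewrite divr_gt0.
have [d1 d10 hd] := modulus_cvg fi e20.
set I := \int[m]_w `|f w|; have I0 : 0 <= I by exact: Rintegral_ge0.
(* The second bound makes 2 I d at most e / 2; adding 1 covers I = 0. *)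
pose d := Num.min d1 (e / 2 / (2 * I + 1)).
have I1 : 0 < 2 * I + 1 by lra.
exists d => [|d0 P pi k j kk kd]; first by rewrite lt_min d10 divr_gt0.
apply: le_trans (avg_sub_le kk fC fi) _.
have [_ _ _ mj] := kk.
have := @kernel_tail _ _ _ _ pi k j kk d (modulus f \o j) (e / 2) (2 * I).
move=> /(_ _ _ _ _)/le_trans; apply.
- by apply: measurableT_comp mj; exact: measurable_modulus (integrable_measurable fi).
- by move=> p; rewrite modulus_ge0 modulus_le.
- exact: ltW.
- move=> p /andP[p1 p2]; apply: hd; apply/andP; split.
    by apply: lt_le_trans p1 _; rewrite ge_min lexx.
  by apply: lt_le_trans p2 _; rewrite ge_min lexx.
rewrite [leRHS](splitr e) lerD2l; apply: (@le_trans _ _ (2 * I * d)).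
  by rewrite ler_wpM2l// mulr_ge0.
apply: (@le_trans _ _ ((2 * I) * (e / 2 / (2 * I + 1)))).
  by rewrite ler_wpM2l ?mulr_ge0// ge_min lexx orbT.
by apply: ler_mul_frac => //; [lra|exact: ltW].
Qed.

(** [d] depends on the bound of [F] but neither on [F] nor on the kernel, so the estimate applies to
    functions [F] that change with the kernel. *)
Lemma avg_weak_approx (C : R) Psi (e : R) : m.-integrable setT (EFin \o Psi) -> 0 < e ->
  exists2 d : R, 0 < d &
  forall d0 (P : measurableType d0) (pi : {sigma_finite_measure set P -> \bar R})
    (k : P -> R) (j : P -> Om), kernel pi k j -> tail pi k j d <= d ->
  forall F, measurable_fun setT F -> (forall w, `|F w| <= C) ->
  `|\int[m]_w ((avg pi k j F w - F w) * Psi w)| <= e.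
Proof.
move=> iP e0; have e20 : 0 < e / 2 by rewrite divr_gt0.
have [C0|C0] := ltP C 0.
  exists 1 => // d0 P pi k j _ _ F _ FC; have := FC (0, 0).
  by move=> /(le_trans (normr_ge0 _)); rewrite leNgt C0.
have C10 : 0 < C + 1 by rewrite ltr_wpDl.
have eC : 0 < e / 2 / (C + 1) by rewrite divr_gt0.
have [d1 d10 hd] := modulus_cvg iP eC.
set I := \int[m]_w `|Psi w|; have I0 : 0 <= I by exact: Rintegral_ge0.
have CI0 : 0 <= C * (2 * I) by rewrite !mulr_ge0.
pose d := Num.min d1 (e / 2 / (C * (2 * I) + 1)).
have I1 : 0 < C * (2 * I) + 1 by rewrite ltr_wpDl.
exists d => [|d0 P pi k j kk kd F mF FC]; first by rewrite lt_min d10 divr_gt0.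
apply: le_trans (avg_weak_le kk mF FC iP) _.
have [_ _ _ mj] := kk.
have := @kernel_tail _ _ _ _ pi k j kk d (fun p => C * modulus Psi (opq (j p))) (e / 2) (C * (2 * I)).
move=> /(_ _ _ _ _)/le_trans; apply.
- apply: measurable_funM => //.
  have mo : measurable_fun setT opq.
    apply: measurable_fun_pair; first exact: measurable_rVN.
    exact: measurableT_comp.
  exact: (measurableT_comp (measurable_modulus (integrable_measurable iP)) (measurableT_comp mo mj)).
- by move=> p; rewrite mulr_ge0 ?modulus_ge0//= ler_wpM2l// modulus_le.
- exact: ltW.
- move=> p /andP[p1 p2]; apply: (@le_trans _ _ (C * (e / 2 / (C + 1)))).
    rewrite ler_wpM2l//; apply: hd; rewrite /opq/close/= !normrN; apply/andP; split.
      by apply: lt_le_trans p1 _; rewrite ge_min lexx.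
    by apply: lt_le_trans p2 _; rewrite ge_min lexx.
  by apply: ler_mul_frac => //; [lra|exact: ltW].
rewrite [leRHS](splitr e) lerD2l; apply: (@le_trans _ _ (C * (2 * I) * d)).
  by rewrite ler_wpM2l.
apply: (@le_trans _ _ ((C * (2 * I)) * (e / 2 / (C * (2 * I) + 1)))).
  by rewrite ler_wpM2l// ge_min lexx orbT.
by apply: ler_mul_frac => //; [lra|exact: ltW].
Qed.

End approximation.

(** * Exponential kernels in time *)

Section time_kernel.
Context {R : realType} {N : nat}.
Notation leb := (@lebesgue_measure R).
Notation Om := ('rV[R]_N * measurableTypeR R)%type.

Lemma mpres_lebesgue_opp : mpres leb (fun x : measurableTypeR R => - x : measurableTypeR R).
Proof.
have mN : measurable_fun setT (fun x : measurableTypeR R => - x : measurableTypeR R).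
  exact: measurableT_comp.
split => // f mf f0.
rewrite -(ge0_integral_pushforward mN _ measurableT)//.
by apply: eq_measure_integral => A mA _; exact: lebesgue_measureN.
Qed.

Variable l : R.
Hypothesis l0 : 0 < l.

Definition expk (s : measurableTypeR R) : R := if s <= 0 then l * expR (l * s) else 0.

Lemma expkE s : expk s = exponential_pdf l (- s).
Proof.
rewrite /expk; case: ifPn => s0; first by rewrite exponential_pdfE ?oppr_ge0// mulrNN.
by rewrite lt0_exponential_pdf// oppr_lt0 ltNge.
Qed.

Lemma expk_ge0 s : 0 <= expk s.
Proof. by rewrite expkE; apply: exponential_pdf_ge0; exact: ltW. Qed.

Lemma measurable_expk : measurable_fun setT expk.
Proof.
rewrite (_ : expk = fun s => exponential_pdf l (- s)).
  by apply: measurableT_comp => //; exact: measurable_exponential_pdf.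
by apply/funext => s; rewrite expkE.
Qed.

Lemma expk_le s : expk s <= l.
Proof.
rewrite /expk; case: ifPn => s0; last exact: ltW.
by rewrite ler_piMr ?(ltW l0)// expR_le1 pmulr_rle0.
Qed.

Lemma expk_integrable : leb.-integrable setT (EFin \o expk) /\ \int[leb]_s expk s = 1.
Proof.
have h : (\int[leb]_s (expk s)%:E = 1)%E.
  under eq_integral do rewrite expkE.
  have [_ hN] := mpres_lebesgue_opp.
  rewrite (hN (fun s => (exponential_pdf l s)%:E)).
  - exact: integral_exponential_pdf.
  - by apply/measurable_EFinP; exact: measurable_exponential_pdf.
  - by move=> s; rewrite lee_fin exponential_pdf_ge0// ltW.
split; last by rewrite /Rintegral h.
apply: ge0_RintegrableE; [exact: measurable_expk|exact: expk_ge0|by rewrite h ltry].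
Qed.

Definition jt (s : measurableTypeR R) : Om := (0, s).

Lemma measurable_jt : measurable_fun setT jt.
Proof. exact: measurable_fun_pair. Qed.

Lemma kernel_expk : kernel leb expk jt.
Proof.
have [h1 h2] := expk_integrable.
by split => //; [exact: expk_ge0|exact: measurable_jt].
Qed.

(** The memoryless property of the exponential law. *)
Lemma expk_shift (tau : R) s : 0 <= tau ->
  expk s * (s <= - tau)%R%:R = expR (- (l * tau)) * expk (s + tau).
Proof.
move=> t0; rewrite /expk -lerBrDr sub0r; case: (leP s (- tau)) => h; last by rewrite !mulr0.
rewrite mulr1 ifT; last by apply: le_trans h _; rewrite oppr_le0.
by rewrite mulrCA -expRD; congr (_ * expR _); ring.
Qed.

Lemma expk_tail_integral (tau : R) : 0 <= tau ->
  \int[leb]_s (expk s * (s <= - tau)%R%:R) = expR (- (l * tau)).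
Proof.
move=> t0; under eq_Rintegral do rewrite expk_shift//.
have [i1 h1] := expk_integrable; have mp := mpres_lebesgue_shift tau.
rewrite RintegralZl//; last exact: (mpres_integrable mp i1).
by rewrite (mpres_Rintegral mp measurable_expk) h1 mulr1.
Qed.

(** The tail equals e^(- l d), at most 1 / (l d) because 1 + x <= e^x. *)
Lemma tail_expk (d : R) : 0 < d -> tail leb expk jt d <= (l * d)^-1.
Proof.
move=> d0; rewrite /tail.
rewrite (_ : \int[leb]_p _ = \int[leb]_s (expk s * (s <= - d)%R%:R)); last first.
  apply: eq_Rintegral => s _; rewrite /expk; case: ifPn => s0; last by rewrite !mul0r.
  by congr (_ * (nat_of_bool _)%:R); rewrite /close /jt/= normr0 d0/= -leNgt ler0_norm// lerNr.
rewrite expk_tail_integral ?(ltW d0)// expRN lef_pV2 ?posrE ?expR_gt0 ?mulr_gt0//.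
by apply: le_trans (expR_ge1Dx _); rewrite lerDr.
Qed.

Variable tau : R.
Hypothesis tau0 : 0 < tau.

Let c := expR (- (l * tau)).

Let c1 : 0 < 1 - c.
Proof. by rewrite subr_gt0 /c expR_lt1 oppr_lt0 mulr_gt0. Qed.

(* By the memoryless property of the exponential law, this is expk conditioned
   on s > - tau: the kernel concentrates at 0 as tau does. *)
Definition texpk (s : measurableTypeR R) : R := (1 - c)^-1 * (expk s - c * expk (s + tau)).

Lemma texpkE s : texpk s = (1 - c)^-1 * (expk s * (- tau < s)%R%:R).
Proof.
rewrite /texpk -expk_shift ?(ltW tau0)// ltNge; congr (_ * _).
by case: (s <= - tau); rewrite ?mulr0 ?mulr1 ?subrr ?subr0.
Qed.

Lemma kernel_texpk : kernel leb texpk jt.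
Proof.
have [i1 h1] := expk_integrable; have mp := mpres_lebesgue_shift tau.
have i2 := mpres_integrable mp i1; have mk := measurable_expk.
split; last exact: measurable_jt.
- by apply: RintegrableZl; apply: RintegrableB => //; exact: RintegrableZl.
- by move=> s; rewrite texpkE !mulr_ge0// ?expk_ge0// invr_ge0 ltW.
- rewrite /texpk RintegralZl//; last by apply: RintegrableB => //; exact: RintegrableZl.
  rewrite RintegralB//; last exact: RintegrableZl.
  rewrite RintegralZl// (mpres_Rintegral mp mk) h1 mulr1 mulVf//.
  by rewrite gt_eqF.
Qed.

Lemma tail_texpk (d : R) : tau <= d -> tail leb texpk jt d = 0.
Proof.
move=> td; rewrite /tail; transitivity (\int[leb]_s (0 : R)); last first.
  by rewrite Rintegral_cst// mul0r.
apply: eq_Rintegral => s _; rewrite texpkE /expk /close /jt/= normr0 (lt_le_trans tau0 td)/=.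
case: ifPn => s0; last by rewrite mul0r mulr0 mul0r.
case: ltP => st; last by rewrite !mulr0 mul0r.
by rewrite -leNgt leNgt ler0_norm// (lt_le_trans _ td) ?mulr0// ltrNl.
Qed.

End time_kernel.

(** * A smooth mollifier in space *)

Section bump.
Context {R : realType} {N : nat}.
Notation X := ('rV[R]_N).
Notation Om := ('rV[R]_N * measurableTypeR R)%type.
Notation lebX := (lebesgue_rV N).

Lemma flat0_mono (r s : R) : r <= s -> flat 0 r <= flat 0 s.
Proof.
move=> rs; have [r0|r0] := leP r 0; first by rewrite flat_le0// flat_ge0.
have s0 := lt_le_trans r0 rs.
by rewrite /flat r0 s0 !expr0 !mul1r ler_expR lerN2 lef_pV2.
Qed.

Variable eta : R.
Hypothesis eta0 : 0 < eta.

(** A product over the coordinates of functions supported in [-eta, eta]: smoothness comes from one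
    variable, and the support lies in a box, that is, in a ball of the sup norm. *)
Definition bump0 (y : X) : R :=
  \prod_(i < N) (flat 0 (eta + y ord0 i) * flat 0 (eta - y ord0 i)).

Definition box (r : R) : set X := [set y | forall i, `[- r, r]%classic (y ord0 i)].

Lemma measurable_box r : measurable (box r).
Proof.
rewrite (_ : box r = \bigcap_(i in [set: 'I_N])
      [set v : X | `[- r, r]%classic (v ord0 i)]); last first.
  by apply/seteqP; split => v /= h i; [move=> _|]; exact: h.
apply: fin_bigcap_measurable => // i _.
rewrite -[X in measurable X]setTI.
exact: (@measurable_coord R N i).
Qed.

Lemma lebesgue_box r : 0 < r -> (0 < lebX (box r) < +oo)%E.
Proof.
move=> r0; rewrite (@lebesgue_rV_box R N (fun=> `[- r, r]%classic))//.
have E : @lebesgue_measure R `[- r, r]%classic = (r + r)%:E.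
  by rewrite lebesgue_measure_itv/= lte_fin gtrN// -EFinB opprK.
under eq_bigr do rewrite E.
have h : 0 < \prod_(i < N) (r + r) by apply: prodr_gt0 => i _; exact: addr_gt0.
have -> : (\prod_(i < N) (r + r)%:E = (\prod_(i < N) (r + r)%R)%:E)%E.
  by rewrite -prodEFin.
by rewrite lte_fin h ltry.
Qed.

Lemma bump0_ge0 y : 0 <= bump0 y.
Proof. by apply: prodr_ge0 => i _; rewrite mulr_ge0// flat_ge0. Qed.

Lemma bump0_le1 y : bump0 y <= 1.
Proof.
apply: prodr_ile1 => i _; rewrite mulr_ge0 ?flat_ge0//=.
by rewrite mulr_ile1 ?flat_ge0 ?flat0_le1.
Qed.

Lemma bump0_neq0 y : bump0 y != 0 -> forall i, `|y ord0 i| < eta.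
Proof.
rewrite /bump0 => /prodf_neq0 h i; have := h i isT.
rewrite mulf_eq0 => /norP[h1 h2]; rewrite ltr_norml.
apply/andP; split; rewrite ltNge; apply/negP => h'.
- by move: h1; rewrite flat_le0 ?eqxx//; lra.
- by move: h2; rewrite flat_le0 ?eqxx//; lra.
Qed.

Lemma measurable_bump0 : measurable_fun setT bump0.
Proof.
have mfl : measurable_fun setT (flat 0 : R -> R).
  by apply: continuous_measurable_fun; exact: (Ck_flat 0 0).
apply: measurable_prod => i _; apply: measurable_funM; apply: (measurableT_comp mfl).
- by apply: measurable_funD => //; exact: measurable_coord.
- by apply: measurable_funB => //; exact: measurable_coord.
Qed.

Lemma bump0_ind y : bump0 y <= \1_(box eta) y.
Proof.
rewrite indicE; have [h|h] := pselect (box eta y).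
  by rewrite mem_set//; exact: bump0_le1.
rewrite memNset//= le_eqVlt; apply/orP; left; apply/negPn/negP => /bump0_neq0 h'.
by apply: h => i; have := h' i; rewrite /= in_itv/= ltr_norml => /andP[/ltW-> /ltW->].
Qed.

Lemma box_integrable r : 0 < r -> lebX.-integrable setT (EFin \o (\1_(box r) : X -> R)).
Proof.
move=> /lebesgue_box /andP[_ h]; apply: ge0_RintegrableE => //.
  by apply: measurable_indic; exact: measurable_box.
by rewrite integral_indic ?setIT//; exact: measurable_box.
Qed.

Lemma bump0_integrable : lebX.-integrable setT (EFin \o bump0).
Proof.
apply: le_Rintegrable (box_integrable eta0); first exact: measurable_bump0.
by move=> y; rewrite ger0_norm ?bump0_ge0//; exact: bump0_ind.
Qed.

Lemma box_Rintegral r : 0 < r -> \int[lebX]_y (\1_(box r) y) = fine (lebX (box r)).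
Proof.
by move=> r0; rewrite /Rintegral integral_indic ?setIT//; exact: measurable_box.
Qed.

(** On the box of half the width every factor of [bump0] is at least [flat 0 (eta / 2)]. *)
Lemma bump0_integral_gt0 : 0 < \int[lebX]_y bump0 y.
Proof.
have e20 : 0 < eta / 2 by rewrite divr_gt0.
have f0 : 0 < flat 0 (eta / 2) by exact: flat0_gt0.
pose c : R := \prod_(i < N) (flat 0 (eta / 2) * flat 0 (eta / 2)).
have c0 : 0 < c by apply: prodr_gt0 => i _; rewrite mulr_gt0.
apply: (@lt_le_trans _ _ (\int[lebX]_y (c * \1_(box (eta / 2)) y))).
  rewrite RintegralZl//; last exact: box_integrable.
  rewrite box_Rintegral// mulr_gt0//; have /andP[h1 h2] := lebesgue_box e20.
  by apply: fine_gt0; rewrite h1.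
apply: le_Rintegral => //; last move=> y _.
- by apply: RintegrableZl; exact: box_integrable.
- exact: bump0_integrable.
rewrite indicE; have [h|h] := pselect (box (eta / 2) y); last first.
  by rewrite memNset// mulr0 bump0_ge0.
rewrite mem_set// mulr1 /c /bump0; apply: ler_prod => i _.
rewrite mulr_ge0 ?(ltW f0)//=; have := h i; rewrite /= in_itv/= => /andP[h1 h2].
by apply: ler_pM; rewrite ?(ltW f0)//; apply: flat0_mono; lra.
Qed.

Definition bump (y : X) : R := (\int[lebX]_y bump0 y)^-1 * bump0 y.

Let b0 : 0 < (\int[lebX]_y bump0 y)^-1.
Proof. by rewrite invr_gt0; exact: bump0_integral_gt0. Qed.

Lemma bump_ge0 y : 0 <= bump y.
Proof. by rewrite mulr_ge0 ?bump0_ge0// ltW. Qed.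

Lemma measurable_bump : measurable_fun setT bump.
Proof. by apply: measurable_funM => //; exact: measurable_bump0. Qed.

Lemma bump_integrable : lebX.-integrable setT (EFin \o bump).
Proof. by apply: RintegrableZl; exact: bump0_integrable. Qed.

Lemma bump_integral : \int[lebX]_y bump y = 1.
Proof.
rewrite RintegralZl//; last exact: bump0_integrable.
by rewrite mulVf// gt_eqF//; exact: bump0_integral_gt0.
Qed.

Lemma bump_neq0 y : bump y != 0 -> box eta y.
Proof.
rewrite mulf_eq0 => /norP[_ /bump0_neq0 h] i.
by have := h i; rewrite /= in_itv/= ltr_norml => /andP[/ltW-> /ltW->].
Qed.

Definition jx (y : X) : Om := (y, 0).

Lemma measurable_jx : measurable_fun setT jx.
Proof. exact: measurable_fun_pair. Qed.

Lemma kernel_bump : kernel lebX bump jx.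
Proof.
split; [exact: bump_integrable|exact: bump_ge0|exact: bump_integral|exact: measurable_jx].
Qed.

Lemma tail_bump d : eta <= d -> tail lebX bump jx d = 0.
Proof.
move=> ed; rewrite /tail; transitivity (\int[lebX]_y (0 : R)); last first.
  by rewrite Rintegral_cst// mul0r.
apply: eq_Rintegral => y _; rewrite /close /jx/= normr0 (lt_le_trans eta0 ed) andbT.
have [->|] := eqVneq (bump y) 0; first by rewrite mul0r.
rewrite mulf_eq0 => /norP[_ /bump0_neq0 h].
suff: ball (0 : X) d y by rewrite -ball_normE/= sub0r normrN => ->; rewrite mulr0.
split => [|a i]; first exact: lt_le_trans ed.
by rewrite ord1 -ball_normE/= mxE sub0r normrN; exact: lt_le_trans (h i) ed.
Qed.

Lemma affine_coord (a b : R) i :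
  affine_fun (fun p : X * R => a * p.1 ord0 i + b) (fun p : X * R => a * p.1 ord0 i).
Proof.
apply: affine_scale; split => [p|v p h] /=; last by rewrite !mxE.
apply: (@differentiable_comp _ _ _ _ fst (fun x : X => x ord0 i)) => //.
  by apply: (@linear_differentiable R (X * R)%type X fst) => q; exact: cvg_fst.
exact: differentiable_coord.
Qed.

Lemma affine_snd : affine_fun (fun p : X * R => p.2) (fun p : X * R => p.2).
Proof.
split => [p|v p h] //=.
by apply: (@linear_differentiable R (X * R)%type R snd) => q; exact: cvg_snd.
Qed.

(** These test functions yield the equation at a fixed point. [theta] may be nonzero at time 0, so
    the initial datum is seen. *)
Lemma bump_test (T : R) (x0 : X) (theta : R -> R) (T1 : R) :
  (forall k, Ck k theta) -> T1 < T -> (forall s, T1 <= s -> theta s = 0) ->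
  test_function T (fun p : X * R => bump (p.1 - x0) * theta p.2).
Proof.
move=> Ct T1T t0; split => [k|].
  apply: CkM; last exact: Ck_comp affine_snd (Ct k).
  apply: CkM; first exact: Ck_cst.
  apply: Ck_prod => i; apply: CkM.
  - have := Ck_comp (affine_coord 1 (eta - x0 ord0 i) i) (Ck_flat k 0).
    by congr Ck; apply/funext => p; rewrite !mxE; congr flat; ring.
  - have := Ck_comp (affine_coord (-1) (eta + x0 ord0 i) i) (Ck_flat k 0).
    by congr Ck; apply/funext => p; rewrite !mxE; congr flat; ring.
pose B : set X := [set y | forall i, `[x0 ord0 i - eta, x0 ord0 i + eta]%classic (y ord0 i)].
exists (B `*` `[0, T1]%classic); split.
- apply: compact_setX; last exact: segment_compact.
  by apply: (@rV_compact R N (fun i => `[x0 ord0 i - eta, x0 ord0 i + eta]%classic)) => i; exact: segment_compact.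
- by move=> [x s] [/= _]; rewrite in_itv/= => /andP[-> /le_lt_trans]; apply.
- move=> [x s] /= /andP[s0 sT] nK; apply: contra_notP nK => /eqP.
  rewrite mulf_eq0 => /norP[/bump_neq0 h1 h2]; split => /=.
    move=> i; have := h1 i; rewrite /= !in_itv/= !mxE => /andP[? ?].
    by apply/andP; split; lra.
  rewrite in_itv/= s0/= leNgt; apply/negP => /ltW /t0 h.
  by rewrite h eqxx in h2.
Qed.

End bump.

Section bump_averages.
Context {R : realType} {N : nat}.
Notation X := ('rV[R]_N).
Notation Om := ('rV[R]_N * measurableTypeR R)%type.
Notation lebX := (lebesgue_rV N).
Notation jx := (@jx R N).

Variable eta : R.
Hypothesis eta0 : 0 < eta.
Notation rho := (@bump R N eta).

Definition db z (y : X) : R := rho (y + z) - rho y.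
Definition ddb z (y : X) : R := rho (y + z) + rho (y - z) - 2 * rho y.

Lemma measurable_shift (r : X -> R) (z : X) : measurable_fun setT r ->
  measurable_fun setT (fun y : X => r (y + z)).
Proof. by move=> mr; apply: (measurableT_comp mr); exact: measurable_rVD. Qed.

Lemma shift_integrable (r : X -> R) (z : X) : lebX.-integrable setT (EFin \o r) ->
  lebX.-integrable setT (EFin \o (fun y : X => r (y + z))).
Proof. exact: (mpres_integrable (mpres_rV_shift z)). Qed.

Lemma shift_integral (r : X -> R) (z : X) : measurable_fun setT r ->
  \int[lebX]_y r (y + z) = \int[lebX]_y r y.
Proof. exact: (mpres_Rintegral (mpres_rV_shift z)). Qed.

Lemma measurable_ddb2 : measurable_fun setT (fun p : X * X => ddb p.2 p.1).
Proof.
have mr := @measurable_bump R N eta.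
have mN : measurable_fun setT (fun p : X * X => - p.2) by apply: measurable_rVN.
apply: measurable_funB; last first.
  by apply: measurable_funM => //; exact: measurableT_comp mr measurable_fst.
by apply: measurable_funD; apply: (measurableT_comp mr); exact: measurable_rVD.
Qed.

Lemma measurable_ddb z : measurable_fun setT (ddb z).
Proof.
have mp : measurable_fun setT (fun y : X => (y, z)) by exact: measurable_fun_pair.
exact: (measurableT_comp measurable_ddb2 mp).
Qed.

Lemma measurable_db z : measurable_fun setT (db z).
Proof.
have mr := @measurable_bump R N eta.
by apply: measurable_funB => //; exact: measurable_shift.
Qed.

(** The bounds for test functions are applied at t = 0 to the bump times a fixed [theta], and then
    divided by powers of [theta 0], which is positive. *)
Lemma bump_bounds : exists2 B : R, 0 <= B & forall (z y : X),
  `|db z y| ^+ 2 <= B * kap z /\ `|ddb z y| <= B * kap z.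
Proof.
pose theta (s : R) := flat 0 (2^-1 - s).
have Ct k : Ck k theta.
  have al : affine_fun (fun s : R => -1 * s + 2^-1) (fun s => -1 * s).
    by apply: affine_scale; split => //= p; exact: derivable1_diffP.1.
  have := Ck_comp al (Ck_flat k 0).
  by congr Ck; apply/funext => s; congr flat; ring.
have h21 : (2^-1 : R) < 1 by rewrite invf_lt1// ltr1n.
have t0 s : 2^-1 <= s -> theta s = 0.
  by move=> hs; rewrite /theta flat_le0// subr_le0.
have psiT := bump_test eta (0 : X) Ct h21 t0.
have [B B0 h] := test_bounds psiT.
have th0 : 0 < theta 0 by rewrite /theta subr0 flat0_gt0.
have {}h (z y : X) : `|db z y| ^+ 2 * theta 0 ^+ 2 <= B * kap z /\ `|ddb z y| * theta 0 <= B * kap z.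
  have [_ h1 _ h2] := h y z 0 (introT andP (conj (lexx 0) ltr01)); split.
    rewrite -exprMn -(ger0_norm (ltW th0)) -normrM; apply: le_trans h1.
    by rewrite /= !subr0 -mulrBl.
  rewrite -{1}(ger0_norm (ltW th0)) -normrM; apply: le_trans h2.
  by rewrite /ddz /sh/= !subr0 !addr0 mulrA -mulrDl -mulrBl.
have th1 : 0 < theta 0 ^+ 2 by rewrite exprn_gt0.
exists (B / theta 0 + B / theta 0 ^+ 2); first by rewrite addr_ge0// divr_ge0// ltW.
move=> z y; have [h1 h2] := h z y; have k0 := kap_ge0 z.
rewrite mulrDl ![_ / _ * _]mulrAC; split.
  by apply: ler_wpDl; [rewrite !mulr_ge0// invr_ge0 ltW|rewrite ler_pdivlMr].
by apply: ler_wpDr; [rewrite !mulr_ge0// invr_ge0 ltW|rewrite ler_pdivlMr].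
Qed.

Let ib := box_integrable (N := N) eta0.
Let mb : measurable_fun setT (\1_(box eta) : X -> R).
Proof. exact: measurable_indic (measurable_box _). Qed.
Let V : R := \int[lebX]_y (\1_(box eta) y).
Let V0 : 0 <= V. Proof. exact: Rintegral_ge0. Qed.

Let boxP y : (rho y == 0) || (\1_(box eta) y == 1 :> R).
Proof.
have [//|/bump_neq0 h] := eqVneq (rho y) 0.
by rewrite indicE mem_set//= eqxx.
Qed.

Lemma bump_L1 : exists2 C : R, 0 <= C & forall z : X,
  [/\ lebX.-integrable setT (EFin \o db z), lebX.-integrable setT (EFin \o ddb z),
      (\int[lebX]_y `|db z y|) ^+ 2 <= C * kap z &
      \int[lebX]_y `|ddb z y| <= C * kap z].
Proof.
have [B B0 h] := bump_bounds.
(* The differences live on two, respectively three, translates of the box of volume [V]: the square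
   of the first norm is at most (2 V)^2 B kap z, and the second norm at most 3 V B kap z. *)
exists (4 * V ^+ 2 * B + 3 * V * B) => [|z].
  by rewrite addr_ge0// !mulr_ge0// sqr_ge0.
have k0 := kap_ge0 z; have Bk0 := mulr_ge0 B0 k0.
have ish z' := shift_integrable z' ib.
pose s := Num.sqrt (B * kap z).
have s0 : 0 <= s by exact: sqrtr_ge0.
have d1 y : `|db z y| <= s * (\1_(box eta) y + \1_(box eta) (y + z)).
  have hs : `|db z y| <= s.
    by rewrite -(normr_id (db z y)) -sqrtr_sqr ler_sqrt// (h z y).1.
  move: hs; rewrite /db; case/orP: (boxP y) => /eqP E1; last first.
    by move=> /le_trans; apply; rewrite E1 ler_peMr// lerDl.
  case/orP: (boxP (y + z)) => /eqP E2.
    by rewrite E1 E2 subrr normr0 => _; rewrite mulr_ge0// addr_ge0.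
  by move=> /le_trans; apply; rewrite E2 ler_peMr// lerDr.
have d2 y : `|ddb z y| <= (B * kap z) * (\1_(box eta) y + \1_(box eta) (y + z) + \1_(box eta) (y - z)).
  have := (h z y).2; rewrite /ddb; case/orP: (boxP y) => /eqP E1; last first.
    by move=> /le_trans; apply; rewrite E1 ler_peMr// -addrA lerDl addr_ge0.
  case/orP: (boxP (y + z)) => /eqP E2; last first.
    by move=> /le_trans; apply; rewrite E2 ler_peMr// addrAC lerDr addr_ge0.
  case/orP: (boxP (y - z)) => /eqP E3; last first.
    by move=> /le_trans; apply; rewrite E3 ler_peMr// lerDr addr_ge0.
  by rewrite E1 E2 E3 mulr0 subr0 addr0 normr0 => _; rewrite mulr_ge0// !addr_ge0.
have i1 : lebX.-integrable setT (EFin \o (fun y => s * (\1_(box eta) y + \1_(box eta) (y + z)))).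
  by apply: RintegrableZl; exact: RintegrableD.
have i2 : lebX.-integrable setT (EFin \o (fun y => (B * kap z) * (\1_(box eta) y + \1_(box eta) (y + z) + \1_(box eta) (y - z)))).
  by apply: RintegrableZl; apply: RintegrableD => //; exact: RintegrableD.
have j1 := le_Rintegrable (measurable_db z) d1 i1.
have j2 := le_Rintegrable (measurable_ddb z) d2 i2.
split => //.
  have : \int[lebX]_y `|db z y| <= s * (2 * V).
    apply: (@le_trans _ _ (\int[lebX]_y (s * (\1_(box eta) y + \1_(box eta) (y + z))))).
      by apply: le_Rintegral => //; exact: integrable_norm.
    rewrite RintegralZl//; last exact: RintegrableD.
    rewrite RintegralD// (shift_integral z mb) ler_wpM2l//.
    by rewrite mulr2n mulrDl mul1r.
  have I0 : 0 <= \int[lebX]_y `|db z y| by exact: Rintegral_ge0.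
  move=> hI; apply: (@le_trans _ _ ((s * (2 * V)) ^+ 2)).
    by rewrite ler_sqr// nnegrE// mulr_ge0// mulr_ge0.
  rewrite exprMn sqr_sqrtr//.
  have := mulr_ge0 V0 Bk0; nra.
apply: (@le_trans _ _ ((B * kap z) * (3 * V))).
  apply: (@le_trans _ _ (\int[lebX]_y ((B * kap z) * (\1_(box eta) y + \1_(box eta) (y + z) + \1_(box eta) (y - z))))).
    by apply: le_Rintegral => //; exact: integrable_norm.
  rewrite RintegralZl//; last by apply: RintegrableD => //; exact: RintegrableD.
  rewrite RintegralD//; last exact: RintegrableD.
  rewrite RintegralD// (shift_integral z mb) (shift_integral (- z) mb) ler_wpM2l//.
  rewrite -/V; lra.
have := mulr_ge0 (sqr_ge0 V) Bk0; nra.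
Qed.

(** A spatial shift of the average is moved onto the kernel; differences of the average of a merely
    bounded [f] are thereby controlled by those of the bump. *)
Lemma avg_shift (r : X -> R) (f : Om -> R) z w : measurable_fun setT r -> measurable_fun setT f ->
  avg lebX r jx f (sh (z, 0) w) = \int[lebX]_y (r (y - z) * f (sh (jx y) w)).
Proof.
move=> mr mf.
have mg : measurable_fun setT (fun y : X => r (y - z) * f (sh (jx y) w)).
  apply: measurable_funM; first exact: measurable_shift.
  apply: (measurableT_comp mf); apply: measurable_fun_pair => //=.
  exact: measurable_rVD.
apply: etrans _ (shift_integral z mg); apply: eq_Rintegral => y _.
rewrite addrK /sh/= addr0; congr (_ * f (_, _)); first by rewrite -addrA (addrC z).
Qed.

Variables (f : Om -> R) (K : R).
Hypotheses (mf : measurable_fun setT f) (fK : forall w, `|f w| <= K).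

Let mr := @measurable_bump R N eta.
Let ir := bump_integrable (N := N) eta0.

Let mfw w : measurable_fun setT (fun y : X => f (sh (jx y) w)).
Proof.
by apply: (measurableT_comp mf); apply: measurable_fun_pair => //=; exact: measurable_rVD.
Qed.

Let mulf_integrable (r : X -> R) w : lebX.-integrable setT (EFin \o r) ->
  lebX.-integrable setT (EFin \o (fun y => r y * f (sh (jx y) w))).
Proof.
move=> hr; have := Rintegrable_bounded_mull (mfw w) (fun y => fK _) hr.
by congr (_.-integrable _ _); apply/funext => y /=; rewrite mulrC.
Qed.

Lemma dz_bump z w :
  dz z (avg lebX rho jx f) w = \int[lebX]_y (db (- z) y * f (sh (jx y) w)).
Proof.
rewrite /dz avg_shift// -RintegralB//.
- by apply: eq_Rintegral => y _; rewrite /db mulrBl.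
- by apply: mulf_integrable; exact: shift_integrable.
- exact: mulf_integrable.
Qed.

Lemma ddz_bump z w :
  ddz z (avg lebX rho jx f) w = \int[lebX]_y (ddb z y * f (sh (jx y) w)).
Proof.
have i1 z' : lebX.-integrable setT (EFin \o (fun y : X => rho (y + z') * f (sh (jx y) w))).
  by apply: mulf_integrable; exact: shift_integrable.
have i0 := mulf_integrable w ir.
have i2 := RintegrableZl 2 i0.
have i3 := RintegrableD (i1 z) (i1 (- z)).
rewrite /ddz !avg_shift// opprK.
transitivity (\int[lebX]_y (rho (y + z) * f (sh (jx y) w) + rho (y - z) * f (sh (jx y) w)
   - 2 * (rho y * f (sh (jx y) w)))); last first.
  by apply: eq_Rintegral => y _; rewrite /ddb; ring.
apply/esym; apply: etrans (RintegralB measurableT i3 i2) _; congr (_ - _); last exact: RintegralZl.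
by apply: etrans (RintegralD measurableT (i1 z) (i1 (- z))) _; exact: addrC.
Qed.

Let norm_mulf_le (r : X -> R) w : lebX.-integrable setT (EFin \o r) ->
  `|\int[lebX]_y (r y * f (sh (jx y) w))| <= K * \int[lebX]_y `|r y|.
Proof.
move=> hr; apply: le_trans (le_normr_Rintegral _ _) _ => //; first exact: mulf_integrable.
rewrite -RintegralZl//; last exact: integrable_norm.
apply: le_Rintegral => //.
- by apply: integrable_norm; exact: mulf_integrable.
- by apply: RintegrableZl; exact: integrable_norm.
- by move=> y _; rewrite normrM mulrC; apply: ler_wpM2r.
Qed.

Lemma avg_bump_bounds : exists2 C : R, 0 <= C & forall (z : X) w,
  `|dz z (avg lebX rho jx f) w| ^+ 2 <= C * kap z /\
  `|ddz z (avg lebX rho jx f) w| <= C * kap z.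
Proof.
have [C C0 h] := bump_L1.
have K0 : 0 <= K by apply: le_trans (fK (0, 0)).
exists (K ^+ 2 * C + K * C) => [|z w].
  by rewrite addr_ge0// mulr_ge0// sqr_ge0.
have k0 := kap_ge0 z; have [_ i2 _ h2] := h z; have [i1 _ h1 _] := h (- z).
rewrite kapN in h1.
rewrite mulrDl dz_bump ddz_bump; split.
  apply: ler_wpDr; first by rewrite !mulr_ge0.
  have := norm_mulf_le w i1; set a := `|_| => ha.
  apply: (@le_trans _ _ ((K * \int[lebX]_y `|db (- z) y|) ^+ 2)).
    rewrite ler_sqr// ?nnegrE//; first by rewrite /a.
    by rewrite mulr_ge0//; exact: Rintegral_ge0.
  by rewrite exprMn -mulrA ler_wpM2l// sqr_ge0.
apply: ler_wpDl; first by rewrite !mulr_ge0// sqr_ge0.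
by apply: le_trans (norm_mulf_le w i2) _; rewrite -mulrA ler_wpM2l.
Qed.

End bump_averages.

(** * The equation averaged in time *)

Section primitive.
Context {R : realType}.
Notation leb := (@lebesgue_measure R).

Lemma Rintegral_if (D : set R) (f : R -> R) (b : pred R) : (forall t, D t <-> b t) ->
  \int[leb]_(t in D) f t = \int[leb]_t (f t * (b t)%:R).
Proof.
move=> Db; rewrite Rintegral_mkcond; apply: eq_Rintegral => t _.
rewrite patchE; case: (boolP (b t)) => bt.
  by rewrite mem_set ?mulr1//; apply/Db.
by rewrite memNset ?mulr0// => /Db; exact/negP.
Qed.

Lemma measurable_predR (b : pred R) (D : set R) : measurable D -> (forall t, D t <-> b t) ->
  measurable_fun setT (fun t : measurableTypeR R => (b t)%:R : R).
Proof.
move=> mD Db; rewrite (_ : (fun t => _) = \1_D); first exact: measurable_indic.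
apply/funext => t; rewrite indicE; case: (boolP (b t)) => bt.
  by rewrite mem_set//; apply/Db.
by rewrite memNset//= => /Db; exact/negP.
Qed.

Lemma mul_pred_integrable (b : pred R) (D : set R) (g : R -> R) : measurable D ->
  (forall t, D t <-> b t) -> leb.-integrable setT (EFin \o g) ->
  leb.-integrable setT (EFin \o (fun t => g t * (b t)%:R)).
Proof.
move=> mD Db ig.
have := Rintegrable_bounded_mull (measurable_predR mD Db) (M := 1) _ ig.
rewrite (_ : (fun t => (b t)%:R * g t) = (fun t => g t * (b t)%:R)); last first.
  by apply/funext => t; rewrite mulrC.
by apply => t; case: (b t); rewrite ?normr1// normr0.
Qed.

Lemma itv_integrable (a b : R) :
  leb.-integrable setT (EFin \o (\1_(`[a, b]%classic) : measurableTypeR R -> R)).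
Proof.
have h : (@lebesgue_measure R `[a, b]%classic < +oo)%E.
  by rewrite lebesgue_measure_itv/=; case: ifP => // _; rewrite -EFinB ltry.
pose I : measurableTypeR R -> R := \1_(`[a, b]%classic).
have mi : measurable_fun setT I by exact: measurable_indic.
apply: (@ge0_RintegrableE _ _ _ leb I) => //.
by rewrite integral_indic ?setIT.
Qed.

(** The primitive is taken from +oo, with a minus sign in its derivative, because the equation for
    the test function in time is solved backwards. *)
Definition prim (g : R -> R) (s : R) : R := \int[leb]_t (g t * (s <= t)%R%:R).

Lemma is_derive_prim (g : R -> R) (s : R) : leb.-integrable setT (EFin \o g) ->
  continuous g -> is_derive s (1 : R) (prim g) (- g s).
Proof.
move=> ig cg.
have igD (D : set R) : measurable D -> leb.-integrable D (EFin \o g).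
  by move=> mD; apply: integrableS ig.
have [d1 d2] := @continuous_FTC1 R g -oo%O s (s + 1) (ltr_pwDr ltr01 (lexx s))
  (igD _ (measurable_itv _)) (ltNyr _) (cg s).
pose F := (fun x : R => \int[leb]_(t in `]-oo, x]) g t).
have -> : prim g = (cst (\int[leb]_t g t) - F).
  apply/funext => x; rewrite !fctE; apply/esym/eqP; rewrite subr_eq; apply/eqP.
  rewrite /F -Rintegral_itv_bndo_bndc; last by apply: igD; exact: measurable_itv.
  rewrite (@Rintegral_if `]-oo, x[%classic g (fun t => t < x)%R); last by move=> t; rewrite /= in_itv.
  have i1 : leb.-integrable setT (EFin \o (fun t => g t * (x <= t)%R%:R)).
    apply: (@mul_pred_integrable _ `[x, +oo[%classic) => //.
    by move=> t; rewrite /= in_itv/= andbT.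
  have i2 : leb.-integrable setT (EFin \o (fun t => g t * (t < x)%R%:R)).
    exact: (@mul_pred_integrable _ `]-oo, x[%classic).
  have E := RintegralD (@measurableT _ (measurableTypeR R)) i1 i2.
  rewrite /prim -E; apply: eq_Rintegral => t _; rewrite ltNge.
  by case: (x <= t); rewrite /= !(mulr0, mulr1) ?addr0 ?add0r.
have D1 : is_derive s (1 : R) (cst (\int[leb]_t g t)) 0 by exact: is_derive_cst.
have D2 : is_derive s (1 : R) F (g s) by apply: DeriveDef; [exact: d1|rewrite -derive1E; exact: d2].
by have := is_deriveB D1 D2; rewrite sub0r.
Qed.

Lemma Ck_prim (g : R -> R) k : leb.-integrable setT (EFin \o g) ->
  (forall k, Ck k g) -> Ck k (prim g).
Proof.
move=> ig Cg; have cg : continuous g := Cg 0%N.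
apply: CkS; apply: (@Ck1 _ _ _ (fun s => - g s)) => [s|]; first exact: is_derive_prim.
rewrite (_ : (fun s => - g s) = (fun s => -1 * g s)); last by apply/funext => s; rewrite mulN1r.
by apply: CkM; [exact: Ck_cst|exact: Cg].
Qed.

End primitive.

(** * The scalar equation P' = Q in resolvent form *)

Section ode.
Context {R : realType}.
Notation leb := (@lebesgue_measure R).
Variables (l T p0 K : R) (P Q : measurableTypeR R -> R).
Hypotheses (l0 : 0 < l) (mP : measurable_fun setT P) (mQ : measurable_fun setT Q).
Hypotheses (PK : forall t, `|P t| <= K) (QK : forall t, `|Q t| <= K).
Hypotheses (Pn : forall t, t <= 0 -> P t = p0) (Qn : forall t, t <= 0 -> Q t = 0).
Hypothesis H : forall theta : R -> R, (forall k, Ck k theta) ->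
  (exists2 T1, 0 < T1 < T & forall s, T1 <= s -> theta s = 0) ->
  \int[leb]_t ((0 < t < T)%R%:R * (P t * derive1 theta t + Q t * theta t)) + p0 * theta 0 = 0.

(** The average [A] over the past inverts 1 + (1/l) d/dt, so P' = Q amounts to P = A (P + Q / l) = A
    W. As [P] is constant and [Q] zero before time 0, the initial value is part of the past. *)
Let W t := P t + l^-1 * Q t.

Lemma measurable_W : measurable_fun setT W.
Proof. by apply: measurable_funD => //; exact: measurable_funM. Qed.

Let KW : R := K + l^-1 * K.
Lemma W_le t : `|W t| <= KW.
Proof.
apply: le_trans (ler_normD _ _) _; apply: lerD => //.
by rewrite normrM ger0_norm ?invr_ge0 ?(ltW l0)// ler_wpM2l// invr_ge0 ltW.
Qed.

Let tav t := \int[leb]_s (expk l s * W (t + s)).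

Section test.
Variables (eta : R -> R) (b : R).
Hypotheses (b0 : 0 < b < T) (Ce : forall k, Ck k eta) (e01 : forall t, 0 <= eta t <= 1).
Hypothesis e0 : forall t, eta t != 0 -> 0 < t < b.

Let g t := eta t * expR (- l * t).
(* The solution of theta' = l theta - eta vanishing for large times; testing the
   equation P' = Q with it removes the time derivative. *)
Let theta s := expR (l * s) * prim g s.

Let Cg k : Ck k g.
Proof. by apply: CkM => //; exact: Ck_expR. Qed.

Let cg : continuous g := Cg 0%N.
Let ce : continuous eta := Ce 0%N.
Let me : measurable_fun setT (eta : measurableTypeR R -> R).
Proof. exact: continuous_measurable_fun. Qed.

Let ie : leb.-integrable setT (EFin \o eta).
Proof.
pose I : measurableTypeR R -> R := \1_(`[0, b]%classic).
have mi : measurable_fun setT I by exact: measurable_indic.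
apply: (@le_Rintegrable _ _ _ leb eta I) => //.
  move=> t; rewrite /I indicE; have [->|/e0 /andP[h1 h2]] := eqVneq (eta t) 0.
    by rewrite normr0.
  rewrite mem_set; last by rewrite /= in_itv/= !ltW.
  by have /andP[? ?] := e01 t; rewrite ger0_norm.
exact: itv_integrable.
Qed.

Let ig : leb.-integrable setT (EFin \o g).
Proof.
apply: (le_Rintegrable _ _ ie); first by exact: continuous_measurable_fun.
move=> t; rewrite /g; have [->|/e0 /andP[h1 _]] := eqVneq (eta t) 0; first by rewrite mul0r normr0.
have /andP[? ?] := e01 t; rewrite normrM !ger0_norm ?expR_ge0// ler_piMr//.
by rewrite expR_le1 mulNr oppr_le0 mulr_ge0// ltW.
Qed.

Let theta0 s : b <= s -> theta s = 0.
Proof.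
move=> bs; rewrite /theta /prim (_ : \int[leb]_t _ = 0) ?mulr0//.
transitivity (\int[leb]_t (0 : R)); last by rewrite Rintegral_cst// mul0r.
apply: eq_Rintegral => t _; rewrite /g.
have [->|/e0 /andP[_ tb]] := eqVneq (eta t) 0; first by rewrite !mul0r.
by rewrite leNgt (lt_le_trans tb bs)/= mulr0.
Qed.

Let dtheta s : derive1 theta s = l * theta s - eta s.
Proof.
rewrite derive1E.
have D1 : is_derive s (1 : R) (fun s => expR (l * s)) (l * expR (l * s)).
  have d1 : is_derive s (1 : R) (fun x : R => l * x) l.
    have := is_deriveZ l (@is_derive_id R R s 1).
    by rewrite /GRing.scale/= mulr1.
  have := @is_derive1_comp R expR (fun x => l * x) s (expR (l * s)) l (is_derive_expR _) d1.
  by rewrite mulrC.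
have D2 := is_derive_prim s ig cg.
have D := is_deriveM D1 D2; rewrite (@derive_val _ _ _ _ _ _ _ D) /theta /g /GRing.scale/=.
rewrite mulrN (mulrC (prim g s)) -mulrA [_ * (eta s * _)]mulrCA -expRD.
by rewrite mulNr subrr expR0 mulr1 addrC mulrA.
Qed.

Let thetaE s : l * theta s = \int[leb]_t (eta t * expk l (s - t)).
Proof.
rewrite /theta mulrA /prim -RintegralZl//; last first.
  apply: (@mul_pred_integrable _ _ `[s, +oo[%classic) => //.
  by move=> t; rewrite /= in_itv/= andbT.
apply: eq_Rintegral => t _; rewrite /expk subr_le0 /g.
case: (s <= t) => /=; last by rewrite !mulr0.
by rewrite mulr1 [LHS]mulrCA -mulrA -expRD; congr (_ * (_ * expR _)); ring.
Qed.

Let ifub : (leb \x leb)%E.-integrable setT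
  (EFin \o (fun p : measurableTypeR R * measurableTypeR R => W p.1 * (eta p.2 * expk l (p.1 - p.2)))).
Proof.
have m12 : measurable_fun setT (fun p : measurableTypeR R * measurableTypeR R => p.1 - p.2 : measurableTypeR R).
  by apply: measurable_funB; [exact: measurable_fst|exact: measurable_snd].
have mf : measurable_fun setT (fun p : measurableTypeR R * measurableTypeR R => W p.1 * (eta p.2 * expk l (p.1 - p.2))).
  apply: measurable_funM; first exact: measurableT_comp measurable_W measurable_fst.
  apply: measurable_funM; first exact: measurableT_comp me measurable_snd.
  exact: measurableT_comp (@measurable_expk R l) m12.
have [i1 h1] := expk_integrable l0.
apply: (@RintegrableX1 _ _ _ _ _ _ _ _ (fun t : measurableTypeR R => KW * eta t)) => //; last exact: RintegrableZl.
  move=> t.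
  have mpi := mpres_integrable (mpres_lebesgue_shift (- t)) i1.
  have := RintegrableZl (eta t) mpi => /(Rintegrable_bounded_mull measurable_W W_le).
  by [].
move=> t /=; have /andP[et0 _] := e01 t.
have mpi := mpres_integrable (mpres_lebesgue_shift (- t)) i1.
have j1 := Rintegrable_bounded_mull measurable_W W_le (RintegrableZl (eta t) mpi).
apply: (@le_trans _ _ (\int[leb]_s (KW * eta t * expk l (s - t)))).
  apply: le_Rintegral => //; first exact: integrable_norm.
    by apply: RintegrableZl.
  move=> s _; rewrite normrM -mulrA ler_pM ?W_le//.
  by rewrite ger0_norm// mulr_ge0// expk_ge0.
rewrite RintegralZl// (mpres_Rintegral (mpres_lebesgue_shift (- t)) (@measurable_expk R l)) h1.
by rewrite mulr1.
Qed.

(** By [thetaE], l * theta is the adjoint average of [eta]. Fubini moves the average to [W], and the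
    weak equation for [theta] becomes the claim. *)
Lemma ode_weak : \int[leb]_t (eta t * (tav t - P t)) = 0.
Proof.
have [h1 h2] := Rfubini1 ifub; have [h3 h4] := Rfubini2 ifub.
have [ik hk] := expk_integrable l0.
have Ct k : Ck k theta by apply: CkM; [exact: Ck_expR|exact: Ck_prim].
have bT : exists2 T1, 0 < T1 < T & forall s, T1 <= s -> theta s = 0 by exists b.
have /andP[bp bT'] := b0.
have E1 s : \int[leb]_t (W s * (eta t * expk l (s - t))) = W s * (l * theta s).
  rewrite thetaE RintegralZl//.
  have [i1 _] := expk_integrable l0.
  have mk : measurable_fun setT (fun t : measurableTypeR R => expk l (s - t)).
    by apply: measurableT_comp (@measurable_expk R l) _; exact: measurable_funB.
  have := Rintegrable_bounded_mull mk (M := l) _ ie.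
  rewrite (_ : (fun t => _ * _) = (fun t => eta t * expk l (s - t))); last first.
    by apply/funext => t; rewrite mulrC.
  by apply => t; rewrite ger0_norm ?expk_le ?expk_ge0.
have E2 t : \int[leb]_s (W s * (eta t * expk l (s - t))) = eta t * tav t.
  have mp := mpres_lebesgue_shift t.
  have mf : measurable_fun setT (fun s : measurableTypeR R => W s * (eta t * expk l (s - t))).
    apply: measurable_funM; first exact: measurable_W.
    apply: measurable_funM => //.
    by apply: measurableT_comp (@measurable_expk R l) _; exact: measurable_funB.
  rewrite -(mpres_Rintegral mp mf) /tav -RintegralZl//.
    by apply: eq_Rintegral => s _; rewrite addrK (addrC s); ring.
  have mWt : measurable_fun setT (fun s : measurableTypeR R => W (t + s)).
    by apply: (measurableT_comp measurable_W); exact: measurable_funD.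
  have := Rintegrable_bounded_mull mWt (fun s => W_le (t + s)) ik.
  by congr (_.-integrable _ _); apply/funext => s /=; rewrite mulrC.
have iWt : leb.-integrable setT (EFin \o (fun s => W s * (l * theta s))).
  by move: h1; congr (_.-integrable _ _); apply/funext => s /=; rewrite -E1.
have iet : leb.-integrable setT (EFin \o (fun t => eta t * tav t)).
  by move: h3; congr (_.-integrable _ _); apply/funext => t /=; rewrite -E2.
have F : \int[leb]_s (W s * (l * theta s)) = \int[leb]_t (eta t * tav t).
  under eq_Rintegral do rewrite -E1.
  by under [RHS]eq_Rintegral do rewrite -E2; rewrite h2 h4.
have iPe : leb.-integrable setT (EFin \o (fun t => P t * eta t)).
  exact: Rintegrable_bounded_mull mP PK ie.
have th00 : p0 * theta 0 = \int[leb]_t ((p0 * theta 0) * expk l t).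
  by rewrite RintegralZl// hk mulr1.
(* For t <= 0, [W t * (l * theta t)] is p0 l e^(l t) theta 0, whose integral is the initial term;
   for t >= T both [theta] and [eta] vanish. *)
have pw t : (0 < t < T)%R%:R * (P t * derive1 theta t + Q t * theta t) =
    W t * (l * theta t) - P t * eta t - p0 * theta 0 * expk l t.
  rewrite dtheta /expk /W; have [t0|t0] := leP t 0.
    have -> : eta t = 0 by apply/eqP/negPn/negP => /e0; rewrite ltNge t0.
    rewrite Pn// Qn// mul0r !mulr0 addr0 subr0; apply/esym/eqP; rewrite subr_eq0; apply/eqP.
    have -> : theta t = expR (l * t) * theta 0.
      rewrite /theta mulr0 expR0 mul1r; congr (_ * _); apply: eq_Rintegral => r _; rewrite /g.
      have [->|/e0 /andP[r0 _]] := eqVneq (eta r) 0; first by rewrite !mul0r.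
      by rewrite (le_trans t0 (ltW r0)) (ltW r0).
    by ring.
  rewrite mulr0 subr0; case: ltP => tT; first by rewrite mul1r; field; rewrite gt_eqF.
  rewrite (theta0 (le_trans (ltW bT') tT)).
  have -> : eta t = 0.
    by apply/eqP/negPn/negP => /e0 /andP[_]; rewrite ltNge (le_trans (ltW bT') tT).
  by rewrite mul0r !mulr0 subr0.
have ik0 := RintegrableZl (p0 * theta 0) ik.
have iWP := RintegrableB iWt iPe.
have := H Ct bT; under eq_Rintegral do rewrite pw.
rewrite RintegralB// -th00 subrK RintegralB// F -RintegralB// => <-.
by apply: eq_Rintegral => t _; ring.
Qed.

End test.

Let mtav : measurable_fun setT (tav : measurableTypeR R -> R).
Proof.
have m12 : measurable_fun setT (fun p : measurableTypeR R * measurableTypeR R => p.1 + p.2 : measurableTypeR R).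
  by apply: measurable_funD; [exact: measurable_fst|exact: measurable_snd].
have mf : measurable_fun setT (fun p : measurableTypeR R * measurableTypeR R => expk l p.2 * W (p.1 + p.2)).
  apply: measurable_funM; last exact: measurableT_comp measurable_W m12.
  exact: measurableT_comp (@measurable_expk R l) measurable_snd.
exact: (measurable_Rintegral2 leb mf).
Qed.

Let tav_le t : `|tav t| <= KW.
Proof.
have [ik hk] := expk_integrable l0.
have mWt : measurable_fun setT (fun s : measurableTypeR R => W (t + s)).
  by apply: (measurableT_comp measurable_W); exact: measurable_funD.
have iW : leb.-integrable setT (EFin \o (fun s => expk l s * W (t + s))).
  have := Rintegrable_bounded_mull mWt (fun s => W_le (t + s)) ik.
  by congr (_.-integrable _ _); apply/funext => s /=; rewrite mulrC.
apply: le_trans (le_normr_Rintegral _ _) _ => //.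
rewrite -[leRHS]mulr1 -hk -RintegralZl//.
apply: le_Rintegral => //; first exact: integrable_norm.
  exact: RintegrableZl.
by move=> s _; rewrite normrM mulrC (ger0_norm (expk_ge0 l0 s)) ler_wpM2r ?expk_ge0// W_le.
Qed.

Let G t := tav t - P t.
Let mG : measurable_fun setT (G : measurableTypeR R -> R).
Proof. exact: measurable_funB. Qed.
Let KG := KW + K.
Let G_le t : `|G t| <= KG.
Proof. by apply: le_trans (ler_normB _ _) _; exact: lerD. Qed.
Let KG0 : 0 <= KG. Proof. exact: le_trans (G_le 0). Qed.

Let flat_cvg1 (a c : R) : 0 < a -> (fun n => flat 0 (n%:R * a - c)) @ \oo --> (1 : R).
Proof.
move=> a0.
have h : (fun n : nat => n%:R * a - c) @ \oo --> +oo%R.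
  apply/cvgryPge => A; near=> n.
  rewrite lerBrDr -ler_pdivrMr//; near: n; exact: nbhs_infty_ger.
have h0 : \forall n \near \oo, 0 < n%:R * a - c.
  by move/cvgryPgt : h => /(_ 0).
have h1 : (fun n : nat => (n%:R * a - c)^-1) @ \oo --> (0 : R).
  exact: (gtr0_cvgV0 h0).2 h.
have h2 : (fun n : nat => expR (- (n%:R * a - c)^-1)) @ \oo --> expR (- 0).
  by apply: continuous_cvg; [exact: continuous_expR|exact: cvgN].
rewrite oppr0 expR0 in h2; apply: cvg_trans h2; apply: near_eq_cvg; near=> n.
by rewrite /flat ifT ?expr0 ?mul1r//; near: n.
Unshelve. all: by end_near. Qed.

Lemma ode_itv b : 0 < b < T -> \int[leb]_t ((0 < t < b)%R%:R * G t) = 0.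
Proof.
move=> bT; have /andP[b0 _] := bT.
(* Smooth functions with values in [0, 1] that vanish off ]0, b[ and converge to its indicator; the
   [- 0] fits the form of [flat_cvg1]. *)
pose e n t := flat 0 (n%:R * t - 1) * flat 0 (n%:R * (b - t) - 0).
have Ce n k : Ck k (e n).
  apply: CkM.
    have al : affine_fun (fun s : R => n%:R * s - 1) (fun s => n%:R * s).
      by apply: affine_scale; split => //= p; exact: derivable1_diffP.1.
    exact: Ck_comp al (Ck_flat k 0).
  have al : affine_fun (fun s : R => - n%:R * s + n%:R * b) (fun s => - n%:R * s).
    by apply: affine_scale; split => //= p; exact: derivable1_diffP.1.
  have := Ck_comp al (Ck_flat k 0); congr Ck; apply/funext => s; congr flat; ring.
have e01 n t : 0 <= e n t <= 1.
  by rewrite mulr_ge0 ?flat_ge0//= mulr_ile1 ?flat_ge0 ?flat0_le1.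
have e0 n t : e n t != 0 -> 0 < t < b.
  rewrite mulf_eq0 => /norP[h1 h2]; apply/andP; split; rewrite ltNge; apply/negP => h.
    move: h1; rewrite flat_le0 ?eqxx// subr_le0 (le_trans _ ler01)//.
    by rewrite mulr_ge0_le0.
  by move: h2; rewrite flat_le0 ?eqxx// subr0 mulr_ge0_le0// subr_le0.
have cv t : (fun n => e n t * G t) @ \oo --> (0 < t < b)%R%:R * G t.
  apply: cvgMl; case: (boolP (0 < t < b)%R) => [/andP[t0 tb]|h].
    rewrite -[X in _ --> X]mulr1; apply: cvgM; apply: flat_cvg1 => //.
    by rewrite subr_gt0.
  rewrite (_ : (fun n => e n t) = cst 0); first exact: cvg_cst.
  by apply/funext => n; apply/eqP/negPn/negP => /e0; exact/negP.
have mI : measurable_fun setT (fun t : measurableTypeR R => (0 < t < b)%R%:R : R).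
  by apply: (@measurable_predR _ _ `]0, b[%classic) => // t; rewrite /= in_itv.
have c1 := @Rdct _ _ _ leb (fun n t => e n t * G t) (fun t => (0 < t < b)%R%:R * G t)
  (fun t => KG * \1_(`[0, b]%classic) t)
  (fun n => measurable_funM (continuous_measurable_fun (Ce n 0%N)) mG)
  (measurable_funM mI mG) cv (RintegrableZl KG (itv_integrable 0 b)).
have Z n : \int[leb]_t (e n t * G t) = 0.
  exact: (ode_weak bT (Ce n) (e01 n) (e0 n)).
have {}c1 : (fun n : nat => \int[leb]_t (e n t * G t)) @ \oo --> \int[leb]_t ((0 < t < b)%R%:R * G t).
  apply: (c1 _).2 => n t; rewrite normrM indicE mulrC.
  have [->|/e0 /andP[h1 h2]] := eqVneq (e n t) 0; first by rewrite normr0 mulr0 mulr_ge0.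
  rewrite mem_set; last by rewrite /= in_itv/= !ltW.
  by rewrite ler_pM// ger0_norm; have /andP[] := e01 n t.
rewrite (funext Z) in c1.
by rewrite -(cvg_lim (@Rhausdorff R) c1); exact: lim_cst.
Qed.

(** The primitive of the difference is 0 on ]0, T[ by [ode_itv], and by Lebesgue's differentiation
    theorem its derivative is the difference almost everywhere. *)
Lemma ode_ae : {ae leb, forall t, 0 < t < T -> P t = tav t}.
Proof.
pose f (t : measurableTypeR R) := (0 < t < T)%R%:R * G t.
have mI : measurable_fun setT (fun t : measurableTypeR R => (0 < t < T)%R%:R : R).
  by apply: (@measurable_predR _ _ `]0, T[%classic) => // t; rewrite /= in_itv.
have iF : leb.-integrable setT (EFin \o f).
  apply: (@le_Rintegrable _ _ _ leb f (fun t => KG * \1_(`[0, T]%classic) t)).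
  - exact: measurable_funM.
  - move=> t; rewrite /f normrM mulrC indicE; case: (boolP (0 < t < T)) => [/andP[h1 h2]|_].
      rewrite mem_set; last by rewrite /= in_itv/= !ltW.
      by rewrite normr1 !mulr1.
    by rewrite normr0 mulr0 mulr_ge0.
  - exact: RintegrableZl (itv_integrable _ _).
have iD (D : set R) : measurable D -> leb.-integrable D (EFin \o f).
  by move=> mD; apply: integrableS iF.
have lf : locally_integrable [set: R] f.
  have := integrable_locally measurableT iF.
  by rewrite patch_setT.
have := @FTC1Ny R f (fun y => iD _ (measurable_itv _)) lf.
apply: filterS; first exact: (ae_filter_ringOfSetsType leb).
move=> x [d1 d2] xT.
have {d1 d2} : f x = 0; last by rewrite /f xT mul1r => /eqP; rewrite subr_eq0 => /eqP.
rewrite -d2 derive1E.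
have /andP[x0 x1] := xT.
rewrite (@near_eq_derive _ _ _ _ (cst 0)) ?derive_cst//; last first.
near=> y.
have y0 : 0 < y by near: y; exact: lt_nbhsr.
have y1 : y < T by near: y; exact: lt_nbhsl.
rewrite -Rintegral_itv_bndo_bndc; last by apply: iD; exact: measurable_itv.
rewrite (@Rintegral_if R `]-oo, y[%classic f (fun t => t < y)%R)//.
apply: etrans (ode_itv (introT andP (conj y0 y1))); apply: eq_Rintegral => t _.
rewrite /f mulrAC -natrM mulnb -andbA; congr ((nat_of_bool (_ && _))%:R * _).
by case: (ltP t y) => ty; rewrite ?andbF// andbT (lt_trans ty).
Unshelve. all: by end_near. Qed.

End ode.

(** * The Levy operator on averages *)

Section LL_average.
Context {R : realType} {N : nat}.
Notation X := ('rV[R]_N).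
Notation Om := ('rV[R]_N * measurableTypeR R)%type.
Notation m := (@lebesgue_Q R N).
Notation lebX := (lebesgue_rV N).
Notation leb := (@lebesgue_measure R).
Variable mu : {sigma_finite_measure set X -> \bar R}.
Hypothesis kapi : mu.-integrable setT (EFin \o kap).

Lemma LL_le (C : R) (F : Om -> R) w : measurable_fun setT F ->
  (forall z w, `|ddz z F w| <= C * kap z) ->
  `|LL mu F w| <= 2^-1 * (C * \int[mu]_z kap z).
Proof.
move=> mF FC; rewrite /LL normrM ger0_norm// ler_wpM2l//.
have iF : mu.-integrable setT (EFin \o (fun z => ddz z F w)).
  apply: (@le_Rintegrable _ _ _ _ _ (fun z => C * kap z)) => //.
    exact: measurableT_comp (measurable_ddz2 mF) (measurable_pair1 w).
  exact: RintegrableZl.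
apply: le_trans (le_normr_Rintegral _ _) _ => //.
rewrite -RintegralZl//; apply: le_Rintegral => //; first exact: integrable_norm.
exact: RintegrableZl.
Qed.

Lemma avg_LL d0 (P : measurableType d0) (pi : {sigma_finite_measure set P -> \bar R})
    (k : P -> R) (j : P -> Om) (C K : R) (F : Om -> R) w : kernel pi k j ->
  measurable_fun setT F -> (forall w, `|F w| <= K) ->
  (forall z w, `|ddz z F w| <= C * kap z) ->
  LL mu (avg pi k j F) w = avg pi k j (LL mu F) w.
Proof.
move=> kk mF FK FC; have [ik k0 k1 mj] := kk.
have mk := integrable_measurable ik.
have mdd : measurable_fun setT (fun r : X * P => k r.2 * ddz r.1 F (sh (j r.2) w)).
  apply: measurable_funM; first exact: measurableT_comp mk measurable_snd.
  have mjw : measurable_fun setT (fun r : X * P => sh (j r.2) w).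
    have h : measurable_fun setT (fun r : X * P => (j r.2, w)).
      by apply: measurable_fun_pair => //; exact: measurableT_comp mj measurable_snd.
    exact: (measurableT_comp (@measurable_sh2 R N) h).
  have h : measurable_fun setT (fun r : X * P => (sh (j r.2) w, r.1)).
    by apply: measurable_fun_pair => //; exact: measurable_fst.
  exact: (measurableT_comp (measurable_ddz2 mF) h).
have idd : (mu \x pi)%E.-integrable setT (EFin \o (fun r : X * P => k r.2 * ddz r.1 F (sh (j r.2) w))).
  apply: (@le_Rintegrable _ _ _ _ _ (fun r : X * P => (C * kap r.1) * k r.2)) => //.
    by move=> r; rewrite normrM mulrC (ger0_norm (k0 _)) ler_wpM2r.
  by apply: (@Rintegrable_prodM _ _ _ _ _ _ _ (fun z => C * kap z) k) => //; exact: RintegrableZl.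
rewrite /LL; under eq_Rintegral do rewrite (avg_ddz kk _ _ mF FK).
rewrite (Rfubini idd) /avg -RintegralZl//; last exact: (Rfubini2 idd).1.
apply: eq_Rintegral => p _ /=.
suff E : mu.-integrable setT (EFin \o (fun z => ddz z F (sh (j p) w))).
  by rewrite RintegralZl// mulrCA.
apply: (@le_Rintegrable _ _ _ _ _ (fun z => C * kap z)) => //.
  exact: measurableT_comp (measurable_ddz2 mF) (measurable_pair1 _).
exact: RintegrableZl.
Qed.

Section bump.
Variable eta : R.
Hypothesis eta0 : 0 < eta.
Notation rho := (@bump R N eta).
Notation jx := (@jx R N).

Definition LLb (y : X) : R := 2^-1 * \int[mu]_z ddb eta z y.

Lemma ddb_integrable : (lebX \x mu)%E.-integrable setT (EFin \o (fun p : X * X => ddb eta p.2 p.1)).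
Proof.
have [C C0 h] := @bump_L1 R N eta eta0.
apply: (@RintegrableX1 _ _ _ _ _ _ _ _ (fun z => C * kap z)).
- exact: measurable_ddb2.
- by move=> z; have [] := h z.
- by move=> z; have [] := h z.
- exact: RintegrableZl.
Qed.

Lemma LLb_integrable : lebX.-integrable setT (EFin \o LLb).
Proof. by apply: RintegrableZl; exact: (Rfubini1 ddb_integrable).1. Qed.

(** The operator falls on the mollifier, whose image [LLb] is integrable, so [f] may be merely
    bounded. *)
Lemma LL_bump (f : Om -> R) (K : R) w : measurable_fun setT f -> (forall w, `|f w| <= K) ->
  LL mu (avg lebX rho jx f) w = \int[lebX]_y (LLb y * f (sh (jx y) w)).
Proof.
move=> mf fK.
have mfw : measurable_fun setT (fun y : X => f (sh (jx y) w)).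
  by apply: (measurableT_comp mf); apply: measurable_fun_pair => //=; exact: measurable_rVD.
have mf2 : measurable_fun setT (fun p : X * X => f (sh (jx p.1) w)).
  exact: measurableT_comp mfw measurable_fst.
have id := Rintegrable_bounded_mull mf2 (fun p => fK _) ddb_integrable.
have id' : (lebX \x mu)%E.-integrable setT (EFin \o (fun p : X * X => ddb eta p.2 p.1 * f (sh (jx p.1) w))).
  by move: id; congr (_.-integrable _ _); apply/funext => p /=; rewrite mulrC.
rewrite /LL; under eq_Rintegral do rewrite (ddz_bump eta0 mf fK).
rewrite -(Rfubini id') -RintegralZl//; last exact: (Rfubini1 id').1.
apply: eq_Rintegral => y _; rewrite /LLb -mulrA; congr (_ * _).
transitivity (\int[mu]_z (f (sh (jx y) w) * ddb eta z y)).
  by apply: eq_Rintegral => z _; rewrite mulrC.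
rewrite RintegralZl// 1?mulrC//.
have [B B0 h] := @bump_bounds R N eta.
apply: (@le_Rintegrable _ _ _ _ _ (fun z => B * kap z)).
- have mp : measurable_fun setT (fun z : X => (y, z)) by exact: measurable_fun_pair.
  exact: (measurableT_comp (measurable_ddb2 eta) mp).
- by move=> z; have [] := h z y.
- exact: RintegrableZl.
Qed.

End bump.
End LL_average.

(** * The resolvent equation in space-time *)

Section equation.
Context {R : realType} {N : nat}.
Notation X := ('rV[R]_N).
Notation Om := ('rV[R]_N * measurableTypeR R)%type.
Notation m := (@lebesgue_Q R N).
Notation lebX := (lebesgue_rV N).
Notation leb := (@lebesgue_measure R).
Notation jx := (@jx R N).
Notation jt := (@jt R N).
Variable mu : {sigma_finite_measure set X -> \bar R}.
Hypothesis kapi : mu.-integrable setT (EFin \o kap).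

Variables (T K : R) (u w : Om -> R) (u0 : X -> R).
Hypotheses (mu_ : measurable_fun setT u) (uK : forall p, `|u p| <= K).
Hypotheses (mw : measurable_fun setT w) (wK : forall p, `|w p| <= K).
Hypothesis w0 : forall p, ~~ (0 < p.2 < T) -> w p = 0.
Hypotheses (mu0 : measurable_fun setT u0) (u0K : forall x, `|u0 x| <= K).
Hypothesis Hd : forall psi, test_function T psi ->
  \int[m]_p ((0 < p.2 < T)%R%:R * (u p * dt psi p + w p * LL mu psi p))
  + \int[lebX]_x (u0 x * psi (x, 0)) = 0.

Definition ext (p : Om) : R := if 0 < p.2 then u p else u0 p.1.

Lemma measurable_ext : measurable_fun setT ext.
Proof.
apply: measurable_fun_if => //.
- apply: measurable_fun_ltr => //; exact: measurable_snd.
- exact: measurable_funS mu_.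
- by apply: measurable_funS (measurableT_comp mu0 measurable_fst).
Qed.

Lemma ext_le p : `|ext p| <= K.
Proof. by rewrite /ext; case: ifP. Qed.

Variables (eta l : R).
Hypotheses (eta0 : 0 < eta) (l0 : 0 < l).
Notation rho := (@bump R N eta).

Let Pj := avg lebX rho jx ext.
Let Fw := avg lebX rho jx w.
Let Qj := LL mu Fw.

Let rk := @kernel_bump R N eta eta0.
Let ek := @kernel_expk R N l l0.
Let ir := @bump_integrable R N eta eta0.
Let iL := LLb_integrable kapi eta0.
Let mLb := integrable_measurable iL.

Let mPj : measurable_fun setT Pj.
Proof. exact: measurable_avg rk _ measurable_ext. Qed.
Let PjK p : `|Pj p| <= K.
Proof. exact: (avg_bounded rk p measurable_ext ext_le). Qed.
Let mFw : measurable_fun setT Fw.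
Proof. exact: measurable_avg rk _ mw. Qed.
Let FwK p : `|Fw p| <= K.
Proof. exact: (avg_bounded rk p mw wK). Qed.
Let mQj : measurable_fun setT Qj.
Proof. exact: measurable_LL. Qed.

Let mslice (f : Om -> R) x0 : measurable_fun setT f ->
  measurable_fun setT (fun t : measurableTypeR R => f (x0, t)).
Proof.
move=> mf; have h : measurable_fun setT (fun t : measurableTypeR R => (x0, t)) by exact: measurable_fun_pair.
exact: (measurableT_comp mf h).
Qed.

Let mslicex (f : Om -> R) t : measurable_fun setT f ->
  measurable_fun setT (fun x : X => f (x, t)).
Proof.
move=> mf; have h : measurable_fun setT (fun x : X => (x, t) : Om) by exact: measurable_fun_pair.
exact: (measurableT_comp mf h).
Qed.

Let time_integrable (h : R -> R) : continuous h ->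
  leb.-integrable setT (EFin \o (fun t : measurableTypeR R => (0 < t < T)%R%:R * h t)).
Proof.
move=> ch; have [B hB] : exists B, forall t, 0 <= t <= T -> `|h t| <= B.
  have ck : compact (h @` `[0, T]).
    by apply: continuous_compact; [exact: continuous_subspaceT|exact: segment_compact].
  have [B [_ hB]] := compact_bounded ck; exists (B + 1) => t tT.
  apply: (hB (B + 1)); first by rewrite ltrDl.
  by exists t => //; rewrite /= in_itv.
pose I : measurableTypeR R -> R := \1_(`[0, T]%classic).
have mI : measurable_fun setT (fun t : measurableTypeR R => (0 < t < T)%R%:R : R).
  by apply: (@measurable_predR _ _ `]0, T[%classic) => // t; rewrite /= in_itv.
apply: (@le_Rintegrable _ _ _ leb _ (fun t => B * I t)).
- by apply: measurable_funM => //; exact: continuous_measurable_fun.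
- move=> t; rewrite /I indicE; case: (boolP (0 < t < T)) => [/andP[h1 h2]|_].
    rewrite mem_set; last by rewrite /= in_itv/= !ltW.
    by rewrite mul1r mulr1; apply: hB; rewrite !ltW.
  rewrite mul0r normr0; case: (boolP (_ \in _)); rewrite ?mulr0// inE/= in_itv/= => tT.
  by rewrite mulr1; apply: le_trans (hB _ tT).
- exact: RintegrableZl (itv_integrable _ _).
Qed.

Let shift_slice (r : X -> R) (f : Om -> R) (x0 : X) (t : R) :
  measurable_fun setT r -> measurable_fun setT f ->
  \int[lebX]_x (r (x - x0) * f (x, t)) = \int[lebX]_y (r y * f (sh (jx y) (x0, t))).
Proof.
move=> mr mf.
have mg : measurable_fun setT (fun x : X => r (x - x0) * f (x, t)).
  by apply: measurable_funM; [exact: measurable_shift|exact: mslicex].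
apply: etrans (esym (shift_integral x0 mg)) _; apply: eq_Rintegral => y _.
by rewrite addrK /sh/= addr0 (addrC y).
Qed.

(** The test function rho (x - x0) theta t turns the weak formulation into the scalar equation P' =
    Q at the point [x0], with [P] the mollified [ext] and [Q] the operator applied to the mollified
    [w]. *)
Lemma slice_test x0 (theta : R -> R) : (forall k, Ck k theta) ->
  (exists2 T1, 0 < T1 < T & forall s, T1 <= s -> theta s = 0) ->
  \int[leb]_t ((0 < t < T)%R%:R * (Pj (x0, t) * derive1 theta t + Qj (x0, t) * theta t))
  + Pj (x0, 0) * theta 0 = 0.
Proof.
move=> Ct [T1 /andP[T10 T1T] th0].
pose psi (p : X * R) := rho (p.1 - x0) * theta p.2.
have psiT : test_function T psi by exact: bump_test Ct T1T th0.
have dth t : derivable theta t 1 by apply/derivable1_diffP; have [] := Ct 1%N.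
have dpsi p : dt psi p = rho (p.1 - x0) * derive1 theta p.2.
  by rewrite /dt /psi/= derive1E deriveZ// -derive1E.
have Lpsi p : LL mu psi p = LLb mu eta (p.1 - x0) * theta p.2.
  rewrite /LL /LLb -mulrA; congr (_ * _).
  transitivity (\int[mu]_z (theta p.2 * ddb eta z (p.1 - x0))).
    apply: eq_Rintegral => z _; rewrite /ddz /psi /ddb /sh/= !addr0.
    by rewrite (addrAC p.1 z) (addrAC p.1 (- z)); ring.
  rewrite RintegralZl// 1?mulrC//.
  have [B B0 h] := @bump_bounds R N eta.
  apply: (@le_Rintegrable _ _ _ _ _ (fun z => B * kap z)).
  - have mp : measurable_fun setT (fun z : X => (p.1 - x0, z)) by exact: measurable_fun_pair.
    exact: (measurableT_comp (measurable_ddb2 eta) mp).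
  - by move=> z; have [] := h z (p.1 - x0).
  - exact: RintegrableZl.
have cdt : continuous (derive1 theta).
  have [_ h] := Ct 1%N; rewrite (_ : derive1 theta = (fun t => 'D_1 theta t)); first exact: h.
  by apply/funext => t; rewrite derive1E.
have ct : continuous theta := Ct 0%N.
have i1 : m.-integrable setT (EFin \o (fun p : Om => u p * (rho (p.1 - x0) * ((0 < p.2 < T)%R%:R * derive1 theta p.2)))).
  apply: (Rintegrable_bounded_mull mu_ uK).
  apply: (@Rintegrable_prodM _ _ _ _ _ _ _ (fun x : X => rho (x - x0)) (fun t : measurableTypeR R => (0 < t < T)%R%:R * derive1 theta t)).
    exact: shift_integrable.
  exact: time_integrable.
have i2 : m.-integrable setT (EFin \o (fun p : Om => w p * (LLb mu eta (p.1 - x0) * ((0 < p.2 < T)%R%:R * theta p.2)))).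
  apply: (Rintegrable_bounded_mull mw wK).
  apply: (@Rintegrable_prodM _ _ _ _ _ _ _ (fun x : X => LLb mu eta (x - x0)) (fun t : measurableTypeR R => (0 < t < T)%R%:R * theta t)).
    exact: shift_integrable.
  exact: time_integrable.
have mr : measurable_fun setT rho by exact: integrable_measurable ir.
rewrite -[RHS](Hd psiT); congr (_ + _).
  have i12 := RintegrableD i1 i2.
  transitivity (\int[m]_p (u p * (rho (p.1 - x0) * ((0 < p.2 < T)%R%:R * derive1 theta p.2)) +
     w p * (LLb mu eta (p.1 - x0) * ((0 < p.2 < T)%R%:R * theta p.2)))); last first.
    by apply: eq_Rintegral => p _; rewrite dpsi Lpsi; ring.
  rewrite -(Rfubini2 i12).2; apply: eq_Rintegral => t _ /=.
  case: (boolP (0 < t < T)) => tT; last first.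
    rewrite mul0r; apply/esym; transitivity (\int[lebX]_x (0 : R)).
      by apply: eq_Rintegral => x _; rewrite !(mul0r, mulr0) addr0.
    by rewrite Rintegral_cst// mul0r.
  have /andP[t0 _] := tT.
  have j1 : lebX.-integrable setT (EFin \o (fun x => rho (x - x0) * u (x, t))).
    have := Rintegrable_bounded_mull (mslicex t mu_) (fun x => uK _) (shift_integrable (- x0) ir).
    by congr (_.-integrable _ _); apply/funext => x /=; rewrite mulrC.
  have j2 : lebX.-integrable setT (EFin \o (fun x => LLb mu eta (x - x0) * w (x, t))).
    have := Rintegrable_bounded_mull (mslicex t mw) (fun x => wK _) (shift_integrable (- x0) iL).
    by congr (_.-integrable _ _); apply/funext => x /=; rewrite mulrC.
  rewrite mul1r /Qj (LL_bump kapi eta0 (x0, t) mw wK) -(shift_slice x0 t mLb mw).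
  have -> : Pj (x0, t) = \int[lebX]_x (rho (x - x0) * u (x, t)).
    rewrite (shift_slice x0 t mr mu_); apply: eq_Rintegral => y _.
    by rewrite /ext /sh/= addr0 t0.
  rewrite mulrC -RintegralZl// [X in _ + X]mulrC -RintegralZl// -RintegralD//; [|exact: RintegrableZl..].
  by apply: eq_Rintegral => x _; rewrite !mul1r; ring.
have -> : Pj (x0, 0) = \int[lebX]_x (rho (x - x0) * u0 x).
  rewrite (shift_slice x0 0 mr (measurableT_comp mu0 measurable_fst)).
  by apply: eq_Rintegral => y _; rewrite /ext /sh/= addr0 ltxx.
rewrite mulrC -RintegralZl//.
  by apply: eq_Rintegral => x _; rewrite /psi/=; ring.
have := Rintegrable_bounded_mull mu0 u0K (shift_integrable (- x0) ir).
by congr (_.-integrable _ _); apply/funext => x /=; rewrite mulrC.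
Qed.

Let QjC : exists C, forall p, `|Qj p| <= C.
Proof.
have [C _ h] := avg_bump_bounds eta0 mw wK.
exists (2^-1 * (C * \int[mu]_z kap z)) => p; apply: LL_le => // z p'.
by have [] := h z p'.
Qed.

Let Qj0 p : ~~ (0 < p.2 < T) -> Qj p = 0.
Proof.
move=> p0; rewrite /Qj (LL_bump kapi eta0 p mw wK).
transitivity (\int[lebX]_y (0 : R)); last by rewrite Rintegral_cst// mul0r.
by apply: eq_Rintegral => y _; rewrite w0 ?mulr0// /sh/= addr0.
Qed.

Lemma slice_equation x0 : {ae leb, forall t, 0 < t < T ->
  Pj (x0, t) = \int[leb]_s (expk l s * (Pj (x0, t + s) + l^-1 * Qj (x0, t + s)))}.
Proof.
have [C hC] := QjC.
have hK t : `|Pj (x0, t)| <= Num.max K C by rewrite le_max PjK.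
have hQ t : `|Qj (x0, t)| <= Num.max K C by rewrite le_max hC orbT.
apply: (ode_ae l0 (mslice x0 mPj) (mslice x0 mQj) hK hQ (p0 := Pj (x0, 0))).
- move=> t t0; apply: eq_Rintegral => y _; rewrite /ext /sh/= !addr0 ltxx.
  by rewrite ltNge t0.
- by move=> t t0; rewrite Qj0//= ltNge t0.
- exact: slice_test.
Qed.

(** The exceptional times of [slice_equation] depend on the point; Tonelli's theorem makes them a
    null set in space-time. The operator commutes with the average in time. *)
Lemma averaged_equation : {ae m, forall p, 0 < p.2 < T ->
  Pj p - avg leb (expk l) jt Pj p = l^-1 * LL mu (avg leb (expk l) jt Fw) p}.
Proof.
have [C _ hC] := avg_bump_bounds eta0 mw wK.
have [C' hC'] := QjC.
pose W p := Pj p + l^-1 * Qj p.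
have mW : measurable_fun setT W by apply: measurable_funD => //; exact: measurable_funM.
pose E p := (0 < p.2 < T)%R%:R * (Pj p - avg leb (expk l) jt W p).
have mI : measurable_fun setT (fun p : Om => (0 < p.2 < T)%R%:R : R).
  have mI : measurable_fun setT (fun t : measurableTypeR R => (0 < t < T)%R%:R : R).
    by apply: (@measurable_predR _ _ `]0, T[%classic) => // t; rewrite /= in_itv.
  exact: measurableT_comp mI measurable_snd.
have mE : measurable_fun setT E.
  by apply: measurable_funM => //; apply: measurable_funB => //; exact: measurable_avg ek _ mW.
have mEa : measurable_fun setT (fun p => `|(E p)%:E|%E).
  by apply: measurableT_comp => //; exact/measurable_EFinP.
have E0 : (\int[m]_p `|(E p)%:E| = 0)%E.
  rewrite /lebesgue_Q fubini_tonelli1//.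
  transitivity (\int[lebX]_x (0 : \bar R))%E; last by rewrite integral0.
  apply: eq_integral => x _; rewrite /fubini_F.
  transitivity (\int[leb]_t (0 : \bar R))%E; last by rewrite integral0.
  apply: ae_eq_integral => //.
    have h : measurable_fun setT (fun t : measurableTypeR R => (x, t)) by exact: measurable_fun_pair.
    exact: (measurableT_comp mEa h).
  have := slice_equation x; apply: filterS; first exact: (ae_filter_ringOfSetsType leb).
  move=> t ht _; rewrite /E; case: (boolP (0 < t < T)) => [/ht ->|_]; last first.
    by rewrite mul0r abse0.
  rewrite mul1r [X in `|X%:E|%E](_ : _ = 0) ?abse0//.
  apply/eqP; rewrite subr_eq0; apply/eqP; apply: eq_Rintegral => s _.
  by rewrite /W /sh/= addr0.
have /(ae_eq_integral_abs m measurableT) : measurable_fun setT (EFin \o E) by exact/measurable_EFinP.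
move=> [+ _] => /(_ E0).
apply: filterS => p /(_ I) [+] pT; rewrite /E pT mul1r => /eqP; rewrite subr_eq0 => /eqP Ep.
rewrite (avg_LL kapi p ek mFw FwK (fun z w => (hC z w).2)) -/Qj.
rewrite [X in X - _]Ep /W.
pose M := Num.max K (l^-1 * C').
rewrite (@avgD _ _ _ _ _ _ _ ek M)//.
- by rewrite (avgZ (C := C') ek)// [X in X - _]addrC addrK.
- by move=> q; rewrite /M le_max PjK.
- exact: measurable_funM.
- move=> q; rewrite normrM ger0_norm ?invr_ge0 ?(ltW l0)// /M le_max.
  by rewrite ler_wpM2l ?orbT// invr_ge0 ltW.
Qed.

End equation.

(** * The energy estimate *)

Section convex_primitive.
Context {R : realType}.
Notation leb := (@lebesgue_measure R).

Lemma convex_primitive (phi : R -> R) : continuous phi ->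
  (forall a b, a <= b -> phi a <= phi b) ->
  exists Phi : R -> R, [/\ measurable_fun setT Phi, Phi 0 = 0 &
    forall r r', phi r * (r' - r) <= Phi r' - Phi r].
Proof.
move=> cphi nd.
(* The primitive of [phi] from 0 is an integral over the whole line against the signed indicator [h]
   of the interval between 0 and [r]. This makes it measurable in [r], and monotonicity of [phi]
   under the integral gives the subgradient inequality. *)
pose h (r s : R) : R := (s < r)%R%:R - (s < 0)%R%:R.
pose F (q : measurableTypeR R * measurableTypeR R) : R := phi q.2 * h q.1 q.2.
have mphi : measurable_fun setT (phi : measurableTypeR R -> R) by exact: continuous_measurable_fun.
have mlt : measurable_fun setT (fun q : measurableTypeR R * measurableTypeR R => (q.2 < q.1)%R%:R : R).
  rewrite (_ : (fun q => _) = \1_[set q : measurableTypeR R * measurableTypeR R | q.2 < q.1]).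
    apply: measurable_indic.
    rewrite (_ : [set q | _] = [set q : measurableTypeR R * measurableTypeR R | 0 < q.1 - q.2]); last first.
      by apply/seteqP; split => q /=; rewrite subr_gt0.
    apply: measurable_gtc; apply: measurable_funB; [exact: measurable_fst|exact: measurable_snd].
  apply/funext => q; rewrite indicE; case: (ltP q.2 q.1) => h0; first by rewrite mem_set.
  by rewrite memNset//=; apply/negP; rewrite -leNgt.
have mlt0 : measurable_fun setT (fun s : measurableTypeR R => (s < 0)%R%:R : R).
  exact: (@measurable_predR _ _ `]-oo, 0[%classic).
have mF : measurable_fun setT F.
  apply: measurable_funM; first exact: measurableT_comp mphi measurable_snd.
  by apply: measurable_funB => //; exact: measurableT_comp mlt0 measurable_snd.
have iF r : leb.-integrable setT (EFin \o (fun s => F (r, s))).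
  pose b := `|r|; have b0 : 0 <= b by exact: normr_ge0.
  pose I : measurableTypeR R -> R := \1_(`[- b, b]%classic).
  pose B := `|phi (- b)| + `|phi b|.
  apply: (@le_Rintegrable _ _ _ leb _ (fun s => B * I s)).
  - have hp : measurable_fun setT (fun s : measurableTypeR R => (r, s) : measurableTypeR R * measurableTypeR R).
      exact: measurable_fun_pair.
    exact: (measurableT_comp mF hp).
  - move=> s; rewrite /F /h /I /= indicE normrM.
    have B0 : 0 <= B by rewrite addr_ge0.
    have [sb|sb] := boolP (- b <= s <= b).
      rewrite mem_set/= ?in_itv//= ler_pM//.
        have /andP[/nd h1 /nd h2] := sb; rewrite /B.
        have := ler_norm (phi b); have := ler_norm (- phi (- b)); rewrite normrN => h3 h4.
        rewrite ler_norml; apply/andP; split.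
          have := normr_ge0 (phi b); lra.
        have := normr_ge0 (phi (- b)); lra.
      by case: (s < r); case: (s < 0); rewrite ?subrr ?normr0 ?sub0r ?normrN ?subr0 ?normr1.
    rewrite memNset/= ?in_itv//=; last exact/negP.
    rewrite mulr0 (_ : `|_ - _| = 0) ?mulr0//.
    have hr : - b <= r <= b by rewrite /b -ler_norml.
    have /andP[r1 r2] := hr.
    have [sn|sn] := ltP s (- b).
      by rewrite (lt_le_trans sn r1) (lt_le_trans sn) ?oppr_le0// subrr normr0.
    move: sb; rewrite sn/= -ltNge => sb.
    by rewrite !ltNge (ltW (le_lt_trans r2 sb)) (ltW (le_lt_trans b0 sb))/= subrr normr0.
  - exact: RintegrableZl (itv_integrable _ _).
pose Phi r := \int[leb]_s F (r, s).
exists Phi; split.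
- exact: (measurable_Rintegral2 leb mF).
- rewrite /Phi; transitivity (\int[leb]_s (0 : R)); last by rewrite Rintegral_cst// mul0r.
  by apply: eq_Rintegral => s _; rewrite /F /h /= subrr mulr0.
have JE r r' : r <= r' -> exists J : measurableTypeR R -> R, [/\
    (fun s => h r' s - h r s) = J, leb.-integrable setT (EFin \o J) & \int[leb]_s J s = r' - r].
  move=> rr; pose J : measurableTypeR R -> R := \1_(`[r, r'[%classic); exists J.
  have mJ : measurable_fun setT J by exact: measurable_indic.
  have lJ : (@lebesgue_measure R `[r, r'[%classic = (r' - r)%:E)%E.
    rewrite lebesgue_measure_itv/= lte_fin.
    by case: ltP => // h'; rewrite (@le_anti _ _ r r') ?rr// subrr.
  have EJ : (\int[leb]_s (J s)%:E = (r' - r)%:E)%E.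
    by rewrite integral_indic ?setIT.
  split; last by rewrite /Rintegral EJ.
    apply/funext => s; rewrite /h /J indicE opprB addrA subrK.
    have [sr|sr] := ltP s r; first by rewrite (lt_le_trans sr rr) subrr memNset//= in_itv/= leNgt sr.
    rewrite subr0; have [sr'|sr'] := ltP s r'; first by rewrite mem_set//= in_itv/= sr.
    by rewrite memNset//= in_itv/= sr ltNge sr'.
  by apply: ge0_RintegrableE => //; rewrite EJ ltry.
have ih r r' c : r <= r' -> leb.-integrable setT (EFin \o (fun s => c * (h r' s - h r s))).
  by move=> /JE[J [E iJ _]]; rewrite (funext (fun s => congr1 _ (congr1 (@^~ s) E))); exact: RintegrableZl.
have key r r' c : r <= r' -> \int[leb]_s (c * (h r' s - h r s)) = c * (r' - r).
  move=> /JE[J [E iJ <-]]; rewrite -RintegralZl//; apply: eq_Rintegral => s _.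
  by rewrite -[h r' s - _]/((fun s => h r' s - h r s) s) E.
have hle r r' s : r <= r' -> 0 <= h r' s - h r s.
  move=> rr; rewrite /h opprB addrA subrK subr_ge0 ler_nat.
  by case: (ltP s r) => // sr; rewrite (lt_le_trans sr rr).
have h0 r r' s : h r' s - h r s != 0 -> r <= r' -> r <= s <= r'.
  rewrite /h opprB addrA subrK => + rr; have [sr|sr] := ltP s r.
    by rewrite (lt_le_trans sr rr) subrr eqxx.
  by have [/ltW ->|] := ltP s r'; rewrite ?andbT// subrr eqxx.
have D r r' : Phi r' - Phi r = \int[leb]_s (phi s * (h r' s - h r s)).
  by rewrite /Phi -RintegralB//; apply: eq_Rintegral => s _; rewrite /F/= -mulrBr.
have iD r r' : leb.-integrable setT (EFin \o (fun s => phi s * (h r' s - h r s))).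
  have := RintegrableB (iF r') (iF r); congr (_.-integrable _ _).
  by apply/funext => s; rewrite /F/= -mulrBr.
move=> r r'; have [rr|/ltW rr] := leP r r'.
  rewrite D -key//; apply: le_Rintegral => //; first exact: ih.
  move=> s _; have [->|/h0/(_ rr)/andP[rs _]] := eqVneq (h r' s - h r s) 0; first by rewrite !mulr0.
  by rewrite ler_wpM2r ?hle ?nd.
rewrite -lerN2 opprB -mulrN opprB D -key//; apply: le_Rintegral => //; first exact: ih.
move=> s _; have [->|/h0/(_ rr)/andP[_ rs]] := eqVneq (h r s - h r' s) 0; first by rewrite !mulr0.
by rewrite ler_wpM2r ?hle ?nd.
Qed.

End convex_primitive.

Lemma mpres_prod1 (R : realType) d1 d2 (T1 : measurableType d1) (T2 : measurableType d2)
    (m1 : {sigma_finite_measure set T1 -> \bar R})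
    (m2 : {sigma_finite_measure set T2 -> \bar R}) (t : T1 -> T1) :
  mpres m1 t -> mpres (m1 \x m2)%E (fun r : T1 * T2 => (t r.1, r.2)).
Proof.
move=> [mt ht]; have mt2 : measurable_fun setT (fun r : T1 * T2 => (t r.1, r.2)).
  apply: measurable_fun_pair; last exact: measurable_snd.
  exact: measurableT_comp mt measurable_fst.
split => // f mf f0.
rewrite fubini_tonelli2//; last exact: measurableT_comp mf mt2.
rewrite fubini_tonelli2//; apply: eq_integral => y _; rewrite /fubini_G/=.
apply: (ht (fun x => f (x, y))) => //.
have h : measurable_fun setT (fun x : T1 => (x, y)) by exact: measurable_fun_pair.
exact: measurableT_comp mf h.
Qed.

(** * Functions that are small up to an integrable part *)

Section vanishing_functions.
Context {R : realType} {N : nat}.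
Notation X := ('rV[R]_N).
Notation Om := ('rV[R]_N * measurableTypeR R)%type.
Notation m := (@lebesgue_Q R N).
Implicit Types f u : Om -> R.

Lemma avg_comm d1 d2 (P1 : measurableType d1) (P2 : measurableType d2)
    (pi1 : {sigma_finite_measure set P1 -> \bar R})
    (pi2 : {sigma_finite_measure set P2 -> \bar R})
    (k1 : P1 -> R) (k2 : P2 -> R) (j1 : P1 -> Om) (j2 : P2 -> Om) (K : R) f w :
  kernel pi1 k1 j1 -> kernel pi2 k2 j2 -> measurable_fun setT f -> (forall w, `|f w| <= K) ->
  avg pi1 k1 j1 (avg pi2 k2 j2 f) w = avg pi2 k2 j2 (avg pi1 k1 j1 f) w.
Proof.
move=> kk1 kk2 mf fK.
have [i1 p1 _ mj1] := kk1; have [i2 p2 _ mj2] := kk2.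
have m1 := integrable_measurable i1; have m2 := integrable_measurable i2.
pose G (r : P1 * P2) := k1 r.1 * (k2 r.2 * f (sh (j1 r.1) (sh (j2 r.2) w))).
have mG : measurable_fun setT G.
  apply: measurable_funM; first exact: measurableT_comp m1 measurable_fst.
  apply: measurable_funM; first exact: measurableT_comp m2 measurable_snd.
  apply: (measurableT_comp mf).
  have h2 : measurable_fun setT (fun r : P1 * P2 => (j2 r.2, w)).
    by apply: measurable_fun_pair => //; exact: measurableT_comp mj2 measurable_snd.
  have h3 : measurable_fun setT (fun r : P1 * P2 => (j1 r.1, sh (j2 r.2) w)).
    apply: measurable_fun_pair; first exact: measurableT_comp mj1 measurable_fst.
    exact: (measurableT_comp (@measurable_sh2 R N) h2).
  exact: (measurableT_comp (@measurable_sh2 R N) h3).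
have iG : (pi1 \x pi2)%E.-integrable setT (EFin \o G).
  apply: (@le_Rintegrable _ _ _ _ _ (fun r : P1 * P2 => K * (k1 r.1 * k2 r.2))) => //.
    move=> r; rewrite /G !normrM (ger0_norm (p1 _)) (ger0_norm (p2 _)) mulrA mulrC.
    by rewrite ler_wpM2r ?mulr_ge0.
  by apply: RintegrableZl; exact: (@Rintegrable_prodM _ _ _ _ _ _ _ k1 k2).
transitivity (\int[pi1]_p \int[pi2]_q G (p, q)).
  apply: eq_Rintegral => p _; rewrite /G/= RintegralZl//; last first.
    have := avg_integrable kk2 w (f := f \o sh (j1 p)) (measurable_sh_comp _ mf) (fun w => fK _).
    by [].
  by congr (_ * _); apply: eq_Rintegral => q _; rewrite shC.
rewrite (Rfubini iG); apply: eq_Rintegral => q _; rewrite /G/=.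
transitivity (\int[pi1]_p (k2 q * (k1 p * f (sh (j1 p) (sh (j2 q) w))))).
  by apply: eq_Rintegral => p _; rewrite mulrCA.
by rewrite RintegralZl//; exact: (avg_integrable kk1 _ mf fK).
Qed.

(** The substitute for integrability of phi(u): domination by a bounded integrable function plus an
    arbitrarily small constant. It is stable under averages because kernels have mass 1. *)
Definition vanishing f := forall e : R, 0 < e -> exists C h,
  [/\ m.-integrable setT (EFin \o h), forall p, 0 <= h p <= C & forall p, `|f p| <= e + h p].

(** Where |f| exceeds e, the integrable part taken for e / 2 exceeds e / 2: Chebyshev. *)
Lemma vanishing_level f (e : R) : measurable_fun setT f -> vanishing f -> 0 < e ->
  (m [set w | (e < `|f w|)%R] < +oo)%E.
Proof.
move=> mf vf e0; have e20 : 0 < e / 2 by rewrite divr_gt0.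
have [C [h [ih hC fh]]] := vf _ e20.
pose S := [set w | (e < `|f w|)%R].
have mS : measurable S by apply: measurable_gtc; exact: measurableT_comp.
have mh := integrable_measurable ih.
have le1 : (\int[m]_w ((e / 2)%:E * (\1_S w)%:E) <= \int[m]_w (h w)%:E)%E.
  apply: ge0_le_integral => //.
  - by move=> w _; rewrite mule_ge0// lee_fin// ltW.
  - apply/measurable_EFinP; apply: measurable_funM => //; exact: measurable_indic.
  - exact/measurable_EFinP.
  - move=> w _; rewrite -EFinM lee_fin indicE; case: (boolP (w \in S)) => Sw.
      have := fh w; move: Sw; rewrite inE /S/= => h1 h2; lra.
    by rewrite mulr0; have /andP[] := hC w.
move: le1; rewrite ge0_integralZl//; last by rewrite lee_fin ltW.
  rewrite integral_indic// setIT => le1.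
  have fin : (\int[m]_w (h w)%:E < +oo)%E.
    by rewrite -EFin_Rintegral// ltry.
  have := le_lt_trans le1 fin; apply: contraTT; rewrite -!leNgt !leye_eq => /eqP Sy.
  rewrite [X in (_ * X)%E](_ : _ = +oo%E); last exact: Sy.
  by rewrite gt0_muley// lte_fin.
by apply/measurable_EFinP; exact: measurable_indic.
Qed.

Lemma vanishing_avg d0 (P : measurableType d0) (pi : {sigma_finite_measure set P -> \bar R})
    (k : P -> R) (j : P -> Om) (K : R) f : kernel pi k j ->
  measurable_fun setT f -> (forall w, `|f w| <= K) -> vanishing f -> vanishing (avg pi k j f).
Proof.
move=> kk mf fK vf e e0; have [C [h [ih hC fh]]] := vf e e0.
have mh := integrable_measurable ih.
have K0 : 0 <= K by apply: le_trans (fK (0, 0)).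
have hC' w : `|h w| <= C by have /andP[h0 h1] := hC w; rewrite ger0_norm.
have C0 : 0 <= C by apply: le_trans (hC' (0, 0)).
have avg0 w : 0 <= avg pi k j h w.
  apply: Rintegral_ge0 => p _; have /andP[h0 _] := hC (sh (j p) w).
  by rewrite mulr_ge0//; have [] := kk.
exists C, (avg pi k j h); split => [|w|w]; first exact: avg_L1.
  by rewrite avg0/=; apply: le_trans (ler_norm _) (avg_bounded kk w mh hC').
apply: le_trans (avg_norm_le kk w mf fK) _.
rewrite -[X in X + _](avg_cst kk e w) -(@avgD _ _ _ _ _ _ _ kk (e + C))//.
- apply: (@avg_le _ _ _ _ _ _ _ kk (K + (e + C))) => //.
  + exact: measurableT_comp.
  + by move=> w'; rewrite normr_id ler_wpDr// addr_ge0// ltW.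
  + exact: measurable_funD.
  + move=> w'; apply: ler_wpDl => //; apply: le_trans (ler_normD _ _) _.
    by rewrite lerD// ger0_norm// ltW.
- by move=> w'; rewrite /cst ger0_norm ?(ltW e0)// lerDl.
- by move=> w'; apply: ler_wpDl => //; exact: ltW.
Qed.

Lemma vanishing_cut f (c : Om -> R) q : measurable_fun setT f -> vanishing f ->
  (forall w, `|c w| <= 1) -> vanishing (fun w => c w * f (sh q w)).
Proof.
move=> mf vf c1 e e0; have [C [h [ih hC fh]]] := vf e e0.
exists C, (fun w => h (sh q w)); split => [|w|w]; [exact: sh_integrable|exact: hC|].
by rewrite normrM; apply: le_trans (fh _); rewrite ler_piMl.
Qed.

(** Where |u| < d, continuity of [phi] at 0 gives the bound [e]; elsewhere K' <= (K' / d) |u|, which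
    is integrable. *)
Lemma vanishing_comp (phi : R -> R) u (K K' : R) : continuous phi -> phi 0 = 0 ->
  m.-integrable setT (EFin \o u) -> (forall w, `|u w| <= K) -> (forall w, `|phi (u w)| <= K') ->
  vanishing (phi \o u).
Proof.
move=> cphi phi0 iu uK wK e e0.
have K0 : 0 <= K by apply: le_trans (uK (0, 0)).
have K'0 : 0 <= K' by apply: le_trans (wK (0, 0)).
have /cvgrPdist_le /(_ e e0) /nbhs_ballP[d /= d0 hd] := cphi 0.
have dn0 : 0 <= K' / d by rewrite divr_ge0// ltW.
exists (K' / d * K), (fun w => K' / d * `|u w|); split.
- by apply: RintegrableZl; exact: integrable_norm.
- by move=> w; rewrite mulr_ge0//= ler_wpM2l.
- move=> w /=; have [ud|ud] := ltP `|u w| d.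
    have := hd (u w); rewrite -ball_normE/= sub0r normrN => /(_ ud).
    rewrite phi0 sub0r normrN => /le_trans; apply; rewrite lerDl.
    by rewrite mulr_ge0.
  apply: ler_wpDl; first exact: ltW.
  apply: le_trans (wK w) _; rewrite -mulrA ler_peMr// mulrC ler_pdivlMr// mul1r.
  exact: ud.
Qed.

End vanishing_functions.

Lemma aeS d (T : measurableType d) (R : realType) (mu : {measure set T -> \bar R})
    (P Q : T -> Prop) : (forall x, P x -> Q x) -> {ae mu, forall x, P x} -> {ae mu, forall x, Q x}.
Proof. by move=> PQ; apply: filterS. Qed.

Section time_cutoff.
Context {R : realType} {N : nat}.
Notation Om := ('rV[R]_N * measurableTypeR R)%type.
Implicit Types (f : Om -> R) (c : R -> R).

Lemma dz_cut c f (q : Om) (z : 'rV[R]_N) (p : Om) :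
  dz z (fun p => c p.2 * f (sh q p)) p = c p.2 * dz z f (sh q p).
Proof. by rewrite /dz (shC q) mulrBr /sh/= addr0. Qed.

Lemma ddz_cut c f (q : Om) (z : 'rV[R]_N) (p : Om) :
  ddz z (fun p => c p.2 * f (sh q p)) p = c p.2 * ddz z f (sh q p).
Proof. rewrite /ddz !(shC q) /sh/= !addr0; ring. Qed.

End time_cutoff.

(** * Energy of a function and of its delayed copy *)

Section energy_step.
Context {R : realType} {N : nat}.
Notation X := ('rV[R]_N).
Notation Om := ('rV[R]_N * measurableTypeR R)%type.
Notation m := (@lebesgue_Q R N).
Variable mu : {sigma_finite_measure set X -> \bar R}.
Notation M := (lebesgue_Q \x mu)%E.
Hypothesis kapi : mu.-integrable setT (EFin \o kap).

Lemma tame_mono (C C' : R) (f : Om -> R) : C <= C' -> tame C f -> tame C' f.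
Proof.
move=> CC' [h1 h2 h3 h4]; split => // [p|z p]; first exact: le_trans (h2 p) CC'.
by apply: le_trans (h3 z p) _; rewrite ler_wpM2r// kap_ge0.
Qed.

(** The copy of [A] delayed by [tau] loses its last piece at the cutoff T, and nothing enters from
    times before 0, where [A] vanishes. After integration this compares the energies of the two. *)
Lemma cut_shift_le (T tau : R) (A : Om -> R) z (p : Om) : (forall p, p.2 <= 0 -> A p = 0) ->
  0 < tau ->
  dz z (fun p => (0 < p.2 < T)%R%:R * A (sh (0, - tau) p)) p ^+ 2 <=
  dz z (fun p => (0 < p.2 < T)%R%:R * A p) (sh (0, - tau) p) ^+ 2.
Proof.
move=> A0 tau0; set q : Om := (0, - tau).
rewrite (dz_cut (fun t => (0 < t < T)%R%:R) A q z p).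
have := dz_cut (fun t => (0 < t < T)%R%:R) A (0, 0) z (sh q p); rewrite sh0 => ->.
rewrite [(sh q p).2]/=.
case: (boolP (0 < p.2 < T)) => [/andP[p0 pT]|_]; last by rewrite mul0r expr0n/= sqr_ge0.
have [pt|pt] := ltP 0 (p.2 - tau); last first.
  rewrite (_ : dz z A (sh q p) = 0); first by rewrite !mulr0.
  by rewrite /dz !A0 ?subrr// /sh/= ?addr0.
by rewrite (lt_trans _ pT)// ltrBlDr ltrDl.
Qed.

Variables (C c : R) (a b : Om -> R) (q : Om).
Hypotheses (ta : tame C a) (tb : tame C b).
Hypothesis dda : forall z p, `|ddz z a p| <= C * kap z.
Hypothesis ba : forall z p, dz z b p ^+ 2 <= dz z a (sh q p) ^+ 2.
Hypotheses (c0 : 0 <= c) (c1 : 0 < 1 - c).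
Variables (K : R) (t G : Om -> R).
Hypotheses (iG : m.-integrable setT (EFin \o G)) (aG : {ae m, forall p, G p = LL mu a p}).
Hypotheses (mt : measurable_fun setT t) (tK : forall p, `|t p| <= K).
Hypothesis abt : forall p, a p - c * b p = (1 - c) * t p.

(* Writing E for the form, E[b,b] <= E[a,a] and Cauchy-Schwarz give
   (1 - c) E[a,a] <= E[a,a] - c E[a,b] = E[a, a - c b] = (1 - c) E[a,t],
   and E[a,t] is minus the integral of t G. *)
Lemma energy_step : M.-integrable setT (EFin \o (fun r => dz r.2 a r.1 ^+ 2)) /\
  \int[M]_r (dz r.2 a r.1 ^+ 2) <= - 2 * \int[m]_p (t p * G p).
Proof.
have [ma aC _ _] := ta; have [mb bC _ _] := tb.
have mLL := measurable_LL mu ma.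
have iL := ae_eq_Rintegrable mLL aG iG.
have ia := form_finite kapi ta dda iL.
have mq := mpres_prod1 mu (mpres_sh q).
have iaq := mpres_integrable mq ia.
have mda : measurable_fun setT (fun r : Om * X => dz r.2 a r.1 ^+ 2).
  by apply: measurable_funX; exact: measurable_dz2.
have ib : M.-integrable setT (EFin \o (fun r => dz r.2 b r.1 ^+ 2)).
  apply: le_Rintegrable iaq; first by apply: measurable_funX; exact: measurable_dz2.
  by move=> r; rewrite ger0_norm ?sqr_ge0//; exact: ba.
have Dba : \int[M]_r (dz r.2 b r.1 ^+ 2) <= \int[M]_r (dz r.2 a r.1 ^+ 2).
  rewrite -(mpres_Rintegral mq mda); apply: le_Rintegral => // r _; exact: ba.
have Iaa := form_identity kapi ta ta dda iL ia ia.
have Iab := form_identity kapi ta tb dda iL ia ib.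
have iab : M.-integrable setT (EFin \o (fun r => dz r.2 a r.1 * dz r.2 b r.1)).
  apply: le_Rintegrable (RintegrableD ia ib); first by apply: measurable_funM; exact: measurable_dz2.
  by move=> r; apply: normM_le_sqr.
have Dab : \int[M]_r (dz r.2 a r.1 * dz r.2 b r.1) <= \int[M]_r (dz r.2 a r.1 ^+ 2).
  have : \int[M]_r (2 * (dz r.2 a r.1 * dz r.2 b r.1)) <=
      \int[M]_r (dz r.2 a r.1 ^+ 2 + dz r.2 b r.1 ^+ 2).
    apply: le_Rintegral => //; [exact: RintegrableZl|exact: RintegrableD|].
    move=> r _; set x := dz _ a _; set y := dz _ b _; have := sqr_ge0 (x - y); nra.
  rewrite RintegralZl// RintegralD//; lra.
split => //; rewrite -(ler_pM2l c1).
apply: (@le_trans _ _ (\int[M]_r (dz r.2 a r.1 ^+ 2) - c * \int[M]_r (dz r.2 a r.1 * dz r.2 b r.1))).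
  by rewrite mulrBl mul1r lerD2l lerN2 ler_wpM2l.
have -> : \int[M]_r (dz r.2 a r.1 ^+ 2) = - 2 * \int[m]_p (a p * LL mu a p).
  by rewrite -Iaa; apply: eq_Rintegral => r _; rewrite expr2.
rewrite Iab (mulrCA c) -mulrBr.
have ja := Rintegrable_bounded_mull ma aC iL.
have jb := Rintegrable_bounded_mull mb bC iL.
rewrite -[c * _]RintegralZl// -RintegralB//; last exact: RintegrableZl.
have itG := Rintegrable_bounded_mull mt tK iG.
rewrite [leRHS]mulrCA -[(1 - c) * _]RintegralZl//.
rewrite le_eqVlt; apply/orP; left; apply/eqP; congr (_ * _).
have mtG := integrable_measurable itG.
apply: ae_eq_Rintegral.
- apply: measurable_funB; first exact: measurable_funM.
  by apply: measurable_funM => //; exact: measurable_funM.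
- exact: measurable_funM.
- by apply: aeS aG => p ->; rewrite [RHS]mulrA -abt mulrBl mulrA.
Qed.

End energy_step.

Lemma avg_texpk (R : realType) (N : nat) (l tau K : R) (F : 'rV[R]_N * measurableTypeR R -> R) p :
  0 < l -> 0 < tau -> measurable_fun setT F -> (forall p, `|F p| <= K) ->
  avg lebesgue_measure (expk l) (@jt R N) F p
    - expR (- (l * tau)) * avg lebesgue_measure (expk l) (@jt R N) F (sh (0, - tau) p) =
  (1 - expR (- (l * tau))) * avg lebesgue_measure (texpk l tau) (@jt R N) F p.
Proof.
move=> l0 tau0 mF FK; set c := expR _; set q := (0, - tau).
have c1 : 0 < 1 - c by rewrite subr_gt0 /c expR_lt1 oppr_lt0 mulr_gt0.
have ek := @kernel_expk R N l l0.
have tk := @kernel_texpk R N l l0 tau tau0.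
have mfs r : measurable_fun setT (fun s : measurableTypeR R => F (sh (jt s) r)).
  exact: (measurable_sh_kernel1 ek r mF).
have [ik _] := expk_integrable l0.
have ikt := mpres_integrable (mpres_lebesgue_shift tau) ik.
have i1 := avg_integrable ek p mF FK.
have i3 : lebesgue_measure.-integrable setT (EFin \o (fun s => expk l (s + tau) * F (sh (jt s) p))).
  have := Rintegrable_bounded_mull (mfs p) (fun s => FK _) ikt.
  by congr (_.-integrable _ _); apply/funext => s /=; rewrite mulrC.
rewrite {2}/avg; have -> : \int[lebesgue_measure]_s (expk l s * F (sh (jt s) (sh q p))) =
    \int[lebesgue_measure]_s (expk l (s + tau) * F (sh (jt s) p)).
  have m3 : measurable_fun setT (fun s : measurableTypeR R => expk l s * F (sh (jt s) (sh q p))).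
    exact: (measurable_funM (@measurable_expk R l) (mfs (sh q p))).
  rewrite -(mpres_Rintegral (mpres_lebesgue_shift tau) m3).
  apply: eq_Rintegral => s _; congr (_ * F _).
  by rewrite /sh /q/= !addr0; congr pair; ring.
rewrite /avg -[c * _]RintegralZl// -RintegralB//; last exact: RintegrableZl.
have i4 := avg_integrable tk p mF FK.
rewrite -RintegralZl//; apply: eq_Rintegral => s _.
by rewrite /texpk -/c; field; rewrite gt_eqF.
Qed.

(** * The averaged function and its energy *)

Section energy_bound.
Context {R : realType} {N : nat}.
Notation X := ('rV[R]_N).
Notation Om := ('rV[R]_N * measurableTypeR R)%type.
Notation m := (@lebesgue_Q R N).
Notation lebX := (lebesgue_rV N).
Notation leb := (@lebesgue_measure R).
Notation jx := (@jx R N).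
Notation jt := (@jt R N).
Variable mu : {sigma_finite_measure set X -> \bar R}.
Notation M := (lebesgue_Q \x mu)%E.
Hypothesis kapi : mu.-integrable setT (EFin \o kap).

Variables (T K : R) (u w : Om -> R) (u0 : X -> R).
Hypotheses (mu_ : measurable_fun setT u) (uK : forall p, `|u p| <= K).
Hypotheses (mw : measurable_fun setT w) (wK : forall p, `|w p| <= K).
Hypotheses (uz : forall p, ~~ (0 < p.2 < T) -> u p = 0).
Hypotheses (wz : forall p, ~~ (0 < p.2 < T) -> w p = 0).
Hypotheses (mu0 : measurable_fun setT u0) (u0K : forall x, `|u0 x| <= K).
Hypotheses (iu : m.-integrable setT (EFin \o u)) (iu0 : lebX.-integrable setT (EFin \o u0)).
Hypothesis (vw : vanishing w).
Hypothesis Hd : forall psi, test_function T psi ->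
  \int[m]_p ((0 < p.2 < T)%R%:R * (u p * dt psi p + w p * LL mu psi p))
  + \int[lebX]_x (u0 x * psi (x, 0)) = 0.

Variables (l : R).
Hypotheses (l0 : 0 < l).

Notation ext := (ext u u0).
Let cut (p : Om) : R := (0 < p.2 < T)%R%:R.
Let ek := @kernel_expk R N l l0.

(** The side l (u - A u) of the resolvent equation, before mollification and restricted to ]0,
    T[. *)
Definition gfun (p : Om) : R := cut p * (l * (ext p - avg leb (expk l) jt ext p)).

Let K0 : 0 <= K. Proof. exact: le_trans (uK (0, 0)). Qed.
Let mext : measurable_fun setT ext. Proof. exact: measurable_ext. Qed.
Let extK p : `|ext p| <= K. Proof. exact: ext_le. Qed.

Let mcut : measurable_fun setT cut.
Proof.
have mI : measurable_fun setT (fun t : measurableTypeR R => (0 < t < T)%R%:R : R).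
  by apply: (@measurable_predR _ _ `]0, T[%classic) => // t; rewrite /= in_itv.
exact: measurableT_comp mI measurable_snd.
Qed.

Let cut01 p : 0 <= cut p <= 1. Proof. by rewrite /cut; case: (0 < _ < _); rewrite ?lexx ?ler01. Qed.
Let cut1 p : `|cut p| <= 1. Proof. by have /andP[? ?] := cut01 p; rewrite ger0_norm. Qed.

Let mgfun : measurable_fun setT gfun.
Proof.
apply: measurable_funM => //; apply: measurable_funM => //; apply: measurable_funB => //.
exact: measurable_avg ek _ mext.
Qed.

Lemma gfun_le p : `|gfun p| <= l * (K + K).
Proof.
rewrite /gfun !normrM (ger0_norm (ltW l0)); apply: (@le_trans _ _ (1 * (l * (K + K)))); last by rewrite mul1r.
apply: ler_pM => //; first by rewrite mulr_ge0// ltW.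
apply: ler_wpM2l; first exact: ltW.
apply: le_trans (ler_normB _ _) _; apply: lerD => //.
exact: (avg_bounded ek p mext extK).
Qed.

(** [ext] need not be integrable over the infinite past, so [u] and the past [f2] are treated apart:
    the average of [f2] is at most |u0| pointwise, and the cutoff confines it to a bounded time
    interval. *)
Lemma gfun_integrable : m.-integrable setT (EFin \o gfun).
Proof.
pose f2 (p : Om) : R := if 0 < p.2 then 0 else u0 p.1.
have mf2 : measurable_fun setT f2.
  apply: measurable_fun_if => //; first by apply: measurable_fun_ltr => //; exact: measurable_snd.
  by apply: measurable_funS (measurableT_comp mu0 measurable_fst).
have f2K p : `|f2 p| <= K by rewrite /f2; case: ifP => _; rewrite ?normr0.
have extE : ext = fun p => u p + f2 p.
  apply/funext => p; rewrite /ext /f2; case: ifPn => p0; first by rewrite addr0.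
  by rewrite uz ?add0r// (negbTE p0).
have f2u0 p : `|avg leb (expk l) jt f2 p| <= `|u0 p.1|.
  have mc : measurable_fun setT (fun q : Om => `|u0 q.1|).
    by apply: measurableT_comp => //; exact: measurableT_comp mu0 measurable_fst.
  have cK (q : Om) : `| `|u0 q.1| | <= K by rewrite normr_id.
  apply: le_trans (avg_norm_le ek p mf2 f2K) _.
  apply: (@le_trans _ _ (avg leb (expk l) jt (fun q => `|u0 q.1|) p)).
    apply: (avg_le ek p _ _ mc cK); first exact: measurableT_comp.
      by move=> q; rewrite normr_id.
    by move=> q; rewrite /f2; case: ifP; rewrite // normr0.
  rewrite -[leRHS](avg_cst ek _ p) le_eqVlt; apply/orP; left; apply/eqP.
  by apply: eq_Rintegral => s _; rewrite /sh/= addr0.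
have i1 : m.-integrable setT (EFin \o (fun p => cut p * `|u0 p.1|)).
  pose I : measurableTypeR R -> R := \1_(`[0, T]%classic).
  apply: (@le_Rintegrable _ _ _ m _ (fun p : Om => `|u0 p.1| * I p.2)).
  - by apply: measurable_funM => //; apply: measurableT_comp => //; exact: measurableT_comp mu0 measurable_fst.
  - move=> p; rewrite normrM normr_id mulrC ler_wpM2l// /cut /I indicE.
    case: (boolP (0 < p.2 < T)) => [/andP[h1 h2]|_]; last by rewrite normr0.
    by rewrite mem_set ?normr1//= in_itv/= !ltW.
  - apply: (@Rintegrable_prodM _ _ _ _ _ _ _ (fun x : X => `|u0 x|) I).
      exact: integrable_norm.
    exact: itv_integrable.
have i2 := integrable_norm (avg_L1 ek iu).
apply: (@le_Rintegrable _ _ _ m _ (fun p => l * (`|u p| + `|avg leb (expk l) jt u p| + cut p * `|u0 p.1|))) => //.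
  move=> p; rewrite /gfun mulrCA normrM (ger0_norm (ltW l0)) ler_wpM2l ?(ltW l0)//.
  rewrite [in leLHS]extE (@avgD _ _ _ _ _ _ _ ek K)// /cut; case: (boolP (0 < p.2 < T)) => pT.
    rewrite !mul1r; have /andP[p0 _] := pT; rewrite {1}/f2 p0 addr0 opprD addrA.
    apply: le_trans (ler_normB _ _) _; apply: lerD; last exact: f2u0.
    exact: ler_normB.
  by rewrite !mul0r normr0 !addr_ge0.
by apply: RintegrableZl; apply: RintegrableD => //; apply: RintegrableD => //; exact: integrable_norm.
Qed.

Variables (eta tau : R).
Hypotheses (eta0 : 0 < eta) (tau0 : 0 < tau).
Notation rho := (@bump R N eta).
Let rk := @kernel_bump R N eta eta0.

Definition Fw := avg lebX rho jx w.
Definition Aw := avg leb (expk l) jt Fw.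
Definition aw (p : Om) : R := cut p * Aw p.

Let mFw : measurable_fun setT Fw. Proof. exact: measurable_avg rk _ mw. Qed.
Let FwK p : `|Fw p| <= K. Proof. exact: (avg_bounded rk p mw wK). Qed.
Let mAw : measurable_fun setT Aw. Proof. exact: measurable_avg ek _ mFw. Qed.
Let AwK p : `|Aw p| <= K. Proof. exact: (avg_bounded ek p mFw FwK). Qed.
Let vAw : vanishing Aw.
Proof. by apply: (vanishing_avg ek mFw FwK); exact: (vanishing_avg rk mw wK). Qed.

Lemma Aw_bounds : exists2 C : R, 0 <= C & forall (z : X) p,
  `|dz z Aw p| ^+ 2 <= C * kap z /\ `|ddz z Aw p| <= C * kap z.
Proof.
have [C C0 h] := avg_bump_bounds eta0 mw wK; exists C => // z p.
have k0 := kap_ge0 z; have Ck := mulr_ge0 C0 k0.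
have mdz : measurable_fun setT (dz z Fw) by exact: measurableT_comp (measurable_dz2 mFw) (measurable_pair2 z).
have mddz : measurable_fun setT (ddz z Fw) by exact: measurableT_comp (measurable_ddz2 mFw) (measurable_pair2 z).
split; last first.
  by rewrite (avg_ddz ek z p mFw FwK); apply: (avg_bounded ek p mddz) => q; have [] := h z q.
rewrite (avg_dz ek z p mFw FwK).
(* The bound on the square passes through the average in the form of its square root. *)
have hs q : `|dz z Fw q| <= Num.sqrt (C * kap z).
  by rewrite -(normr_id (dz z Fw q)) -sqrtr_sqr ler_sqrt// (h z q).1.
rewrite -[leRHS]sqr_sqrtr// ler_sqr// ?nnegrE//.
exact: (avg_bounded ek p mdz hs).
Qed.

Lemma Aw_past p : p.2 <= 0 -> Aw p = 0.
Proof.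
move=> p0; transitivity (\int[leb]_s (0 : R)); last by rewrite Rintegral_cst// mul0r.
apply: eq_Rintegral => s _; rewrite /expk; case: ifPn => s0; last by rewrite mul0r.
rewrite (_ : Fw _ = 0) ?mulr0//; transitivity (\int[lebX]_y (0 : R)); last by rewrite Rintegral_cst// mul0r.
apply: eq_Rintegral => y _; rewrite wz ?mulr0// /sh/= addr0 negb_and -!leNgt.
by apply/orP; left; rewrite -[leRHS]addr0; exact: lerD.
Qed.

Lemma cut_tame (q : Om) : exists2 C, 0 <= C & tame C (fun p => cut p * Aw (sh q p)) /\
  forall z p, `|ddz z (fun p => cut p * Aw (sh q p)) p| <= C * kap z.
Proof.
have [C C0 h] := Aw_bounds; exists (K + C); first exact: addr_ge0.
have mA : measurable_fun setT (fun p => cut p * Aw (sh q p)).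
  exact: (measurable_funM mcut (measurable_sh_comp q mAw)).
split; last first.
  move=> z p; rewrite (ddz_cut (fun t => (0 < t < T)%R%:R) Aw q z p) normrM mulrDl; apply: ler_wpDl; first by rewrite mulr_ge0// kap_ge0.
  apply: le_trans (h z (sh q p)).2; apply: ler_piMl; [exact: normr_ge0|exact: (cut1 p)].
split => //.
- move=> p; rewrite normrM; apply: ler_wpDr => //; apply: le_trans (AwK (sh q p)).
  by rewrite ler_piMl.
- move=> z p; rewrite (dz_cut (fun t => (0 < t < T)%R%:R) Aw q z p) normrM mulrDl exprMn; apply: ler_wpDl; first by rewrite mulr_ge0// kap_ge0.
  apply: le_trans (h z (sh q p)).1; apply: ler_piMl; first exact: sqr_ge0.
  by apply: exprn_ile1; [exact: normr_ge0|exact: (cut1 p)].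
- by move=> e e0; apply: (vanishing_level mA _ e0); exact: (vanishing_cut q mAw vAw cut1).
Qed.

(** The resolvent equation, with the averages in space and time exchanged and multiplied by the
    cutoff, which commutes with spatial operations. *)
Lemma LL_aw : {ae m, forall p, avg lebX rho jx gfun p = LL mu aw p}.
Proof.
have := averaged_equation kapi mu_ uK mw wK wz mu0 u0K Hd eta0 l0.
apply: aeS => p hp.
have -> : LL mu aw p = cut p * LL mu Aw p.
  rewrite /LL [RHS]mulrCA; congr (_ * _); have [C C0 h] := Aw_bounds.
  rewrite -RintegralZl//.
    apply: eq_Rintegral => z _; have := ddz_cut (fun t => (0 < t < T)%R%:R) Aw (0, 0) z p; rewrite sh0/= => <-.
    by rewrite /aw; congr (ddz _ _ _); apply/funext => q; rewrite sh0.
  apply: (@le_Rintegrable _ _ _ _ _ (fun z => C * kap z)).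
  - exact: measurableT_comp (measurable_ddz2 mAw) (measurable_pair1 p).
  - by move=> z; exact: (h z p).2.
  - exact: RintegrableZl.
have mtav := measurable_avg ek mext.
have tavK q := avg_bounded ek q mext extK.
have -> : avg lebX rho jx gfun p = cut p * (l * (avg lebX rho jx ext p - avg lebX rho jx (avg leb (expk l) jt ext) p)).
  transitivity (avg lebX rho jx (fun q => (cut p * l) * (ext q + (-1) * avg leb (expk l) jt ext q)) p).
    have gE q : gfun q = cut q * l * (ext q + -1 * avg leb (expk l) jt ext q).
      by rewrite /gfun mulN1r mulrA.
    apply: eq_Rintegral => y _; rewrite gE (_ : cut (sh (jx y) p) = cut p)//.
    by rewrite /cut /sh/= addr0.
  have mN : measurable_fun setT (fun q => (-1) * avg leb (expk l) jt ext q) by exact: measurable_funM.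
  have NK q : `|(-1) * avg leb (expk l) jt ext q| <= K by rewrite mulN1r normrN.
  rewrite (@avgZ _ _ _ _ _ _ _ rk (K + K)).
  - by rewrite (@avgD _ _ _ _ _ _ _ rk K)// (@avgZ _ _ _ _ _ _ _ rk K)// mulN1r -mulrA.
  - exact: measurable_funD.
  - by move=> q; apply: le_trans (ler_normD _ _) _; exact: lerD.
rewrite (avg_comm p rk ek mext extK) /cut; case: (boolP (0 < p.2 < T)) => pT; last by rewrite !mul0r.
congr (_ * _); rewrite (hp pT) mulrA mulfV ?mul1r//.
by rewrite gt_eqF.
Qed.

Let awE : aw = fun p => cut p * Aw (sh (0, 0) p).
Proof. by apply/funext => p; rewrite sh0. Qed.

Let q : Om := (0, - tau).
Let bw p := cut p * Aw (sh q p).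

Lemma aw_energy : M.-integrable setT (EFin \o (fun r => dz r.2 aw r.1 ^+ 2)) /\
  \int[M]_r (dz r.2 aw r.1 ^+ 2) <=
  - 2 * \int[m]_p (cut p * avg leb (texpk l tau) jt Fw p * avg lebX rho jx gfun p).
Proof.
have [Ca Ca0 [ta]] := cut_tame (0, 0); rewrite -awE in ta *; move=> dda.
have [Cb Cb0 [tb _]] := cut_tame q; rewrite -/bw in tb.
pose C := Ca + Cb.
have {}ta : tame C aw by apply: tame_mono ta; rewrite lerDl.
have {}tb : tame C bw by apply: tame_mono tb; rewrite lerDr.
have {}dda z p : `|ddz z aw p| <= C * kap z.
  apply: le_trans (dda z p) _; apply: ler_wpM2r; first exact: kap_ge0.
  by rewrite /C lerDl.
have [ma aC _ _] := ta.
have ig := avg_L1 rk gfun_integrable.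
have ba z p : dz z bw p ^+ 2 <= dz z aw (sh q p) ^+ 2 := cut_shift_le T z p Aw_past tau0.
pose c := expR (- (l * tau)).
have c0 : 0 <= c by exact: expR_ge0.
have c1 : 0 < 1 - c by rewrite subr_gt0 /c expR_lt1 oppr_lt0 mulr_gt0.
have tk := @kernel_texpk R N l l0 tau tau0.
have E p : aw p - c * bw p = (1 - c) * (cut p * avg leb (texpk l tau) jt Fw p).
  by rewrite /bw mulrCA -mulrBr [RHS]mulrCA; congr (_ * _); exact: avg_texpk mFw FwK.
have mt : measurable_fun setT (fun p => cut p * avg leb (texpk l tau) jt Fw p).
  exact: (measurable_funM mcut (measurable_avg tk mFw)).
have tC p : `|cut p * avg leb (texpk l tau) jt Fw p| <= K.
  rewrite normrM; apply: le_trans (avg_bounded tk p mFw FwK); apply: ler_piMl; [exact: normr_ge0|exact: (cut1 p)].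
exact: (energy_step kapi ta tb dda ba c0 c1 ig LL_aw mt tC E).
Qed.

End energy_bound.

Lemma avg_integral (R : realType) (N : nat) d0 (P : measurableType d0)
    (pi : {sigma_finite_measure set P -> \bar R}) (k : P -> R)
    (j : P -> 'rV[R]_N * measurableTypeR R) (f : 'rV[R]_N * measurableTypeR R -> R) :
  kernel pi k j -> lebesgue_Q.-integrable setT (EFin \o f) ->
  \int[lebesgue_Q]_w avg pi k j f w = \int[lebesgue_Q]_w f w.
Proof.
move=> kk fi; have mf := integrable_measurable fi; have [ik k0 k1 _] := kk.
rewrite /avg (Rfubini (avg_L1_2 kk fi))/=.
transitivity (\int[pi]_p ((\int[lebesgue_Q]_w f w) * k p)).
  apply: eq_Rintegral => p _; rewrite RintegralZl//; last exact: sh_integrable.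
  by rewrite (sh_integral (j p) mf) mulrC.
by rewrite RintegralZl// k1 mulr1.
Qed.

(** * The convexity inequality *)

Section entropy.
Context {R : realType} {N : nat}.
Notation X := ('rV[R]_N).
Notation Om := ('rV[R]_N * measurableTypeR R)%type.
Notation m := (@lebesgue_Q R N).
Notation lebX := (lebesgue_rV N).
Notation leb := (@lebesgue_measure R).
Notation jt := (@jt R N).

Variables (T K l : R) (u : Om -> R) (u0 : X -> R) (phi Phi : R -> R).
Hypotheses (l0 : 0 < l).
Hypotheses (mu_ : measurable_fun setT u) (uK : forall p, `|u p| <= K).
Hypotheses (uz : forall p, ~~ (0 < p.2 < T) -> u p = 0).
Hypotheses (mu0 : measurable_fun setT u0) (u0K : forall x, `|u0 x| <= K).
Hypotheses (iu : m.-integrable setT (EFin \o u)) (iu0 : lebX.-integrable setT (EFin \o u0)).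
Hypotheses (mphi : measurable_fun setT phi) (phi0 : phi 0 = 0).
Hypotheses (phiK : forall r, `|r| <= K -> `|phi r| <= K).
Hypotheses (mPhi : measurable_fun setT Phi) (Phi0 : Phi 0 = 0).
Hypothesis subgrad : forall r r', phi r * (r' - r) <= Phi r' - Phi r.

Let ek := @kernel_expk R N l l0.
Let tav := avg leb (expk l) jt.

Let Phi_ge0 r : 0 <= Phi r.
Proof. by have := subgrad 0 r; rewrite phi0 mul0r Phi0 subr0. Qed.

Let Phi_le r : `|r| <= K -> Phi r <= K * `|r|.
Proof.
move=> rK; have := subgrad r 0; rewrite Phi0 !sub0r mulrN lerN2 => /le_trans; apply.
by apply: le_trans (ler_norm _) _; rewrite normrM ler_wpM2r// phiK.
Qed.

Let K0 : 0 <= K. Proof. exact: le_trans (uK (0, 0)). Qed.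

Let PhiK r : `|r| <= K -> `|Phi r| <= K * K.
Proof. by move=> rK; rewrite ger0_norm//; apply: le_trans (Phi_le rK) _; rewrite ler_wpM2l. Qed.

(** [Phi] of the extended [u] splits into [f1], integrable over space-time, and the contribution
    [f2] of the past, which need not be. *)
Let f1 := Phi \o u.
Let f2 (p : Om) : R := (p.2 <= 0)%R%:R * Phi (u0 p.1).

Let mf1 : measurable_fun setT f1. Proof. exact: measurableT_comp. Qed.

Let mpast : measurable_fun setT (fun p : Om => (p.2 <= 0)%R%:R : R).
Proof.
have mI : measurable_fun setT (fun t : measurableTypeR R => (t <= 0)%R%:R : R).
  exact: (@measurable_predR _ _ `]-oo, 0]%classic).
exact: measurableT_comp mI measurable_snd.
Qed.

Let mf2 : measurable_fun setT f2.
Proof.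
apply: measurable_funM => //; apply: measurableT_comp => //.
exact: measurableT_comp mu0 measurable_fst.
Qed.

Let f1K p : `|f1 p| <= K * K. Proof. exact: PhiK. Qed.
Let f2K p : `|f2 p| <= K * K.
Proof.
rewrite /f2; case: (p.2 <= 0); rewrite ?mul1r ?PhiK// mul0r normr0.
exact: mulr_ge0.
Qed.

Let PhiE p : Phi (ext u u0 p) = f1 p + f2 p.
Proof.
rewrite /ext /f1 /f2 /= leNgt; case: (boolP (0 < p.2)) => p0 /=.
  by rewrite mul0r addr0.
by rewrite mul1r uz ?(negbTE p0)// Phi0 add0r.
Qed.

Let if1 : m.-integrable setT (EFin \o f1).
Proof.
apply: (@le_Rintegrable _ _ _ m _ (fun p => K * `|u p|)) => //.
  by move=> p; rewrite ger0_norm ?Phi_ge0//; exact: Phi_le.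
by apply: RintegrableZl; exact: integrable_norm.
Qed.

Let i02 : lebX.-integrable setT (EFin \o (Phi \o u0)).
Proof.
apply: (@le_Rintegrable _ _ _ lebX _ (fun x => K * `|u0 x|)).
- exact: measurableT_comp.
- by move=> x; rewrite ger0_norm ?Phi_ge0//; exact: Phi_le.
- by apply: RintegrableZl; exact: integrable_norm.
Qed.

Let tav_f2 p : 0 < p.2 -> tav f2 p = Phi (u0 p.1) * expR (- (l * p.2)).
Proof.
move=> p0; rewrite -(expk_tail_integral l0 (ltW p0)).
have mI : measurable_fun setT (fun s : measurableTypeR R => (s <= - p.2)%R%:R : R).
  exact: (@measurable_predR _ _ `]-oo, - p.2]%classic).
rewrite -RintegralZl//; last first.
  have [ik _] := expk_integrable l0.
  have := Rintegrable_bounded_mull mI (M := 1) _ ik.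
  rewrite (_ : (fun s => _ * _) = (fun s => expk l s * (s <= - p.2)%R%:R)); last first.
    by apply/funext => s; rewrite mulrC.
  by apply => s; case: (s <= _); rewrite ?normr1// normr0.
apply: eq_Rintegral => s _; rewrite /f2 /sh/= addr0 lerNr.
have -> : (p.2 + s <= 0)%R = (p.2 <= - s)%R by rewrite -lerBrDr sub0r.
by ring.
Qed.

(** The subgradient inequality at the value [u p], averaged over the past with the probability
    density [expk l]. *)
Let pointwise p : 0 < p.2 < T ->
  phi (u p) * (tav (ext u u0) p - ext u u0 p) <= tav f1 p + tav f2 p - f1 p.
Proof.
move=> pT; have /andP[p0 _] := pT.
have mext : measurable_fun setT (ext u u0) by exact: measurable_ext.
have extK := ext_le uK u0K.
have extp : ext u u0 p = u p by rewrite /ext p0.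
pose F q := phi (u p) * (ext u u0 q + - u p).
pose G q := (f1 q + f2 q) + - Phi (u p).
have uN q : `|cst (- u p) q| <= K by rewrite /cst normrN.
have PN q : `|cst (- Phi (u p)) q| <= K * K + K * K.
  by rewrite /cst normrN ler_wpDr ?mulr_ge0// PhiK.
have mE : measurable_fun setT (fun q => ext u u0 q + - u p) by exact: measurable_funD.
have EK q : `|ext u u0 q + - u p| <= K + K.
  by apply: le_trans (ler_normD _ _) _; rewrite normrN; exact: lerD.
have mF : measurable_fun setT F by exact: measurable_funM.
have m12 : measurable_fun setT (fun q => f1 q + f2 q) by exact: measurable_funD.
have K12 q : `|f1 q + f2 q| <= K * K + K * K.
  by apply: le_trans (ler_normD _ _) _; exact: lerD.
have mG : measurable_fun setT G by exact: measurable_funD.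
have FK q : `|F q| <= 3 * (K * K).
  rewrite normrM (_ : 3 * (K * K) = K * (3 * K)); last by ring.
  apply: ler_pM => //; first exact: phiK.
  by apply: le_trans (EK q) _; have := K0; lra.
have GK q : `|G q| <= 3 * (K * K).
  apply: le_trans (ler_normD _ _) _; rewrite normrN; apply: (@le_trans _ _ ((K * K + K * K) + K * K)).
    by apply: lerD => //; exact: PhiK.
  by lra.
have FG q : F q <= G q.
  by rewrite /F /G -PhiE; exact: subgrad.
have := avg_le ek p mF FK mG GK FG.
have -> : avg leb (expk l) jt F p = phi (u p) * (tav (ext u u0) p - u p).
  rewrite /F (avgZ (C := K + K) ek)// (avgD (C := K) ek)//; last by move=> ?; rewrite normrN.
  by congr (_ * (_ + _)); exact: (avg_cst ek).
have -> : avg leb (expk l) jt G p = (tav f1 p + tav f2 p) - Phi (u p).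
  rewrite /G (avgD (C := K * K + K * K) ek)// ?(avgD (C := K * K) ek)//; last first.
    by move=> ?; rewrite normrN ler_wpDr ?mulr_ge0// PhiK.
  by congr (_ + _); exact: (avg_cst ek).
by rewrite extp.
Qed.

(** Averaging preserves the integral of [f1], so its two terms cancel over the whole space-time; the
    part added outside ]0, T[ is nonnegative. The past contributes l e^(- l t) Phi (u0 x), whose
    integral in time is Phi (u0 x): the bound is independent of [l]. *)
Lemma entropy_bound : - (\int[m]_p (phi (u p) * gfun T u u0 l p)) <= \int[lebX]_x Phi (u0 x).
Proof.
have mphiu : measurable_fun setT (fun p => phi (u p)) by exact: measurableT_comp.
have ig := @gfun_integrable R N T K u u0 mu_ uK uz mu0 u0K iu iu0 l l0.
have ipg := Rintegrable_bounded_mull mphiu (fun p => phiK (uK p)) ig.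
have [ik hk] := expk_integrable l0.
have iko := mpres_integrable mpres_lebesgue_opp ik.
have iT := avg_L1 ek if1.
have i3 : m.-integrable setT (EFin \o (fun p : Om => Phi (u0 p.1) * expk l (- p.2))).
  by apply: (@Rintegrable_prodM _ _ _ _ _ _ _ (Phi \o u0) (fun t : measurableTypeR R => expk l (- t))).
have i4 := RintegrableB iT if1.
rewrite -mulN1r -RintegralZl//.
apply: (@le_trans _ _ (\int[m]_p (l * (avg leb (expk l) jt f1 p - f1 p) + Phi (u0 p.1) * expk l (- p.2)))).
  apply: le_Rintegral => //; [exact: RintegrableZl|by apply: RintegrableD => //; exact: RintegrableZl|].
  move=> p _; rewrite /gfun mulN1r.
  have f10 q : 0 <= f1 q by exact: Phi_ge0.
  have tav0 : 0 <= tav f1 p by apply: Rintegral_ge0 => s _; rewrite mulr_ge0// expk_ge0.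
  case: (boolP (0 < p.2 < T)) => pT.
    have /andP[p0 _] := pT; have h := pointwise pT; rewrite (tav_f2 p0) in h.
    rewrite mul1r mulrCA -mulrN -mulrN opprB.
    have -> : expk l (- p.2) = l * expR (- (l * p.2)) by rewrite /expk oppr_le0 (ltW p0) mulrN.
    rewrite [X in _ <= _ + X]mulrCA -mulrDr ler_wpM2l ?(ltW l0)//.
    by apply: le_trans h _; rewrite addrAC.
  have -> : f1 p = 0 by rewrite /f1/= uz.
  rewrite mul0r mulr0 oppr0 addr0; apply: addr_ge0; apply: mulr_ge0; rewrite ?expk_ge0//.
  exact: ltW.
rewrite RintegralD//; last exact: RintegrableZl.
rewrite RintegralZl// RintegralB// (avg_integral ek if1) subrr mulr0 add0r.
have [_ <-] := Rfubini1 i3.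
rewrite le_eqVlt; apply/orP; left; apply/eqP; apply: eq_Rintegral => x _ /=.
rewrite RintegralZl// (mpres_Rintegral mpres_lebesgue_opp (@measurable_expk R l)) hk.
by rewrite mulr1.
Qed.

End entropy.

(** * Energy bound uniform in the parameters *)

Section uniform_bound.
Context {R : realType} {N : nat}.
Notation X := ('rV[R]_N).
Notation Om := ('rV[R]_N * measurableTypeR R)%type.
Notation m := (@lebesgue_Q R N).
Notation lebX := (lebesgue_rV N).
Notation leb := (@lebesgue_measure R).
Variable mu : {sigma_finite_measure set X -> \bar R}.
Notation M := (lebesgue_Q \x mu)%E.
Hypothesis kapi : mu.-integrable setT (EFin \o kap).

Variables (T K : R) (u : Om -> R) (u0 : X -> R) (phi Phi : R -> R).
Hypotheses (mu_ : measurable_fun setT u) (uK : forall p, `|u p| <= K).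
Hypotheses (uz : forall p, ~~ (0 < p.2 < T) -> u p = 0).
Hypotheses (mu0 : measurable_fun setT u0) (u0K : forall x, `|u0 x| <= K).
Hypotheses (iu : m.-integrable setT (EFin \o u)) (iu0 : lebX.-integrable setT (EFin \o u0)).
Hypotheses (cphi : continuous phi) (phi0 : phi 0 = 0).
Hypotheses (phiK : forall r, `|r| <= K -> `|phi r| <= K).
Hypotheses (mPhi : measurable_fun setT Phi) (Phi0 : Phi 0 = 0).
Hypothesis subgrad : forall r r', phi r * (r' - r) <= Phi r' - Phi r.
Let w : Om -> R := phi \o u.
Hypothesis Hd : forall psi, test_function T psi ->
  \int[m]_p ((0 < p.2 < T)%R%:R * (u p * dt psi p + w p * LL mu psi p))
  + \int[lebX]_x (u0 x * psi (x, 0)) = 0.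

Let mw : measurable_fun setT w.
Proof. by apply: measurableT_comp => //; exact: continuous_measurable_fun. Qed.
Let wK p : `|w p| <= K. Proof. by apply: phiK; exact: uK. Qed.
Let wz p : ~~ (0 < p.2 < T) -> w p = 0.
Proof. by move=> pT; rewrite /w/= uz. Qed.
Let vw : vanishing w.
Proof. exact: (vanishing_comp cphi phi0 iu uK wK). Qed.

(** [eta] is both the width of the mollifier and the time step; as it is at most d1 and d2, the
    tails vanish. Three errors of at most 1 / 6 remain, and the factor 2 of [aw_energy] makes their
    sum 1. *)
Lemma energy_uniform (l delta : R) : 0 < l -> 0 < delta -> exists2 eta : R, 0 < eta <= delta &
  M.-integrable setT (EFin \o (fun r => dz r.2 (aw T w l eta) r.1 ^+ 2)) /\
  \int[M]_r (dz r.2 (aw T w l eta) r.1 ^+ 2) <= 2 * (\int[lebX]_x Phi (u0 x)) + 1.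
Proof.
move=> l0 de0.
pose g := gfun T u u0 l.
have ig : m.-integrable setT (EFin \o g) by exact: (gfun_integrable mu_ uK uz mu0 u0K iu iu0 l0).
have mg := integrable_measurable ig.
have gK := gfun_le T mu_ uK mu0 u0K l0.
have K0 : 0 <= K by apply: le_trans (uK (0, 0)).
(* K times this number is at most 1 / 6, also for K = 0. *)
have e10 : 0 < 1 / (6 * (K + 1)) :> R by rewrite divr_gt0// mulr_gt0// ltr_wpDl.
have e20 : 0 < 1 / 6 :> R by rewrite divr_gt0.
have [d1 d10 h1] := avg_L1_approx gK ig e10.
have [d2 d20 h2] := avg_weak_approx K ig e20.
pose eta := Num.min delta (Num.min d1 d2).
have eta0 : 0 < eta by rewrite !lt_min de0 d10.
have ed1 : eta <= d1 by rewrite !ge_min lexx !orbT.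
have ed2 : eta <= d2 by rewrite !ge_min lexx !orbT.
exists eta; first by rewrite eta0 ge_min lexx.
have [ia ha] := aw_energy kapi mu_ uK mw wK uz wz mu0 u0K iu iu0 vw Hd l0 eta0 eta0.
split => //; apply: le_trans ha _.
have rk := @kernel_bump R N eta eta0.
have tk := @kernel_texpk R N l l0 eta eta0.
have t1 : tail lebX (bump eta) (@jx R N) d1 <= d1 by rewrite (tail_bump eta0 ed1) ltW.
have t2 : tail lebX (bump eta) (@jx R N) d2 <= d2 by rewrite (tail_bump eta0 ed2) ltW.
have t3 : tail leb (texpk l eta) (@jt R N) d2 <= d2 by rewrite (tail_texpk _ eta0 ed2) ltW.
pose F := Fw w eta.
have mF : measurable_fun setT F by exact: (measurable_avg rk mw).
have FK p : `|F p| <= K by exact: (avg_bounded rk p mw wK).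
pose t := avg leb (texpk l eta) (@jt R N) F.
have mt : measurable_fun setT t by exact: (measurable_avg tk mF).
have tK p : `|t p| <= K by exact: (avg_bounded tk p mF FK).
have a1 : \int[m]_p `|avg lebX (bump eta) (@jx R N) g p - g p| <= 1 / (6 * (K + 1)) by exact: h1 rk t1.
have a2 : `|\int[m]_p ((F p - w p) * g p)| <= 1 / 6 by exact: h2 rk t2 _ mw wK.
have a3 : `|\int[m]_p ((t p - F p) * g p)| <= 1 / 6 by exact: h2 tk t3 _ mF FK.
have := entropy_bound l0 mu_ uK uz mu0 u0K iu iu0 (continuous_measurable_fun cphi) phi0 phiK mPhi Phi0 subgrad.
rewrite -/g; set P := \int[lebX]_x Phi (u0 x) => ent.
pose cut (p : Om) : R := (0 < p.2 < T)%R%:R.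
pose rg := avg lebX (bump eta) (@jx R N) g.
have irg : m.-integrable setT (EFin \o rg) by exact: (avg_L1 rk ig).
have mcut : measurable_fun setT cut.
  have mI : measurable_fun setT (fun t : measurableTypeR R => (0 < t < T)%R%:R : R).
    by apply: (@measurable_predR _ _ `]0, T[%classic) => // s; rewrite /= in_itv.
  exact: measurableT_comp mI measurable_snd.
have mct : measurable_fun setT (fun p => cut p * t p) by exact: measurable_funM.
have ctK p : `|cut p * t p| <= K.
  rewrite normrM; apply: le_trans (tK p); apply: ler_piMl => //.
  by rewrite /cut; case: (0 < _ < _); rewrite ?normr1// normr0.
have idg := RintegrableB irg ig.
have j1 := Rintegrable_bounded_mull mct ctK idg.
have mtF : measurable_fun setT (fun p => t p - F p) by exact: measurable_funB.
have mFw' : measurable_fun setT (fun p => F p - w p) by exact: measurable_funB.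
have tFK p : `|t p - F p| <= K + K by apply: le_trans (ler_normB _ _) _; exact: lerD.
have FwK' p : `|F p - w p| <= K + K by apply: le_trans (ler_normB _ _) _; exact: lerD.
have j2 := Rintegrable_bounded_mull mtF tFK ig.
have j3 := Rintegrable_bounded_mull mFw' FwK' ig.
have j4 := Rintegrable_bounded_mull mw wK ig.
(* The errors of mollifying [g], of averaging over the short past and of mollifying [w]; the
   convexity inequality controls the last term. *)
have E : \int[m]_p (cut p * t p * rg p) = \int[m]_p (cut p * t p * (rg p - g p)) +
    \int[m]_p ((t p - F p) * g p) + \int[m]_p ((F p - w p) * g p) + \int[m]_p (w p * g p).
  rewrite -RintegralD// -RintegralD//; last exact: RintegrableD.
  rewrite -RintegralD//; last by apply: RintegrableD => //; exact: RintegrableD.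
  apply: eq_Rintegral => p _; have gE : g p = cut p * g p.
    by rewrite /g /gfun /cut; case: (0 < _ < _); rewrite ?mul1r// !mul0r.
  have tgE : t p * g p = cut p * t p * g p by rewrite [in LHS]gE; ring.
  transitivity (cut p * t p * (rg p - g p) + t p * g p); first by rewrite tgE; ring.
  by ring.
have a4 : `|\int[m]_p (cut p * t p * (rg p - g p))| <= 1 / 6.
  apply: le_trans (le_normr_Rintegral _ _) _ => //.
  apply: (@le_trans _ _ (K * \int[m]_p `|rg p - g p|)).
    rewrite -RintegralZl//; last exact: integrable_norm.
    apply: le_Rintegral => //; [exact: integrable_norm|by apply: RintegrableZl; exact: integrable_norm|].
    by move=> p _; rewrite normrM ler_wpM2r.
  apply: (@le_trans _ _ (K * (1 / (6 * (K + 1))))); first by rewrite ler_wpM2l.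
  have K1 : 0 < K + 1 by rewrite ltr_wpDl.
  rewrite mulrA mulr1 invfM mulrA mulrAC ler_wpM2r ?invr_ge0//.
  by rewrite ler_pdivrMr// mul1r lerDl.
rewrite -/g -/rg -/F -/t E.
move: a2 a3 a4 ent; rewrite !ler_norml.
move=> /andP[b1 b2] /andP[b3 b4] /andP[b5 b6] ent; lra.
Qed.

End uniform_bound.

(** * Passage to the limit in the averages *)

Section finite_energy.
Context {R : realType} {N : nat}.
Notation X := ('rV[R]_N).
Notation Om := ('rV[R]_N * measurableTypeR R)%type.
Notation m := (@lebesgue_Q R N).
Notation lebX := (lebesgue_rV N).
Notation leb := (@lebesgue_measure R).
Variable mu : {sigma_finite_measure set X -> \bar R}.
Notation M := (lebesgue_Q \x mu)%E.
Hypothesis kapi : mu.-integrable setT (EFin \o kap).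

Section double_average.
Variable eta : nat -> R.
Hypothesis eta_n : forall n, 0 < eta n <= n.+1%:R^-1.

Definition avg2 n (f : Om -> R) : Om -> R :=
  avg leb (expk n.+1%:R) (@jt R N) (avg lebX (bump (eta n)) (@jx R N) f).

Let eta0 n : 0 < eta n. Proof. by have /andP[] := eta_n n. Qed.
Let ek n := @kernel_expk R N n.+1%:R (ltr0Sn R n).
Let rk n := @kernel_bump R N (eta n) (eta0 n).

Lemma measurable_avg2 n (f : Om -> R) : measurable_fun setT f -> measurable_fun setT (avg2 n f).
Proof. by move=> mf; exact: (measurable_avg (ek n) (measurable_avg (rk n) mf)). Qed.

Lemma avg2_le K n (f : Om -> R) p : measurable_fun setT f -> (forall p, `|f p| <= K) -> `|avg2 n f p| <= K.
Proof.
move=> mf fK; apply: (avg_bounded (ek n) p (measurable_avg (rk n) mf)) => q.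
exact: (avg_bounded (rk n) q mf fK).
Qed.

(** The function averaged in time changes with [n], which the uniformity of [avg_weak_approx]
    allows. *)
Lemma avg2_weak K (f Psi : Om -> R) : measurable_fun setT f -> (forall p, `|f p| <= K) ->
  m.-integrable setT (EFin \o Psi) ->
  (fun n => \int[m]_p (avg2 n f p * Psi p)) @ \oo --> \int[m]_p (f p * Psi p).
Proof.
move=> mf fK iP; apply/cvgrPdist_le => e e0.
have e20 : 0 < e / 2 by rewrite divr_gt0.
have [d d0 h] := avg_weak_approx K iP e20.
near=> n.
have nd : n.+1%:R^-1 <= d by apply: ltW; near: n; exact: (near_infty_natSinv_lt (PosNum d0)).
(* The exponential kernel of rate n + 1 has tail at most 1 / ((n + 1) d), which is at most [d] once
   1 / (n + 1) <= d^2. *)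
have nd2 : n.+1%:R^-1 <= d * d by apply: ltW; near: n; exact: (near_infty_natSinv_lt (PosNum (mulr_gt0 d0 d0))).
have t1 : tail lebX (bump (eta n)) (@jx R N) d <= d.
  have /andP[_ h'] := eta_n n.
  by rewrite (tail_bump (eta0 n) (le_trans h' nd)) ltW.
have t2 : tail leb (expk n.+1%:R) (@jt R N) d <= d.
  apply: le_trans (@tail_expk R N _ (ltr0Sn R n) d d0) _.
  by rewrite invfM ler_pdivrMr.
have mf1 := measurable_avg (rk n) mf.
have f1K q := avg_bounded (rk n) q mf fK.
have a1 := h _ _ _ _ _ (rk n) t1 f mf fK.
have a2 := h _ _ _ _ _ (ek n) t2 _ mf1 f1K.
have i0 := Rintegrable_bounded_mull mf fK iP.
have i1 := Rintegrable_bounded_mull mf1 f1K iP.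
have i2 := Rintegrable_bounded_mull (measurable_avg2 n mf) (fun p => avg2_le n p mf fK) iP.
rewrite distrC.
have -> : \int[m]_p (avg2 n f p * Psi p) - \int[m]_p (f p * Psi p) =
    \int[m]_p ((avg2 n f p - avg lebX (bump (eta n)) (@jx R N) f p) * Psi p) +
    \int[m]_p ((avg lebX (bump (eta n)) (@jx R N) f p - f p) * Psi p).
  under [X in _ = X + _]eq_Rintegral do rewrite mulrBl.
  under [X in _ = _ + X]eq_Rintegral do rewrite mulrBl.
  by rewrite !RintegralB// addrA subrK.
by apply: le_trans (ler_normD _ _) _; rewrite (splitr e); apply: lerD.
Unshelve. all: by end_near. Qed.

End double_average.

Lemma kap_eq0 (z : X) : kap z = 0 -> z = 0.
Proof.
move=> k0; apply: euclidean_norm_eq0; apply/eqP; rewrite -sqrf_eq0.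
have [h|h] := leP (euclidean_norm z) 1; first by rewrite -(kap_small h) k0.
by move: k0; rewrite (kap_large h) => /eqP; rewrite oner_eq0.
Qed.

Section limit.
Variables (T K C0 : R) (w : Om -> R) (eta : nat -> R).
Hypothesis eta_n : forall n, 0 < eta n <= n.+1%:R^-1.
Hypotheses (mw : measurable_fun setT w) (wK : forall p, `|w p| <= K).
Hypotheses (wz : forall p, ~~ (0 < p.2 < T) -> w p = 0).
Variable a : nat -> Om -> R.
Hypotheses (ma : forall n, measurable_fun setT (a n)).
Hypothesis aE : forall n z p, dz z (a n) p = (0 < p.2 < T)%R%:R * avg2 eta n (dz z w) p.
Hypothesis ia : forall n, M.-integrable setT (EFin \o (fun r => dz r.2 (a n) r.1 ^+ 2)).
Hypothesis aC : forall n, \int[M]_r (dz r.2 (a n) r.1 ^+ 2) <= C0.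

Let K0 : 0 <= K. Proof. exact: le_trans (wK (0, 0)). Qed.
Let mdz z : measurable_fun setT (dz z w).
Proof. exact: measurableT_comp (measurable_dz2 mw) (measurable_pair2 z). Qed.
Let dzK z p : `|dz z w p| <= K + K.
Proof. by apply: le_trans (ler_normB _ _) _; exact: lerD. Qed.
Let dz_cut0 z p : (0 < p.2 < T)%R%:R * dz z w p = dz z w p.
Proof.
case: (boolP (0 < p.2 < T)) => pT; first by rewrite mul1r.
by rewrite mul0r /dz !wz ?subrr// /sh/= addr0.
Qed.

Section truncation.
Variables (B : set Om) (Z : set X).
Hypotheses (mB : measurable B) (Boo : (m B < +oo)%E) (mZ : measurable Z).
Hypothesis iZ : mu.-integrable setT (EFin \o (\1_Z : X -> R)).

Let iB := Rintegrable_indic mB Boo.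

Let S (r : Om * X) : R := \1_B r.1 * \1_Z r.2.

Let mS : measurable_fun setT S.
Proof.
apply: measurable_funM.
- exact: measurableT_comp (measurable_ind mB) measurable_fst.
- exact: measurableT_comp (measurable_indic mZ) measurable_snd.
Qed.

Let iS : M.-integrable setT (EFin \o S).
Proof. exact: (@Rintegrable_prodM _ _ _ _ _ _ _ (\1_B : Om -> R) (\1_Z : X -> R)). Qed.

Let S01 r : 0 <= S r <= 1.
Proof. by rewrite /S mulr_ge0//= mulr_ile1// indicE lern1 leq_b1. Qed.

Let mdw : measurable_fun setT (fun r : Om * X => dz r.2 w r.1). Proof. exact: measurable_dz2. Qed.
Let mda n : measurable_fun setT (fun r : Om * X => dz r.2 (a n) r.1). Proof. exact: measurable_dz2. Qed.

Let iww : M.-integrable setT (EFin \o (fun r => dz r.2 w r.1 ^+ 2 * S r)).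
Proof.
apply: (Rintegrable_bounded_mull (M := (K + K) ^+ 2)) => //; first exact: measurable_funX.
by move=> r; rewrite normrX lerXn2r// ?nnegrE// addr_ge0.
Qed.

Let avgdzK n z p : `|avg2 eta n (dz z w) p| <= K + K.
Proof. exact: (avg2_le eta_n n p (mdz z) (dzK z)). Qed.

Let iaw n : M.-integrable setT (EFin \o (fun r => (dz r.2 (a n) r.1 * dz r.2 w r.1) * S r)).
Proof.
apply: (Rintegrable_bounded_mull (M := (K + K) * (K + K))) => //; first exact: measurable_funM.
move=> r; rewrite normrM ler_pM// aE normrM.
apply: le_trans (avgdzK n r.2 r.1); apply: ler_piMl => //.
by case: (0 < _ < _); rewrite ?normr1// normr0.
Qed.

(* Weak convergence of dz (a n) and 2 x y - y ^ 2 <= x ^ 2. *)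
Lemma truncated_energy : M.-integrable setT (EFin \o (fun r => dz r.2 w r.1 ^+ 2 * S r)) /\
  \int[M]_r (dz r.2 w r.1 ^+ 2 * S r) <= C0.
Proof.
split => //.
(* For each [z] the convergence is weak in space-time; the indicators of [B] and [Z] give a bound
   integrable in [z], and dominated convergence in [z] concludes. *)
have Cv : (fun n => \int[M]_r ((dz r.2 (a n) r.1 * dz r.2 w r.1) * S r)) @ \oo -->
    \int[M]_r (dz r.2 w r.1 ^+ 2 * S r).
  rewrite -(Rfubini2 iww).2.
  under eq_fun do rewrite -(Rfubini2 (iaw _)).2.
  have [] := @Rdct _ _ _ mu (fun n z => \int[m]_p ((dz z (a n) p * dz z w p) * S (p, z)))
    (fun z => \int[m]_p (dz z w p ^+ 2 * S (p, z)))
    (fun z => ((K + K) * (K + K) * \int[m]_p (\1_B p)) * \1_Z z) => //.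
  - by move=> n; exact: integrable_measurable (Rfubini2 (iaw n)).1.
  - exact: integrable_measurable (Rfubini2 iww).1.
  - move=> z; have iP : m.-integrable setT (EFin \o (fun p => dz z w p * S (p, z))).
      apply: (Rintegrable_bounded_mull (mdz z) (dzK z)).
      have := RintegrableZl (\1_Z z) iB; congr (_.-integrable _ _).
      by apply/funext => p; rewrite /S/= mulrC.
    have := avg2_weak eta_n (mdz z) (dzK z) iP.
    rewrite (_ : (fun n => _) = (fun n => \int[m]_p ((dz z (a n) p * dz z w p) * S (p, z)))); last first.
      apply/funext => n; apply: eq_Rintegral => p _; rewrite aE -[in LHS]dz_cut0.
      by ring.
    rewrite (_ : \int[m]_p _ = \int[m]_p (dz z w p ^+ 2 * S (p, z)))//.
    by apply: eq_Rintegral => p _; ring.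
  - exact: RintegrableZl.
  - move=> n z; have mSz : measurable_fun setT (fun p => S (p, z)).
      exact: measurableT_comp mS (measurable_pair2 z).
    have iSz : m.-integrable setT (EFin \o (fun p => S (p, z))).
      have := RintegrableZl (\1_Z z) iB; congr (_.-integrable _ _).
      by apply/funext => p; rewrite /S/= mulrC.
    have bd p : `|dz z (a n) p * dz z w p| <= (K + K) * (K + K).
      rewrite normrM ler_pM// aE normrM.
      apply: le_trans (avgdzK n z p); apply: ler_piMl => //.
      by case: (0 < _ < _); rewrite ?normr1// normr0.
    have mdz2 : measurable_fun setT (fun p => dz z (a n) p * dz z w p).
      by apply: measurable_funM => //; exact: measurableT_comp (mda n) (measurable_pair2 z).
    have isz := Rintegrable_bounded_mull mdz2 bd iSz.
    apply: le_trans (le_normr_Rintegral _ _) _ => //.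
    have -> : (K + K) * (K + K) * (\int[m]_p \1_B p) * \1_Z z =
        \int[m]_p ((K + K) * (K + K) * S (p, z)).
      rewrite RintegralZl// -mulrA; congr (_ * _).
      by rewrite mulrC -RintegralZl//; apply: eq_Rintegral => p _; rewrite /S mulrC.
    apply: le_Rintegral => //; [exact: integrable_norm|exact: RintegrableZl|].
    move=> p _; rewrite normrM; have /andP[s0 _] := S01 (p, z).
    by rewrite (ger0_norm s0) ler_wpM2r.
set L := \int[M]_r (dz r.2 w r.1 ^+ 2 * S r) in Cv *.
have hn n : \int[M]_r ((dz r.2 (a n) r.1 * dz r.2 w r.1) * S r) <= 2^-1 * C0 + 2^-1 * L.
  apply: (@le_trans _ _ (\int[M]_r (2^-1 * dz r.2 (a n) r.1 ^+ 2 + 2^-1 * (dz r.2 w r.1 ^+ 2 * S r)))).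
    apply: le_Rintegral => //; first by apply: RintegrableD; exact: RintegrableZl.
    move=> r _; have := S01 r; set x := dz _ (a n) _; set y := dz _ w _; set s := S r.
    move=> /andP[s0 s1]; have := sqr_ge0 (x - y); have := sqr_ge0 x; nra.
  rewrite RintegralD//; [|exact: RintegrableZl|exact: RintegrableZl].
  rewrite !RintegralZl// lerD2r ler_wpM2l//.
(* The truncation makes the integral [L] finite, so that half of it can be absorbed on the left. *)
have LC : L <= 2^-1 * C0 + 2^-1 * L.
  rewrite -[X in X <= _](cvg_lim (@Rhausdorff R) Cv); apply: limr_le; last exact: nearW.
  by apply/cvg_ex; exists L.
lra.
Qed.

End truncation.

(** The truncation sets exhaust everything but z = 0, where the difference vanishes; Fatou's lemma
    concludes, as [C0] does not depend on them. *)
Lemma limit_energy : M.-integrable setT (EFin \o (fun r => dz r.2 w r.1 ^+ 2)).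
Proof.
pose B n : set Om := [set p | close n%:R p].
pose Z n := [set z : X | n.+1%:R^-1 <= kap z].
have mB n : measurable (B n) by exact: measurable_close.
have Boo n : (m (B n) < +oo)%E.
  apply: le_lt_trans (@lebesgue_Q_ball R N n%:R).
  rewrite le_measure ?inE//; first by apply: open_measurable_prod; exact: ball_open.
  move=> p /andP[h1 h2]; split; first by rewrite -ball_normE/= sub0r normrN.
  by rewrite -ball_normE/= sub0r normrN.
have mZ n : measurable (Z n) by apply: measurable_gec; exact: measurable_kap.
have iZ n : mu.-integrable setT (EFin \o (\1_(Z n) : X -> R)).
  apply: (@le_Rintegrable _ _ _ mu _ (fun z => n.+1%:R * kap z)).
  - exact: measurable_indic.
  - move=> z; rewrite indicE; case: (boolP (z \in Z n)); rewrite ?inE => h.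
      by rewrite normr1 -ler_pdivrMl// mulr1.
    by rewrite normr0 mulr_ge0// kap_ge0.
  - exact: RintegrableZl.
have mdw : measurable_fun setT (fun r : Om * X => dz r.2 w r.1 ^+ 2).
  by apply: measurable_funX; exact: measurable_dz2.
apply: ge0_RintegrableE => // [r|]; first exact: sqr_ge0.
apply: (@le_lt_trans _ _ C0%:E); last exact: ltry.
pose S n (r : Om * X) : R := \1_(B n) r.1 * \1_(Z n) r.2.
apply: (@fatou_bound _ _ _ _ (fun n r => dz r.2 w r.1 ^+ 2 * S n r)).
- move=> n; apply: measurable_funM => //; apply: measurable_funM.
    exact: measurableT_comp (measurable_ind (mB n)) measurable_fst.
  exact: measurableT_comp (measurable_indic (mZ n)) measurable_snd.
- by move=> n r; rewrite mulr_ge0 ?sqr_ge0// mulr_ge0.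
- move=> r; have [z0|z0] := eqVneq r.2 0.
    have -> : dz r.2 w r.1 = 0 by rewrite z0 /dz sh0 subrr.
    by rewrite expr0n/=; under eq_fun do rewrite mul0r; exact: cvg_cst.
  have kz : 0 < kap r.2.
    by rewrite lt0r kap_ge0 andbT; apply: contra_neq z0; exact: kap_eq0.
  rewrite -[X in _ --> X]mulr1; apply: cvgMr; apply: cvg_near_cst; near=> n.
  rewrite /S !indicE !mem_set ?mulr1//.
    apply: ltW; near: n; exact: (near_infty_natSinv_lt (PosNum kz)).
  rewrite /B/= /close; apply/andP; split; near: n; exact: nbhs_infty_gtr.
- move=> n; have [iS hS] := truncated_energy (mB n) (Boo n) (mZ n) (iZ n).
  by rewrite -EFin_Rintegral// lee_fin.
Unshelve. all: by end_near. Qed.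

End limit.

Variables (T K : R) (u : Om -> R) (u0 : X -> R) (phi : R -> R).
Hypotheses (mu_ : measurable_fun setT u) (uK : forall p, `|u p| <= K).
Hypotheses (uz : forall p, ~~ (0 < p.2 < T) -> u p = 0).
Hypotheses (mu0 : measurable_fun setT u0) (u0K : forall x, `|u0 x| <= K).
Hypotheses (iu : m.-integrable setT (EFin \o u)) (iu0 : lebX.-integrable setT (EFin \o u0)).
Hypotheses (cphi : continuous phi) (phi0 : phi 0 = 0).
Hypotheses (nd : forall a b, a <= b -> phi a <= phi b).
Hypotheses (phiK : forall r, `|r| <= K -> `|phi r| <= K).
Hypothesis Hd : forall psi, test_function T psi ->
  \int[m]_p ((0 < p.2 < T)%R%:R * (u p * dt psi p + phi (u p) * LL mu psi p))
  + \int[lebX]_x (u0 x * psi (x, 0)) = 0.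

Lemma finite_energy : M.-integrable setT (EFin \o (fun r => dz r.2 (phi \o u) r.1 ^+ 2)).
Proof.
have [Phi [mPhi Phi0 sub]] := convex_primitive cphi nd.
have inv0 n : 0 < n.+1%:R^-1 :> R by rewrite invr_gt0.
have H n := energy_uniform kapi mu_ uK uz mu0 u0K iu iu0 cphi phi0 phiK mPhi Phi0 sub Hd
  (ltr0Sn R n) (inv0 n).
have {}H n : exists eta : R, 0 < eta <= n.+1%:R^-1 /\
    (M.-integrable setT (EFin \o (fun r => dz r.2 (aw T (phi \o u) n.+1%:R eta) r.1 ^+ 2)) /\
  \int[M]_r (dz r.2 (aw T (phi \o u) n.+1%:R eta) r.1 ^+ 2) <= 2 * (\int[lebX]_x Phi (u0 x)) + 1).
  by have [eta h1 h2] := H n; exists eta.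
have [eta He] := choice H.
have eta_n n : 0 < eta n <= n.+1%:R^-1 by have [] := He n.
have eta0 n : 0 < eta n by have /andP[] := eta_n n.
have mw : measurable_fun setT (phi \o u).
  by apply: measurableT_comp => //; exact: continuous_measurable_fun.
have wK p : `|(phi \o u) p| <= K by apply: phiK; exact: uK.
have wz p : ~~ (0 < p.2 < T) -> (phi \o u) p = 0 by move=> pT; rewrite /= uz.
have rk n := @kernel_bump R N (eta n) (eta0 n).
have ek n := @kernel_expk R N n.+1%:R (ltr0Sn R n).
pose a n := aw T (phi \o u) n.+1%:R (eta n).
have mcut : measurable_fun setT (fun p : Om => (0 < p.2 < T)%R%:R : R).
  have mI : measurable_fun setT (fun t : measurableTypeR R => (0 < t < T)%R%:R : R).
    by apply: (@measurable_predR _ _ `]0, T[%classic) => // t; rewrite /= in_itv.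
  exact: measurableT_comp mI measurable_snd.
have mA n := measurable_avg2 eta_n n mw.
have ma n : measurable_fun setT (a n) by exact: (measurable_funM mcut (mA n)).
have aE n z p : dz z (a n) p = (0 < p.2 < T)%R%:R * avg2 eta n (dz z (phi \o u)) p.
  have := dz_cut (fun t => (0 < t < T)%R%:R) (avg2 eta n (phi \o u)) (0, 0) z p.
  rewrite sh0 /= => E; rewrite (_ : a n = fun p => (0 < p.2 < T)%R%:R * avg2 eta n (phi \o u) p)//.
  rewrite E; congr (_ * _).
  rewrite /avg2 (avg_dz (ek n) z p (measurable_avg (rk n) mw) (fun q => avg_bounded (rk n) q mw wK)).
  by congr avg; apply/funext => q; exact: (avg_dz (rk n) z q mw wK).
apply: (limit_energy eta_n mw wK wz ma aE (C0 := 2 * (\int[lebX]_x Phi (u0 x)) + 1)).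
- by move=> n; have [_ []] := He n.
- by move=> n; have [_ []] := He n.
Qed.

End finite_energy.

(** * Reduction of the two notions of solution *)

Section test_integrals.
Context {R : realType} {N : nat}.
Notation X := ('rV[R]_N).
Notation Om := ('rV[R]_N * measurableTypeR R)%type.
Notation m := (@lebesgue_Q R N).
Notation lebX := (lebesgue_rV N).
Notation leb := (@lebesgue_measure R).
Variable mu : {sigma_finite_measure set X -> \bar R}.
Notation M := (lebesgue_Q \x mu)%E.
Hypothesis kapi : mu.-integrable setT (EFin \o kap).
Variables (T : R) (psi : X * R -> R).
Hypothesis psiT : test_function T psi.

Let cut (p : Om) : R := (0 < p.2 < T)%R%:R.

Lemma measurable_cut : measurable_fun setT cut.
Proof.
have mI : measurable_fun setT (fun t : measurableTypeR R => (0 < t < T)%R%:R : R).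
  by apply: (@measurable_predR _ _ `]0, T[%classic) => // s; rewrite /= in_itv.
exact: measurableT_comp mI measurable_snd.
Qed.

(** A test function is arbitrary at times outside [0, T[, while the integrals run over all of
    space-time. *)
Definition cutpsi (p : Om) : R := cut p * psi p.

Lemma dtE (p : X * R) : dt psi p = 'D_((0, 1) : X * R) psi p.
Proof.
case: p => x t; rewrite /dt derive1E /derive /=.
suff -> : (fun h : R => h^-1 *: (psi (x, h *: (1 : R) + t) - psi (x, t))) =
    (fun h : R => h^-1 *: (psi (h *: ((0, 1) : X * R) + (x, t)) - psi (x, t))) by [].
by apply/funext => h; congr (_ *: (psi _ - _)); congr pair; rewrite /= scaler0 add0r.
Qed.

Lemma dt_continuous : continuous (dt psi).
Proof.
have [_ h] := psiT.1 1%N; rewrite (_ : dt psi = 'D_((0, 1) : X * R) psi); first exact: h.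
by apply/funext => p; exact: dtE.
Qed.

(** Difference quotients in time need room on both sides, hence the open interval ]0, T[ where the
    spatial version allows t = 0. *)
Lemma dt_vanishes (K : set (X * R)) p : compact K ->
  (forall p, 0 <= p.2 < T -> ~ K p -> psi p = 0) -> 0 < p.2 < T -> ~ K p -> dt psi p = 0.
Proof.
move=> cK vK /andP[p0 pT] Kp.
have oK : open (~` K).
  by apply: closed_openC; apply: compact_closed => //; exact: norm_hausdorff.
have c0 : (fun e : R => e *: ((0, 1) : X * R) + p) @ (0:R) --> p.
  suff : (fun e : R => e *: ((0, 1) : X * R) + p) @ (0:R) --> 0 *: ((0, 1) : X * R) + p.
    by rewrite scale0r add0r.
  by apply: cvgD; [apply: cvgZ; [exact: cvg_id|exact: cvg_cst]|exact: cvg_cst].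
have nK : \forall e \near (0 : R), ~ K (e *: ((0, 1) : X * R) + p).
  have : nbhs p (~` K) by exact: open_nbhs_nbhs.
  exact: (c0 (~` K)).
have nT : \forall e \near (0 : R), 0 <= (e *: ((0, 1) : X * R) + p).2 < T.
  have e2 (e : R) : (e *: ((0, 1) : X * R) + p).2 = e + p.2.
    by rewrite /= /GRing.scale/= mulr1.
  near=> e; rewrite e2; apply/andP; split.
    by rewrite -lerBlDr sub0r; apply: ltW; near: e; apply: lt_nbhsr; rewrite oppr_lt0.
  by rewrite -ltrBrDr; near: e; apply: lt_nbhsl; rewrite subr_gt0.
rewrite dtE /derive; apply: cvg_lim => //.
apply: (@cvg_trans _ (cst (0:R) @ 0^')); last exact: cvg_cst.
apply: near_eq_cvg; near=> e => /=.
rewrite (vK p) ?(ltW p0)// vK ?subrr ?scaler0//.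
  by near: e; exact: nbhs_dnbhs.
by near: e; exact: nbhs_dnbhs.
Unshelve. all: by end_near. Qed.

(** The compact support is enclosed in an open ball [S]; differences vanish unless the point or one
    of its shifts lies in [S]. *)
Lemma test_support : exists (B : R) (S : set Om), [/\ 0 <= B, measurable S, (m S < +oo)%E &
  forall p, [/\ `|cutpsi p| <= B * \1_S p, `|cut p * dt psi p| <= B * \1_S p,
    forall z, `|dz z cutpsi p| ^+ 2 <= B * kap z * (\1_S p + \1_S (shx z p)) &
    forall z, `|ddz z cutpsi p| <= B * kap z * (\1_S p + \1_S (shx z p) + \1_S (shx (- z) p))]].
Proof.
have [B B0 hB] := test_bounds psiT.
have [_ [K [cK KT vK]]] := psiT.
have [B' [_ hB']] : bounded_set (dt psi @` K).
  apply: compact_bounded; apply: continuous_compact => //.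
  by apply: continuous_subspaceT; exact: dt_continuous.
have [Mk [_ hM]] := compact_bounded cK.
pose r := `|Mk| + 2.
pose S : set Om := ball ((0, 0) : X * R) r.
have KS p : K p -> S p.
  move=> Kp; rewrite /S -ball_normE/= sub0r normrN.
  apply: (@le_lt_trans _ _ (`|Mk| + 1)); last by rewrite ltrD2l ltr1n.
  by apply: (hM (`|Mk| + 1)) => //; rewrite (le_lt_trans (ler_norm _))// ltrDl.
have mS : measurable S by apply: open_measurable_prod; exact: ball_open.
(* Adding 1 gives the strict inequality with which [hB'] bounds the time derivative on [K]. *)
pose C := B + `|B'| + 1.
have C0 : 0 <= C by rewrite !addr_ge0.
have BC : B <= C by rewrite /C -addrA lerDl addr_ge0.
have cP p : cut p = 0 \/ (0 < p.2 < T /\ cut p = 1).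
  by rewrite /cut; case: (0 < p.2 < T); [right|left].
have psi0 p : ~ S p -> cutpsi p = 0.
  move=> Sp; rewrite /cutpsi; have [->|[/andP[p0 pT] ->]] := cP p; first by rewrite mul0r.
  by rewrite vK ?mulr0// ?(ltW p0)//; move/KS.
have indP p : S p -> \1_S p = 1 :> R by move=> h; rewrite indicE mem_set.
have dzE z p : dz z cutpsi p = cut p * dz z psi p.
  by have := dz_cut (fun t => (0 < t < T)%R%:R) psi (0, 0) z p; rewrite sh0.
have ddzE z p : ddz z cutpsi p = cut p * ddz z psi p.
  by have := ddz_cut (fun t => (0 < t < T)%R%:R) psi (0, 0) z p; rewrite sh0.
exists C, S; split => // [|p]; first exact: lebesgue_Q_ball.
have pE : p = (p.1, p.2) by case: p.
split.
- have [Sp|Sp] := pselect (S p); last by rewrite psi0// normr0 mulr_ge0.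
  rewrite indP// mulr1 /cutpsi; have [->|[/andP[p0 pT] ->]] := cP p; first by rewrite mul0r normr0.
  by rewrite mul1r; have [h _ _ _] := hB p.1 0 p.2 (introT andP (conj (ltW p0) pT)); rewrite -pE in h; exact: le_trans h BC.
- have [->|[pT ->]] := cP p; first by rewrite mul0r normr0 mulr_ge0.
  rewrite mul1r; have [Kp|Kp] := pselect (K p); last first.
    by rewrite (dt_vanishes cK vK pT Kp) normr0 mulr_ge0.
  rewrite indP ?mulr1; last exact: KS.
  apply: (hB' C); last by exists p.
  by rewrite /C (le_lt_trans (ler_norm _))// -addrA addrCA ltrDl ltr_wpDl.
- move=> z; have k0 := mulr_ge0 C0 (kap_ge0 z).
  have [[Sp Sp']|/not_andP nS] := pselect (~ S p /\ ~ S (shx z p)).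
    by rewrite /dz -/(shx z p) !psi0// subrr normr0 expr0n/= mulr_ge0// addr_ge0.
  apply: (@le_trans _ _ (C * kap z)); last first.
    rewrite ler_peMr//; case: nS => /contrapT h; rewrite (indP _ h).
      by rewrite lerDl.
    by rewrite lerDr.
  rewrite dzE; have [->|[/andP[p0 pT] ->]] := cP p; first by rewrite mul0r normr0 expr0n.
  have [_ h _ _] := hB p.1 z p.2 (introT andP (conj (ltW p0) pT)).
  rewrite -pE in h; rewrite mul1r /dz /sh/= addr0; apply: le_trans h _.
  by rewrite ler_wpM2r// kap_ge0.
- move=> z; have k0 := mulr_ge0 C0 (kap_ge0 z).
  have [[Sp [Sp' Sp'']]|nS] := pselect (~ S p /\ ~ S (shx z p) /\ ~ S (shx (- z) p)).
    rewrite /ddz -/(shx z p) -/(shx (- z) p) !psi0// addr0 mulr0 subr0 normr0.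
    by rewrite mulr_ge0// !addr_ge0.
  apply: (@le_trans _ _ (C * kap z)); last first.
    rewrite ler_peMr//; have {nS} : S p \/ S (shx z p) \/ S (shx (- z) p).
      apply: contrapT => h; apply: nS; split; first by move=> h'; apply: h; left.
      by split => h'; apply: h; right; [left|right].
    case=> [h|[h|h]]; rewrite (indP _ h).
    - by rewrite -addrA lerDl addr_ge0.
    - by rewrite addrAC lerDr addr_ge0.
    - by rewrite lerDr addr_ge0.
  rewrite ddzE; have [->|[/andP[p0 pT] ->]] := cP p.
    by rewrite mul0r normr0.
  have [_ _ _ h] := hB p.1 z p.2 (introT andP (conj (ltW p0) pT)).
  rewrite -pE in h; rewrite mul1r; apply: le_trans h _.
  by rewrite ler_wpM2r// kap_ge0.
Qed.

Lemma measurable_cutpsi : measurable_fun setT cutpsi.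
Proof. by apply: measurable_funM; [exact: measurable_cut|exact: test_measurable psiT]. Qed.

Lemma measurable_dt : measurable_fun setT (dt psi : Om -> R).
Proof. exact: continuous_measurable_prod dt_continuous. Qed.

Lemma LL_cutpsi p : LL mu cutpsi p = cut p * LL mu psi p.
Proof.
have dE z : ddz z cutpsi p = cut p * ddz z psi p.
  by have := ddz_cut (fun t => (0 < t < T)%R%:R) psi (0, 0) z p; rewrite sh0.
rewrite /LL [RHS]mulrCA; congr (_ * _); under eq_Rintegral do rewrite dE.
rewrite /cut; case: (boolP (0 < p.2 < T)) => [/andP[p0 pT]|_]; last first.
  rewrite mul0r; transitivity (\int[mu]_z (0 : R)); last by rewrite Rintegral_cst// mul0r.
  by apply: eq_Rintegral => z _; rewrite mul0r.
by rewrite mul1r; apply: eq_Rintegral => z _; rewrite mul1r.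
Qed.

Variables (w : Om -> R) (K : R).
Hypotheses (mw : measurable_fun setT w) (wK : forall p, `|w p| <= K).

Lemma test_forms : [/\ m.-integrable setT (EFin \o cutpsi),
  m.-integrable setT (EFin \o (fun p => cut p * dt psi p)),
  M.-integrable setT (EFin \o (fun r => dz r.2 cutpsi r.1 ^+ 2)),
  M.-integrable setT (EFin \o (fun r => w r.1 * ddz r.2 cutpsi r.1)) &
  exists2 C, 0 <= C & forall z p, `|ddz z cutpsi p| <= C * kap z].
Proof.
have [B [S [B0 mS Soo h]]] := test_support.
have iS := Rintegrable_indic mS Soo.
have mc := measurable_cutpsi.
have mind := measurable_ind mS.
have mk2 : measurable_fun setT (fun r : Om * X => kap r.2).
  exact: measurableT_comp (@measurable_kap R N) measurable_snd.
have mS1 : measurable_fun setT (fun r : Om * X => \1_S r.1 : R) by exact: measurableT_comp mind measurable_fst.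
have mS2 : measurable_fun setT (fun r : Om * X => \1_S (shx r.2 r.1) : R).
  exact: measurableT_comp mind measurable_shx2.
have mS3 : measurable_fun setT (fun r : Om * X => \1_S (shx (- r.2) r.1) : R).
  exact: measurableT_comp mind measurable_shxN2.
have iM : M.-integrable setT (EFin \o (fun r => B * kap r.2 *
    (\1_S r.1 + \1_S (shx r.2 r.1) + \1_S (shx (- r.2) r.1)))).
  have i3 z : m.-integrable setT (EFin \o (fun p => \1_S p + \1_S (shx z p) + \1_S (shx (- z) p))).
    by apply: RintegrableD; [apply: RintegrableD => //|]; exact: shx_integrable.
  apply: (@RintegrableX1 _ _ _ _ _ _ _ _ (fun z => (B * (3 * \int[m]_p (\1_S p))) * kap z)).
  - apply: measurable_funM; first exact: measurable_funM.
    by apply: measurable_funD => //; exact: measurable_funD.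
  - by move=> z; exact: (RintegrableZl (B * kap z) (i3 z)).
  - move=> z /=; under eq_Rintegral do rewrite ger0_norm ?mulr_ge0 ?kap_ge0 ?addr_ge0//.
    rewrite (RintegralZl _ measurableT (i3 z)).
    rewrite RintegralD//; [|by apply: RintegrableD => //; exact: shx_integrable|exact: shx_integrable].
    rewrite RintegralD//; last exact: shx_integrable.
    rewrite (shx_integral z mind) (shx_integral (- z) mind).
    by rewrite le_eqVlt; apply/orP; left; apply/eqP; ring.
  - exact: RintegrableZl.
split.
- apply: (le_Rintegrable mc _ (RintegrableZl B iS)) => p; by have [] := h p.
- apply: (le_Rintegrable _ _ (RintegrableZl B iS)).
    by apply: measurable_funM; [exact: measurable_cut|exact: measurable_dt].
  by move=> p; have [] := h p.
- apply: (le_Rintegrable _ _ iM); first by apply: measurable_funX; exact: measurable_dz2.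
  move=> r; have [_ _ h3 _] := h r.1; rewrite normrX; apply: le_trans (h3 r.2) _.
  by rewrite ler_wpM2l ?mulr_ge0 ?kap_ge0// lerDl.
- apply: (Rintegrable_bounded_mull (M := K)); first exact: measurableT_comp mw measurable_fst.
    by move=> r; exact: wK.
  apply: (le_Rintegrable _ _ iM); first exact: measurable_ddz2.
  by move=> r; have [_ _ _ h4] := h r.1.
- exists (3 * B) => [|z p]; first by rewrite mulr_ge0.
  have [_ _ _ h4] := h p; apply: le_trans (h4 z) _.
  have k0 := mulr_ge0 B0 (kap_ge0 z); rewrite (_ : 3 * B * kap z = B * kap z * 3); last by ring.
  rewrite ler_wpM2l//.
  have i1 q : \1_S q <= 1 :> R by rewrite indicE lern1 leq_b1.
  have := i1 p; have := i1 (shx z p); have := i1 (shx (- z) p); lra.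
Qed.

(** The test function takes the role of [p] in [form_LL], being the factor with controlled second
    differences; [w] is only bounded and of finite energy. *)
Lemma test_form_LL : M.-integrable setT (EFin \o (fun r => dz r.2 w r.1 ^+ 2)) ->
  M.-integrable setT (EFin \o (fun r => dz r.2 w r.1 * dz r.2 cutpsi r.1)) /\
  \int[M]_r (dz r.2 w r.1 * dz r.2 cutpsi r.1) = - 2 * \int[m]_p (cut p * (w p * LL mu psi p)).
Proof.
move=> iw; have [i1 _ i3 i4 [C C0 hC]] := test_forms.
have mc := measurable_cutpsi.
have iwp : M.-integrable setT (EFin \o (fun r => dz r.2 w r.1 * dz r.2 cutpsi r.1)).
  apply: (le_Rintegrable _ _ (RintegrableD iw i3)); first by apply: measurable_funM; exact: measurable_dz2.
  by move=> r; exact: normM_le_sqr.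
split => //.
rewrite (_ : \int[M]_r _ = \int[M]_r (dz r.2 cutpsi r.1 * dz r.2 w r.1)); last first.
  by apply: eq_Rintegral => r _; rewrite mulrC.
rewrite (form_LL kapi mc mw hC) => [||//|].
- by congr (_ * _); apply: eq_Rintegral => p _; rewrite LL_cutpsi mulrCA.
- by move: iwp; congr (_.-integrable _ _); apply/funext => r /=; rewrite mulrC.
- move=> z; exact: (Rintegrable_bounded_mull mw wK (shx_integrable z i1)).
Qed.

Lemma test_LL_integrable : m.-integrable setT (EFin \o (fun p => cut p * (w p * LL mu psi p))).
Proof.
have [i1 _ i3 i4 [C C0 hC]] := test_forms.
have [+ _] := integral_ddz_LL kapi measurable_cutpsi hC i4.
by congr (_.-integrable _ _); apply/funext => p /=; rewrite LL_cutpsi mulrCA.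
Qed.

End test_integrals.

(** By translation invariance a second difference of an integrable function has integral 0. This
    removes the constant [phi 0] from the distributional formulation. *)
Lemma test_LL_integral0 (R : realType) (N : nat)
    (mu : {sigma_finite_measure set 'rV[R]_N -> \bar R}) (T : R) (psi : 'rV[R]_N * R -> R) :
  mu.-integrable setT (EFin \o kap) -> test_function T psi ->
  \int[lebesgue_Q]_p ((0 < (p : 'rV[R]_N * measurableTypeR R).2 < T)%R%:R * LL mu psi p) = 0.
Proof.
move=> kapi psiT; have mc := measurable_cutpsi psiT.
have n1 (p : 'rV[R]_N * measurableTypeR R) : `|cst (1 : R) p| <= 1 by rewrite /cst normr1.
have [i1 _ i3 i4 [C C0 hC]] := @test_forms R N mu kapi T psi psiT (cst 1) 1 (measurable_cst _) n1.
have [_ E] := integral_ddz_LL kapi mc hC i4.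
have E0 : \int[(lebesgue_Q \x mu)%E]_r (cst 1 r.1 * ddz r.2 (cutpsi T psi) r.1) = 0.
  rewrite -(Rfubini2 i4).2; transitivity (\int[mu]_z (0 : R)); last by rewrite Rintegral_cst// mul0r.
  apply: eq_Rintegral => z _ /=.
  have j1 := shx_integrable z i1; have j2 := shx_integrable (- z) i1.
  transitivity (\int[lebesgue_Q]_p (cutpsi T psi (shx z p) + cutpsi T psi (shx (- z) p) - 2 * cutpsi T psi p)).
    by apply: eq_Rintegral => p _; rewrite mul1r.
  rewrite RintegralB//; [|exact: RintegrableD|exact: RintegrableZl].
  rewrite RintegralD// RintegralZl// !shx_integral//.
  by rewrite mulr2n mulrDl mul1r subrr.
move: E; rewrite E0 => /esym/eqP; rewrite mulf_eq0 pnatr_eq0/= => /eqP E.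
rewrite -[RHS]E; apply: eq_Rintegral => p _; rewrite mul1r LL_cutpsi//.
Qed.

Lemma aeI d (T : measurableType d) (R : realType) (mu : {measure set T -> \bar R})
    (P Q : T -> Prop) : {ae mu, forall x, P x} -> {ae mu, forall x, Q x} ->
  {ae mu, forall x, P x /\ Q x}.
Proof. by move=> aP aQ; apply: filterI. Qed.

(** * Iterated integrals with extended real values *)

Section fubini_Q.
Local Open Scope ereal_scope.
Context {R : realType} {N : nat}.
Variable F : 'rV[R]_N * measurableTypeR R -> \bar R.

Lemma tonelli_Q : measurable_fun setT F -> (forall p, 0 <= F p) ->
  \int[lebesgue_Q]_p F p = \int[lebesgue_measure]_t \int[lebesgue_rV N]_x F (x, t).
Proof. by move=> mF F0; rewrite /lebesgue_Q fubini_tonelli2. Qed.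

Lemma measurable_tonelli_Q : measurable_fun setT F -> (forall p, 0 <= F p) ->
  measurable_fun setT (fun t : measurableTypeR R => \int[lebesgue_rV N]_x F (x, t)).
Proof. by move=> mF F0; exact: measurable_fun_fubini_tonelli_G. Qed.

Lemma integrable_slice_Q : lebesgue_Q.-integrable setT F ->
  lebesgue_measure.-integrable setT (fun t : measurableTypeR R => \int[lebesgue_rV N]_x F (x, t)).
Proof.
move=> iF; have mF := measurable_int _ iF; have mG := measurable_fubini_G iF.
apply/integrableP; split => //.
apply: le_lt_trans ((integrable21ltyP (lebesgue_rV N) lebesgue_measure mF).1 iF).
apply: ge0_le_integral => //.
- exact: measurableT_comp.
- apply: (measurable_fun_fubini_tonelli_G (fun p => `|F p|)) => //.
  exact: measurableT_comp.
- move=> t _; apply: le_abse_integral => //.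
  have ht : measurable_fun setT (fun x : 'rV[R]_N => (x, t)) by exact: measurable_fun_pair.
  exact: measurableT_comp mF ht.
Qed.

Lemma fubini_Q : lebesgue_Q.-integrable setT F ->
  \int[lebesgue_measure]_t \int[lebesgue_rV N]_x F (x, t) = \int[lebesgue_Q]_p F p.
Proof. by move=> iF; exact: integral21_prod_meas1 iF. Qed.

End fubini_Q.

Section fubini_M.
Local Open Scope ereal_scope.
Context {R : realType} {N : nat}.
Notation Om := ('rV[R]_N * measurableTypeR R)%type.
Variable mu : {sigma_finite_measure set 'rV[R]_N -> \bar R}.
Variable G : Om * 'rV[R]_N -> \bar R.

Lemma tonelli_M (k : R) : (0 <= k)%R -> measurable_fun setT G -> (forall r, 0 <= G r) ->
  k%:E * \int[lebesgue_Q \x mu]_r G r =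
    \int[lebesgue_measure]_t (k%:E * \int[lebesgue_rV N]_x \int[mu]_z G (x, t, z)).
Proof.
move=> k0 mG G0; pose F (p : Om) := \int[mu]_z G (p, z).
have mF : measurable_fun setT F by exact: measurable_fun_fubini_tonelli_F.
have F0 p : 0 <= F p by apply: integral_ge0 => z _; exact: G0.
rewrite ge0_integralZl//; last 2 first.
- exact: measurable_tonelli_Q mF F0.
- by move=> t _; apply: integral_ge0 => x _; exact: F0.
by rewrite fubini_tonelli1// (tonelli_Q mF F0).
Qed.

Lemma fubini_M : (lebesgue_Q \x mu).-integrable setT G ->
  \int[lebesgue_measure]_t \int[lebesgue_rV N]_x \int[mu]_z G (x, t, z) =
    \int[lebesgue_Q \x mu]_r G r /\
  lebesgue_measure.-integrable setT
    (fun t : measurableTypeR R => \int[lebesgue_rV N]_x \int[mu]_z G (x, t, z)).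
Proof.
move=> iG; have iF := integrable_fubini_F iG.
by split; [rewrite -(integral12_prod_meas1 iG) -(fubini_Q iF)|exact: integrable_slice_Q iF].
Qed.

End fubini_M.

(** * Both formulations in terms of bounded representatives *)

Section assembly.
Context {R : realType} {N : nat}.
Notation X := ('rV[R]_N).
Notation Om := ('rV[R]_N * measurableTypeR R)%type.
Notation m := (@lebesgue_Q R N).
Notation lebX := (lebesgue_rV N).
Notation leb := (@lebesgue_measure R).
Variable mu : {sigma_finite_measure set X -> \bar R}.
Notation M := (lebesgue_Q \x mu)%E.
Hypotheses (mu_levy : levy_integrable mu) (mu_even : even_measure mu).

Let kapi : mu.-integrable setT (EFin \o kap). Proof. exact: kap_integrable. Qed.

(** A null set of space-time has null preimages under the projection and, since translations
    preserve measure, under the shift by [z]. Changing a function on a null set thus leaves its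
    differences unchanged almost everywhere. *)
Lemma null_slices (P : Om -> Prop) : {ae m, forall p, P p} ->
  {ae M, forall r, P r.1} /\ {ae M, forall r, P (shx r.2 r.1)}.
Proof.
move=> [A [mA A0 PA]].
have null (g : Om * X -> Om) : measurable_fun setT g ->
    (forall z, mpres m (fun p => g (p, z))) -> M (g @^-1` A) = 0%E.
  move=> mg pg.
  have mgA : measurable (g @^-1` A) by rewrite -[X in measurable X]setTI; exact: mg.
  have mI : measurable_fun setT (fun r => (\1_A (g r))%:E : \bar R).
    by apply/measurable_EFinP; exact: measurableT_comp (measurable_ind mA) mg.
  have -> : M (g @^-1` A) = (\int[M]_r (\1_A (g r))%:E)%E.
    transitivity (\int[M]_r (\1_(g @^-1` A) r)%:E)%E; last by [].
    by rewrite integral_indic ?setIT.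
  rewrite fubini_tonelli2//.
  transitivity (\int[mu]_z (0 : \bar R))%E; last by rewrite integral0.
  apply: eq_integral => z _; rewrite /fubini_G.
  have [_ h] := pg z; rewrite (h (fun p => (\1_A p)%:E)) => [||p].
  - by rewrite integral_indic// setIT.
  - by apply/measurable_EFinP; exact: measurable_ind.
  - by rewrite lee_fin.
split.
- exists (fst @^-1` A); split.
  + by rewrite -[X in measurable X]setTI; exact: measurable_fst.
  + by apply: null; [exact: measurable_fst|move=> z; split => //; exact: measurable_id].
  + by move=> r /= h; apply: PA => /= h'; exact: h.
- exists ((fun r : Om * X => shx r.2 r.1) @^-1` A); split.
  + by rewrite -[X in measurable X]setTI; exact: measurable_shx2.
  + apply: null; [exact: measurable_shx2|exact: mpres_shx].
  + by move=> r /= h; apply: PA => /= h'; exact: h.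
Qed.

Lemma energyE (f g : X -> R) : energy mu f g =
  (2^-1%:E * \int[lebX]_x \int[mu]_z ((f (x + z) - f x) * (g (x + z) - g x))%:E)%E.
Proof.
rewrite /energy; congr (_ * _)%E; apply: eq_integral => x _.
rewrite integral_mkcond; apply: eq_integral => z _; rewrite patchE.
case: ifPn => // /negP z0.
have -> : z = 0 by apply: contrapT => /eqP zn0; apply: z0; rewrite inE.
by rewrite addr0 !subrr mul0r.
Qed.

Variables (T : R) (hT : 0 < T).

Let cut (p : Om) : R := (0 < p.2 < T)%R%:R.
Let mcut : measurable_fun setT cut. Proof. exact: measurable_cut. Qed.

Lemma measurable_Q : measurable (Q_ T : set Om).
Proof.
rewrite (_ : Q_ T = setT `&` snd @^-1` `]0, T[%classic :> set Om).
  exact: measurable_snd.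
by rewrite setTI; apply/seteqP; split => p /=; rewrite in_itv.
Qed.

Variables (phi : R -> R) (u : X * R -> R) (u0 : X -> R).
Hypotheses (mu_ : measurable_fun (Q_ T) (u : Om -> R)).
Hypotheses (mphi : measurable_fun setT phi).
Variables (ub w : Om -> R) (u0b : X -> R) (c K : R).
Hypotheses (mub : measurable_fun setT ub) (ubK : forall p, `|ub p| <= K).
Hypotheses (mw : measurable_fun setT w) (wK : forall p, `|w p| <= K).
Hypotheses (ubz : forall p, ~~ (0 < p.2 < T) -> ub p = 0).
Hypotheses (wz : forall p, ~~ (0 < p.2 < T) -> w p = 0).
Hypothesis ae_u : {ae m, forall p, 0 < p.2 < T -> u p = ub p /\ phi (u p) = w p + c}.
Hypotheses (iu0b : lebX.-integrable setT (EFin \o u0b)).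
Hypotheses (mu0_ : measurable_fun setT u0) (ae_u0 : {ae lebX, forall x, u0 x = u0b x}).

Let uh : Om -> R := (u : Om -> R) \_ (Q_ T).
Let vh : Om -> R := (phi \o u : Om -> R) \_ (Q_ T).

Let patchT (f : Om -> R) p : 0 < p.2 < T -> (f \_ (Q_ T)) p = f p.
Proof. by move=> pT; rewrite patchE mem_set. Qed.

Let patchF (f : Om -> R) p : ~~ (0 < p.2 < T) -> (f \_ (Q_ T)) p = 0.
Proof. by move=> pT; rewrite patchE memNset//; exact/negP. Qed.

Let dz_vh x t z : 0 < t < T -> dz z vh (x, t) = phi (u (x + z, t)) - phi (u (x, t)).
Proof. by move=> tT; rewrite /dz /sh /vh addr0 !patchT. Qed.

Let dz_vh0 x t z : ~~ (0 < t < T) -> dz z vh (x, t) = 0.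
Proof. by move=> tT; rewrite /dz /sh /vh addr0 !patchF// subrr. Qed.

Let muh : measurable_fun setT uh.
Proof. exact: (measurable_restrictT u measurable_Q).1 mu_. Qed.

Let mphiu : measurable_fun (Q_ T) (phi \o u : Om -> R).
Proof. exact: measurableT_comp. Qed.

Let mvh : measurable_fun setT vh.
Proof. exact: (measurable_restrictT (phi \o u) measurable_Q).1 mphiu. Qed.

Let ae_dz : {ae M, forall r, dz r.2 vh r.1 = dz r.2 w r.1}.
Proof.
have [h1 h2] := null_slices ae_u; have h12 : {ae M, forall r,
    (0 < r.1.2 < T -> u r.1 = ub r.1 /\ phi (u r.1) = w r.1 + c) /\
    (0 < (shx r.2 r.1).2 < T -> u (shx r.2 r.1) = ub (shx r.2 r.1) /\ phi (u (shx r.2 r.1)) = w (shx r.2 r.1) + c)}.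
  exact: aeI h1 h2.
apply: aeS h12 => -[p z] /= [k1 k2]; rewrite /dz -/(shx z p).
case: (boolP (0 < p.2 < T)) => pT.
  have pT' : 0 < (shx z p).2 < T by rewrite /= addr0.
  by rewrite /vh !patchT//= (k1 pT).2 (k2 pT').2; ring.
have pT' : ~~ (0 < (shx z p).2 < T) by rewrite /= addr0.
by rewrite /vh !patchF// !wz.
Qed.

Let mD (f : Om -> R) : measurable_fun setT f -> measurable_fun setT (fun r : Om * X => dz r.2 f r.1).
Proof. exact: measurable_dz2. Qed.

(** Tonelli's theorem identifies the time integral of the energy with half the integral over [M];
    the constant [c] disappears from the differences. *)
Lemma L2_energyP : L2_energy T mu (phi \o u) <->
  M.-integrable setT (EFin \o (fun r => dz r.2 w r.1 ^+ 2)).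
Proof.
have ndz r : (0 <= (dz r.2 vh r.1 ^+ 2)%:E)%E by rewrite lee_fin sqr_ge0.
have mdz : measurable_fun setT (fun r : Om * X => (dz r.2 vh r.1 ^+ 2)%:E).
  by apply/measurable_EFinP; apply: measurable_funX; exact: mD.
have E : (\int[leb]_(t in `]0%R, T[) energy mu (fun x => (phi \o u) (x, t)) (fun x => (phi \o u) (x, t)) =
    2^-1%:E * \int[M]_r (dz r.2 w r.1 ^+ 2)%:E)%E.
  have -> : (\int[M]_r (dz r.2 w r.1 ^+ 2)%:E = \int[M]_r (dz r.2 vh r.1 ^+ 2)%:E)%E.
    apply: ae_eq_integral => //.
      by apply/measurable_EFinP; apply: measurable_funX; exact: mD.
    by apply: aeS ae_dz => r -> _.
  have h2 : 0 <= 2^-1 :> R by rewrite invr_ge0.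
  rewrite (@tonelli_M R N mu (fun r => (dz r.2 vh r.1 ^+ 2)%:E) _ h2 mdz ndz).
  rewrite integral_mkcond; apply: eq_integral => t _; rewrite patchE.
  case: (boolP (0 < t < T)) => tT.
    rewrite mem_set; last by rewrite /= in_itv.
    rewrite energyE; congr (_ * _)%E; apply: eq_integral => x _; apply: eq_integral => z _.
    by rewrite dz_vh// expr2.
  rewrite memNset; last by rewrite /= in_itv/=; exact/negP.
  rewrite integral0_eq ?mule0// => x _.
  rewrite integral0_eq// => z _.
  by rewrite dz_vh0// expr0n.
split.
- move=> [_]; rewrite E => h; apply: ge0_RintegrableE.
  + by apply: measurable_funX; exact: mD.
  + by move=> r; exact: sqr_ge0.
  + move: h; apply: contraTT; rewrite -!leNgt !leye_eq => /eqP ->.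
    by rewrite gt0_muley// lte_fin invr_gt0.
- move=> iw; split; first exact: mphiu.
  by rewrite E -EFin_Rintegral// -EFinM ltry.
Qed.

Section test.
Variable psi : X * R -> R.
Hypothesis psiT : test_function T psi.

Lemma initial_term : (\int[lebX]_x (u0 x * psi (x, 0))%:E)%E = (\int[lebX]_x (u0b x * psi (x, 0)))%:E.
Proof.
have [B B0 h] := test_bounds psiT.
have mp : measurable_fun setT (fun x => psi (x, 0)).
  have h0 : measurable_fun setT (fun x : X => (x, 0) : Om) by exact: measurable_fun_pair.
  exact: (measurableT_comp (test_measurable psiT) h0).
have pB x : `|psi (x, 0)| <= B by have [] := h x 0 0 (introT andP (conj (lexx 0) hT)).
have mu0b := integrable_measurable iu0b.
rewrite EFin_Rintegral; last first.
  have := Rintegrable_bounded_mull mp pB iu0b; congr (_.-integrable _ _).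
  by apply/funext => x /=; rewrite mulrC.
apply: ae_eq_integral => //; [exact/measurable_EFinP/measurable_funM..|].
by apply: aeS ae_u0 => x -> _.
Qed.

(** The common value of both formulations without the initial term; it is real, whereas the
    formulations are written with extended integrals. *)
Let J : R := \int[m]_p (cut p * (ub p * dt psi p + w p * LL mu psi p)).

Let i_dt : m.-integrable setT (EFin \o (fun p => ub p * (cut p * dt psi p))).
Proof.
have [_ i2 _ _ _] := test_forms kapi psiT mw wK.
exact: (Rintegrable_bounded_mull mub ubK i2).
Qed.

Let i_LL : m.-integrable setT (EFin \o (fun p => cut p * (w p * LL mu psi p))).
Proof. exact: (@test_LL_integrable _ _ _ kapi _ _ psiT _ _ mw wK). Qed.

Let JE : J = \int[m]_p (ub p * (cut p * dt psi p)) + \int[m]_p (cut p * (w p * LL mu psi p)).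
Proof. by rewrite -RintegralD//; apply: eq_Rintegral => p _; ring. Qed.

Let mdt : measurable_fun setT (dt psi : Om -> R). Proof. exact: (measurable_dt psiT). Qed.

Lemma distributional_term :
  (\int[m]_(p in Q_ T) (u p * dt psi p + phi (u p) * levy_operator mu (fun x => psi (x, p.2)) p.1)%:E)%E =
  J%:E.
Proof.
have i_c : m.-integrable setT (EFin \o (fun p : Om => cut p * (c * LL mu psi p))).
  exact: (@test_LL_integrable _ _ _ kapi _ _ psiT (cst c) `|c| (measurable_cst _) (fun p => lexx _)).
have I0 : \int[m]_p (cut p * (c * LL mu psi p)) = 0.
  have h0 := test_LL_integral0 kapi psiT.
  have i1 := @test_LL_integrable _ _ _ kapi _ _ psiT (cst 1) `|1| (measurable_cst _) (fun p => lexx _).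
  transitivity (\int[m]_p (c * (cut p * (cst 1 p * LL mu psi p)))).
    by apply: eq_Rintegral => p _; rewrite /cst; ring.
  rewrite RintegralZl// (_ : \int[m]_p _ = 0) ?mulr0// -[RHS]h0.
  by apply: eq_Rintegral => p _; rewrite /cst mul1r.
rewrite -[J]addr0 -I0 JE -!RintegralD//; last exact: RintegrableD.
rewrite EFin_Rintegral; last by apply: RintegrableD => //; exact: RintegrableD.
rewrite [LHS]integral_mkcond.
transitivity (\int[m]_p (uh p * (cut p * dt psi p) + cut p * (vh p * LL mu psi p))%:E)%E.
  apply: eq_integral => p _; rewrite patchE; case: (boolP (0 < p.2 < T)) => pT.
    rewrite mem_set//; have /andP[p0 p1] := pT; rewrite (levy_operatorE mu_levy mu_even psiT) ?(ltW p0)//.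
    by rewrite /uh /vh !patchT// /cut pT !mul1r -surjective_pairing.
  rewrite memNset; last exact/negP.
  rewrite /uh /cut (patchF (u : Om -> R) pT) (negbTE pT) mul0r add0r.
  by rewrite mul0r.
have mL := measurable_LL mu (test_measurable psiT).
apply: ae_eq_integral => //.
- apply/measurable_EFinP; apply: measurable_funD.
    by apply: measurable_funM => //; exact: measurable_funM.
  by apply: measurable_funM => //; exact: measurable_funM.
- exact: (measurable_int _ (RintegrableD (RintegrableD i_dt i_LL) i_c)).
- apply: aeS ae_u => p hp _ /=; congr EFin; rewrite /uh /vh /cut.
  case: (boolP (0 < p.2 < T)) => pT; last by rewrite patchF// ubz// !mul0r !addr0.
  by rewrite !patchT//= (hp pT).2 (hp pT).1; ring.
Qed.

(** The energy is half of an integral over [M] and [test_form_LL] carries the factor -2, so that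
    minus the energy is the pairing of [w] with the operator. *)
Lemma energy_term : M.-integrable setT (EFin \o (fun r => dz r.2 w r.1 ^+ 2)) ->
  (\int[leb]_(t in `]0%R, T[)
     (\int[lebX]_x (u (x, t) * dt psi (x, t))%:E
      - energy mu (fun x => phi (u (x, t))) (fun x => psi (x, t))))%E = J%:E.
Proof.
move=> iw.
have [iwp Ewp] := test_form_LL kapi psiT mw wK iw.
pose f1 p := uh p * (cut p * dt psi p).
pose f2 r := dz r.2 vh r.1 * dz r.2 (cutpsi T psi) r.1.
have mc := measurable_cutpsi psiT.
have mf1 : measurable_fun setT f1 by apply: measurable_funM => //; exact: measurable_funM.
have mf2 : measurable_fun setT f2 by apply: measurable_funM; exact: mD.
have ae1 : {ae m, forall p, ub p * (cut p * dt psi p) = f1 p}.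
  apply: aeS ae_u => p hp; rewrite /f1 /uh.
  case: (boolP (0 < p.2 < T)) => pT; last by rewrite patchF// ubz.
  by rewrite !patchT// (hp pT).1.
have ae2 : {ae M, forall r, dz r.2 w r.1 * dz r.2 (cutpsi T psi) r.1 = f2 r}.
  by apply: aeS ae_dz => r hr; rewrite /f2 hr.
have if1 := ae_eq_Rintegrable mf1 ae1 i_dt.
have if2 := ae_eq_Rintegrable mf2 ae2 iwp.
have I1 : (\int[m]_p (f1 p)%:E = (\int[m]_p (ub p * (cut p * dt psi p)))%:E)%E.
  by rewrite -EFin_Rintegral//; congr EFin; apply/esym; apply: ae_eq_Rintegral => //; exact: integrable_measurable i_dt.
have I2 : (\int[M]_r (f2 r)%:E = (- 2 * \int[m]_p (cut p * (w p * LL mu psi p)))%:E)%E.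
  rewrite -EFin_Rintegral// -Ewp; congr EFin; apply/esym; apply: ae_eq_Rintegral => //.
  exact: integrable_measurable iwp.
have iG1 := @integrable_slice_Q R N (EFin \o f1) if1.
have [E2 iG2] := @fubini_M R N mu (EFin \o f2) if2.
rewrite [LHS]integral_mkcond.
transitivity (\int[leb]_t (\int[lebX]_x (EFin \o f1) (x, t)
   - 2^-1%:E * \int[lebX]_x \int[mu]_z (EFin \o f2) (x, t, z)))%E.
  apply: eq_integral => t _; rewrite patchE.
  case: (boolP (0 < t < T)) => tT.
    rewrite mem_set; last by rewrite /= in_itv.
    rewrite energyE; congr (_ - _ * _)%E; apply: eq_integral => x _.
      by rewrite /f1 /uh /cut/= patchT// tT mul1r.
    apply: eq_integral => z _ /=.
    by rewrite /f2 dz_vh// /dz /cutpsi /sh /= addr0 tT !mul1r.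
  rewrite memNset; last by rewrite /= in_itv/=; exact/negP.
  rewrite integral0_eq ?add0e; last by move=> x _; rewrite /f1 /uh/= patchF// mul0r.
  rewrite integral0_eq ?mule0 ?oppe0// => x _.
  rewrite integral0_eq// => z _.
  by rewrite /= /f2 /= dz_vh0// mul0r.
rewrite integralB//; last exact: integrableZl.
rewrite integralZl// fubini_Q// E2.
rewrite (_ : integral _ _ _ = \int[m]_p (f1 p)%:E)%E// I1.
rewrite (_ : integral _ _ _ = \int[M]_r (f2 r)%:E)%E// I2.
by rewrite -EFinM -EFinB JE; congr EFin; field.
Qed.

End test.

End assembly.

Section sigma_finite_measure_of.
Context d (T : measurableType d) (R : realType).
Variables (mu : {measure set T -> \bar R}) (sf : sigma_finite setT mu).

(** A copy of [mu] indexed by a proof, so that the sigma-finite structure can be attached to it. *)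
Definition sigma_finite_of of sigma_finite setT mu : set T -> \bar R := mu.

HB.instance Definition _ := Measure.on (sigma_finite_of sf).
HB.instance Definition _ := Measure_isSigmaFinite.Build _ _ _ (sigma_finite_of sf) sf.

End sigma_finite_measure_of.

Section clamp.
Context {R : realType}.
Variable B : R.
Hypothesis B0 : 0 <= B.

Definition clamp (r : R) : R := Num.max (- B) (Num.min B r).

Lemma clamp_le r : `|clamp r| <= B.
Proof.
rewrite /clamp ler_norml le_max lexx/= ge_max ge_min lexx/= andbT.
by rewrite (le_trans _ B0)// oppr_le0.
Qed.

Lemma clamp_id r : `|r| <= B -> clamp r = r.
Proof. by rewrite ler_norml /clamp => /andP[h1 h2]; rewrite min_r// max_r. Qed.

Lemma clamp_norm r : `|clamp r| <= `|r|.
Proof.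
have [h|h] := leP `|r| B; first by rewrite clamp_id.
by apply: le_trans (clamp_le r) _; exact: ltW.
Qed.

Lemma clamp_mono r s : r <= s -> clamp r <= clamp s.
Proof. by move=> rs; rewrite /clamp; apply: le_max2 => //; apply: le_min2. Qed.

Lemma continuous_clamp : continuous clamp.
Proof.
move=> r; have cm : {for r, continuous ((cst B : R -> R^o) \min (id : R -> R^o))}.
  by apply: continuous_min; [exact: cvg_cst|exact: cvg_id].
exact: (@continuous_max R R (cst (- B)) _ r (cvg_cst _) cm).
Qed.

End clamp.

(* Off null sets, u is the bounded function ub and phi u is phi1 ub + phi 0,
   with phi1 bounded and vanishing at 0. *)
Lemma energy_distributional (R : realType) (N : nat) (T : R) (hT : 0 < T)
    (phi : R -> R) (phi_cont : continuous phi)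
    (phi_nd : forall a b : R, a <= b -> phi a <= phi b)
    (mu : {sigma_finite_measure set 'rV[R]_N -> \bar R})
    (mu_even : even_measure mu)
    (mu_levy : levy_integrable mu)
    (u0 : 'rV[R]_N -> R) (u0_L1 : L1_rV u0) (u0_Linfty : Linfty_rV u0)
    (u : 'rV[R]_N * R -> R) (u_L1 : L1_Q T u) (u_Linfty : Linfty_Q T u) :
  energy_solution T mu phi u0 u <-> distributional_solution T mu phi u0 u.
Proof.
have kapi := kap_integrable mu_levy.
have [mu_ [Mu hMu]] := u_Linfty; have [mu0_ [M0 hM0]] := u0_Linfty.
pose B := `|Mu| + `|M0|; have B0 : 0 <= B by exact: addr_ge0.
pose ub : 'rV[R]_N * measurableTypeR R -> R := (clamp B \o u) \_ (Q_ T).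
pose u0b := clamp B \o u0.
pose phi1 r := phi (clamp B r) - phi 0.
(* By monotonicity |phi| is at most |phi (- B)| + |phi B| on [-B, B]; the last term accounts for
   subtracting [phi 0]. *)
pose B1 := `|phi (- B)| + `|phi B| + `|phi 0|.
pose K := B + B1.
have B10 : 0 <= B1 by rewrite !addr_ge0.
have BK : B <= K by rewrite lerDl.
have clamp0 : clamp B 0 = 0 by rewrite clamp_id// normr0.
have mclamp : measurable_fun setT (clamp B).
  by apply: continuous_measurable_fun; exact: continuous_clamp.
have cphi1 : continuous phi1.
  move=> r; apply: cvgB; last exact: cvg_cst.
  by apply: continuous_comp; [exact: continuous_clamp|exact: phi_cont].
have phi10 : phi1 0 = 0 by rewrite /phi1 clamp0 subrr.
have nd1 a b : a <= b -> phi1 a <= phi1 b.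
  by move=> ab; rewrite lerD2r; apply: phi_nd; exact: clamp_mono.
have phi1K r : `|phi1 r| <= K.
  apply: (@le_trans _ _ B1); last by rewrite lerDr.
  apply: le_trans (ler_normB _ _) _; rewrite lerD2r.
  have := clamp_le B0 r; rewrite ler_norml => /andP[/phi_nd h1 /phi_nd h2].
  have := ler_norm (phi B); have := ler_norm (- phi (- B)); rewrite normrN => h3 h4.
  have := normr_ge0 (phi B); have := normr_ge0 (phi (- B)) => h5 h6.
  by rewrite ler_norml; apply/andP; split; lra.
have mQ := @measurable_Q R N T.
have mub : measurable_fun setT ub.
  exact: (measurable_restrictT _ mQ).1 (measurableT_comp mclamp mu_).
have ubE p : 0 < p.2 < T -> ub p = clamp B (u p) by move=> pT; rewrite /ub patchE mem_set.
have ubz p : ~~ (0 < p.2 < T) -> ub p = 0.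
  by move=> pT; rewrite /ub patchE memNset//; exact/negP.
have ubB p : `|ub p| <= B.
  case: (boolP (0 < p.2 < T)) => pT; last by rewrite ubz// normr0.
  by rewrite ubE//; exact: (clamp_le B0).
have ubK p : `|ub p| <= K by exact: le_trans (ubB p) BK.
have u0bK x : `|u0b x| <= K by exact: le_trans (clamp_le B0 _) BK.
have mu0b : measurable_fun setT u0b by exact: measurableT_comp.
have iub : lebesgue_Q.-integrable setT (EFin \o ub).
  pose uh : 'rV[R]_N * measurableTypeR R -> R := u \_ (Q_ T).
  have iuh : lebesgue_Q.-integrable setT (EFin \o uh).
    by have := (integrable_mkcond _ mQ).1 u_L1; rewrite restrict_EFin.
  apply: le_Rintegrable (integrable_norm iuh) => // p.
  case: (boolP (0 < p.2 < T)) => pT; last by rewrite ubz// normr0 /=.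
  have uhE : uh p = u p by rewrite /uh patchE mem_set.
  by rewrite ubE//= uhE; exact: (clamp_norm B0).
have iu0b : (lebesgue_rV N).-integrable setT (EFin \o u0b).
  by apply: le_Rintegrable (integrable_norm u0_L1) => // x; exact: (clamp_norm B0).
have mw : measurable_fun setT (phi1 \o ub).
  by apply: measurableT_comp => //; exact: continuous_measurable_fun.
have wK p : `|(phi1 \o ub) p| <= K by exact: phi1K.
have wz p : ~~ (0 < p.2 < T) -> (phi1 \o ub) p = 0 by move=> pT; rewrite /= ubz.
have ae_u : {ae lebesgue_Q, forall p : 'rV[R]_N * measurableTypeR R, 0 < p.2 < T ->
    u p = ub p /\ phi (u p) = (phi1 \o ub) p + phi 0}.
  apply: aeS hMu => p hp pT.
  have uB : `|u p| <= B.
    apply: le_trans (hp pT) _; apply: le_trans (ler_norm _) _.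
    by rewrite lerDl.
  by rewrite /= ubE// clamp_id//; split => //; rewrite /phi1 clamp_id// subrK.
have ae_u0 : {ae lebesgue_rV N, forall x, u0 x = u0b x}.
  apply: aeS hM0 => x hx; rewrite /u0b /= clamp_id//.
  by apply: le_trans hx _; apply: le_trans (ler_norm _) _; rewrite lerDr.
have mphi : measurable_fun setT phi by exact: continuous_measurable_fun.
have ET psi (psiT : test_function T psi) :=
  energy_term mu_levy mu_ mphi mub ubK mw wK ubz wz ae_u psiT.
have DT psi (psiT : test_function T psi) :=
  distributional_term mu_levy mu_even mu_ mphi mub ubK mw wK ubz ae_u psiT.
have IT psi (psiT : test_function T psi) := initial_term hT iu0b mu0_ ae_u0 psiT.
have L2 := L2_energyP mu mu_ mphi mw wz ae_u.
split=> [[hl /L2 iw he]|[hl hd]].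
- split => // psi psiT; have := he psi psiT.
  by rewrite ET// IT// DT// IT.
(* Finite energy has to be established before [energy_term] applies; from then on the two
   formulations are the same equation. *)
- have iw : (lebesgue_Q \x mu)%E.-integrable setT (EFin \o (fun r => dz r.2 (phi1 \o ub) r.1 ^+ 2)).
    apply: (finite_energy kapi mub ubK ubz mu0b u0bK iub iu0b cphi1 phi10 nd1 (fun r _ => phi1K r)) => psi psiT.
    have := hd psi psiT; rewrite DT// IT// -EFinD => /eqP.
    by rewrite eqe => /eqP.
  split => //; first exact/L2.
  by move=> psi psiT; have := hd psi psiT; rewrite ET// IT// DT// IT.
Qed.

Theorem corollary2p18 (R : realType) (N : nat) (hN : (0 < N)%N)
    (T : R) (hT : 0 < T)
    (phi : R -> R) (phi_cont : continuous phi)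
    (phi_nd : forall a b : R, a <= b -> phi a <= phi b)
    (mu : {measure set 'rV[R]_N -> \bar R})
    (mu_radon : radon_punctured mu) (mu_even : even_measure mu)
    (mu_levy : levy_integrable mu)
    (u0 : 'rV[R]_N -> R) (u0_L1 : L1_rV u0) (u0_Linfty : Linfty_rV u0)
    (u : 'rV[R]_N * R -> R) (u_L1 : L1_Q T u) (u_Linfty : Linfty_Q T u)
    (u_C : C_L1loc T u) :
  energy_solution T mu phi u0 u <-> distributional_solution T mu phi u0 u.
Proof.
(* Product measures require sigma-finiteness, which follows from the null origin and the Levy
   condition. *)
have [mu0 _ _] := mu_radon; have sf := levy_sigma_finite mu0 mu_levy.
exact: (@energy_distributional R N T hT phi phi_cont phi_nd (sigma_finite_of sf)
  mu_even mu_levy u0 u0_L1 u0_Linfty u u_L1 u_Linfty).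
Qed.
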